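(* Let $\Omega\subset\mathbb{R}^n$ be an open connected set and let $\rho$ be a symmetric quasi-metric on $\Omega$ whose balls are Lebesgue measurable and which is compatible with the Euclidean distance in the sense given in the context. Fix $1<p<\infty$ and $1<t\le\infty$, and let $Q$ be a measurable function on $\Omega$ with values in the symmetric positive semi-definite $n\times n$ matrices such that $Q\in L^{\frac p2}_{\mathrm{loc}}(\Omega)$. Suppose that, for some $\sigma\ge1$ and some $s>p\sigma'$ (with a common function $r_1$), the cutoff condition of order $s$, the local Poincaré property of order $p$ with gain $t'=\frac{s}{s-p}$, and the local Sobolev property of order $p$ with gain $\sigma$ hold in $\Omega$. Let $\Theta\Subset\Omega$ be open and let $q\in[p',\infty)\cap(p\sigma',\infty)$. Then there exists a positive constant $C$ such that for every $\varphi\in L^q(\Theta)$, every $\tau\in(0,1)$, and every weak solution $\vec{\mathbf u}_\tau=(u_\tau,\vec g_\tau)\in\widehat H^{1,p}_{Q,0}(\Theta)$ of the Dirichlet problem $$\operatorname{div}\big(|\sqrt Q\nabla u|^{p-2}Q\nabla u\big)-\tau|u|^{p-2}u=\varphi\ \text{ in }\Theta,\qquad u=0\ \text{ on }\partial\Theta,$$ one has $$\operatorname*{ess\,sup}_{x\in\Theta}|u_\tau(x)|\le C\|\varphi\|_{L^q(\Theta)}^{\frac1{p-1}}.$$ (In particular $C$ is independent of $\varphi$, $\vec{\mathbf u}_\tau$ and $\tau$.)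
   Context: Notation: primes on exponents denote Hölder conjugates ($\frac1\sigma+\frac1{\sigma'}=1$, $\sigma'=\infty$ if $\sigma=1$; $\frac1t+\frac1{t'}=1$), so $t'=\frac{s}{s-p}$ means $s=pt$, with $t'=1$ when $s=t=\infty$. $\fint_B=\frac{1}{|B|}\int_B$; $f_B=\fint_B f\,dx$. $|Q(x)|_{\mathrm{op}}=\sup_{|\xi|=1}|Q(x)\xi|$, and $Q\in L^r_{\mathrm{loc}}$ means $|Q|_{\mathrm{op}}\in L^r_{\mathrm{loc}}$; $\sqrt{Q}$ is the positive semi-definite square root. For an open set $U$, $\Theta\Subset U$ means $\Theta$ bounded and $\overline\Theta\subset U$; $Lip_0(U)$ is the set of Lipschitz functions $f$ with $\operatorname{supp}(f)\Subset U$; $Lip(U)$ is the set of Lipschitz functions on $U$. Quasi-metric: $\rho:\Omega\times\Omega\to\mathbb{R}$ and there is $\kappa\ge1$ such that for all $x,y,z\in\Omega$: $\rho(x,y)=0$ iff $x=y$; $\rho(x,y)=\rho(y,x)$; $\rho(x,y)\le\kappa(\rho(x,z)+\rho(z,y))$. $B(x,r)=\{y\in\Omega:\rho(x,y)<r\}$ is the $\rho$-ball and $D(x,r)=\{y\in\Omega:|x-y|<r\}$ the Euclidean ball. Compatibility with the Euclidean distance: for $x,y\in\Omega$, $|x-y|\to0$ iff $\rho(x,y)\to0$; equivalently, for every $x\in\Omega$ and $\epsilon>0$ there is $\delta>0$ with $D(x,\delta)\subset B(x,\epsilon)$, and for every $\delta>0$ there is $\gamma>0$ with $B(x,\gamma)\subset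 D(x,\delta)$. Fix a positive continuous function $r_1:\Omega\to(0,\infty)$, common to the following three conditions. Local Sobolev property of order $p$ with gain $\sigma$: there is $C_0>0$ such that for all $y\in\Omega$, $0<r<r_1(y)$, $f\in Lip_0(B(y,r))$, $$\Big(\fint_{B(y,r)}|f|^{p\sigma}dx\Big)^{\frac1{p\sigma}}\le C_0r\Big(\fint_{B(y,r)}|\sqrt Q\nabla f|^pdx\Big)^{\frac1p}+C_0\Big(\fint_{B(y,r)}|f|^pdx\Big)^{\frac1p}.$$ Local Poincaré property of order $p$ with gain $t'\ge1$: there are $C_1>0$, $\beta\ge1$ such that for all $y\in\Omega$ and $r$ with $0<\beta r<r_1(y)$, $$\Big(\fint_{B(y,r)}|f-f_{B(y,r)}|^{pt'}dx\Big)^{\frac1{pt'}}\le C_1r\Big(\fint_{B(y,\beta r)}|\sqrt Q\nabla f|^pdx\Big)^{\frac1p}$$ for every $f\in Lip(B(y,\beta r))$ with $\sqrt Q\nabla f\in L^p(B(y,\beta r))$. Cutoff condition of order $1\le s\le\infty$: there are constants $C_3,N>0$ and $0<\alpha<1$ such that for every $x\in\Omega$ and $0<r<r_1(x)$ there is a sequence $\{\psi_j\}_{j=1}^\infty\subset Lip_0(B(x,r))$ such that for all $j$: $0\le\psi_j\le1$; $\operatorname{supp}\psi_1\subset B(x,r)$; $B(x,\alpha r)\subset\{y\in B(x,r):\psi_j(y)=1\}$; $\operatorname{supp}\psi_{j+1}\subset\{y\in B(x,r):\psi_j(y)=1\}$; and $\big(\fint_{B(x,r)}|\sqrt{Q(y)}\nabla\psi_j(y)|^s\,dy\big)^{1/s}\le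 C_3\frac{N^j}{r}$ (essential supremum if $s=\infty$). Function spaces: $\mathcal L^p_Q(\Theta)$ is the space of measurable $\mathbf f:\Theta\to\mathbb{R}^n$ with $\|\mathbf f\|_{\mathcal L^p_Q(\Theta)}=(\int_\Theta|\sqrt Q\mathbf f|^p\,dx)^{1/p}<\infty$, modulo $\mathbf f\equiv\mathbf g$ iff $\|\mathbf f-\mathbf g\|_{\mathcal L^p_Q(\Theta)}=0$. $\widehat H^{1,p}_{Q,0}(\Theta)$ is the formal closure (completion) of $Lip_0(\Theta)$ under the norm $\big[\int_\Theta|f|^p\,dx+\int_\Theta|\sqrt Q\nabla f|^p\,dx\big]^{1/p}$; it is identified with the closure of $\{(f,\nabla f):f\in Lip_0(\Theta)\}$ in $L^p(\Theta)\times\mathcal L^p_Q(\Theta)$ with norm $(\|u\|_{L^p}^p+\|\vec g\|_{\mathcal L^p_Q}^p)^{1/p}$, and its elements are written as pairs $(u,\vec g)$. A weak solution of the Dirichlet problem is an element $\vec{\mathbf u}=(u,\vec g)\in\widehat H^{1,p}_{Q,0}(\Theta)$ such that for every $v\in Lip_0(\Theta)$, $$\int_\Theta\langle Q\vec g,\vec g\rangle^{\frac{p-2}2}\langle Q\vec g,\nabla v\rangle\,dx+\tau\int_\Theta|u|^{p-2}uv\,dx=-\int_\Theta\varphi v\,dx,$$ where for $1<p<2$ the integrands are taken to be $0$ at points where $\sqrt Q\vec g=0$, respectively $u=0$. *)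

(* Defs.v *)
From HB Require Import structures.
From mathcomp Require Import all_boot all_order all_algebra.
From mathcomp Require Import all_classical all_reals all_analysis.
From mathcomp Require Import ess_sup_inf.

Set Implicit Arguments.
Unset Strict Implicit.
Unset Printing Implicit Defensive.

Import Order.TTheory GRing.Theory Num.Theory.
Import numFieldNormedType.Exports.

Local Open Scope classical_set_scope.
Local Open Scope ring_scope.

(* The Euclidean space of dimension N >= 1 is 'rV[R]_n.+1 with N = n + 1. Its
   library topology is the usual one, but its library norm is the sup norm;
   [enorm] below is the Euclidean norm. *)

(* Lebesgue measure is not in the library beyond dimension 1. It is the
   Caratheodory measure of the outer measure defined by countable coverings by
   half-open boxes; [caratheodory_type lebesgue_outer] is then 'rV[R]_n.+1 with
   the (complete) sigma-algebra of Lebesgue measurable sets. *)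
Section lebesgue.
Context {R : realType} {n : nat}.
Implicit Types (a b : 'rV[R]_n.+1) (A : set 'rV[R]_n.+1).

Definition box (c : 'rV[R]_n.+1 * 'rV[R]_n.+1) : set 'rV[R]_n.+1 :=
  [set x | forall i, c.1 0 i < x 0 i <= c.2 0 i].

Definition box_volume (c : 'rV[R]_n.+1 * 'rV[R]_n.+1) : R :=
  \prod_i Num.max (c.2 0 i - c.1 0 i) 0.

Definition lebesgue_outer A : \bar R :=
  ereal_inf [set (\sum_(k <oo) (box_volume (c k))%:E)%E
            | c in [set c : nat -> 'rV[R]_n.+1 * 'rV[R]_n.+1
                   | A `<=` \bigcup_k box (c k)]].

Lemma box_volume_ge0 c : 0 <= box_volume c.
Proof. by apply: prodr_ge0 => i _; rewrite le_max lexx orbT. Qed.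

Lemma lebesgue_outer_ge0 A : (0 <= lebesgue_outer A)%E.
Proof.
apply: le_ereal_inf_tmp => _ [c _ <-].
by apply: nneseries_ge0 => k _ _; rewrite lee_fin box_volume_ge0.
Qed.

Lemma lebesgue_outer0 : lebesgue_outer set0 = 0%E.
Proof.
apply/eqP; rewrite eq_le lebesgue_outer_ge0 andbT.
apply: ereal_inf_lbound; exists (fun=> (0, 0)); first exact: sub0set.
rewrite eseries0// => k _ _; congr EFin.
by rewrite /box_volume big_ord_recl/= subrr maxxx mul0r.
Qed.

Lemma le_lebesgue_outer :
  {homo lebesgue_outer : A B / A `<=` B >-> (A <= B)%E}.
Proof.
move=> A B AB; apply: ereal_inf_le_tmp => _ [c Bc <-].
by exists c => //; apply: subset_trans AB Bc.
Qed.

Lemma lebesgue_outer_sigma_subadditive : sigma_subadditive lebesgue_outer.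
Proof.
move=> A; have [[i ioo]|] := pselect (exists i, lebesgue_outer (A i) = +oo%E).
  rewrite (eseries_pinfty _ _ ioo) ?leey// => k _.
  by rewrite -ltNye (lt_le_trans _ (lebesgue_outer_ge0 _)).
rewrite -forallNE => Aoo.
suff add2e (e : {posnum R}) : (lebesgue_outer (\bigcup_k A k) <=
    \sum_(i <oo) lebesgue_outer (A i) + e%:num%:E)%E.
  by apply/lee_addgt0Pr => _/posnumP[].
rewrite (le_trans _ (epsilon_trick _ _ _))//; last first.
  by move=> k; exact: lebesgue_outer_ge0.
pose P k (B : nat -> 'rV[R]_n.+1 * 'rV[R]_n.+1) :=
  A k `<=` \bigcup_j box (B j) /\
  (\sum_(j <oo) (box_volume (B j))%:E <=
     lebesgue_outer (A k) + (e%:num / (2 ^ k.+1)%:R)%:E)%E.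
have [G PG] : {G : nat -> nat -> 'rV[R]_n.+1 * 'rV[R]_n.+1
               & forall k, P k (G k)}.
  apply: (@choice _ _ P) => k; rewrite /P.
  have Afin : lebesgue_outer (A k) \is a fin_num.
    by rewrite ge0_fin_numE ?lebesgue_outer_ge0// ltey; exact/eqP/Aoo.
  have e0 : 0 < e%:num / (2 ^ k.+1)%:R by [].
  have [_ [c Ac <-] cA] := lb_ereal_inf_adherent e0 Afin.
  by exists c; split => //; exact/ltW.
pose v i : \bar R := (box_volume (uncurry G i))%:E.
have v_ge0 i : (0 <= v i)%E by rewrite lee_fin box_volume_ge0.
apply: (@le_trans _ _ (\esum_(i in setT) v i)%E).
  apply: ereal_inf_lbound => /=.
  have /card_esym/ppcard_eqP[f] := card_nat2.
  exists (uncurry G \o f).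
    move=> t [i _] /(PG i).1[j _ Gt].
    by exists (f^-1%FUN (i, j)) => //=; rewrite invK ?inE.
  rewrite -(esum_pred_image v _ xpredT) ?[fun=> _]set_true//.
  by rewrite image_eq.
rewrite (_ : esum _ _ = \sum_(i <oo) \sum_(j <oo) v (i, j))%E; last first.
  pose J : nat -> set (nat * nat) := fun i => [set (i, j) | j in setT].
  rewrite (_ : setT = \bigcup_k J k); last first.
    by rewrite predeqE => -[a b]; split => // _; exists a => //; exists b.
  rewrite esum_bigcupT //=; last first.
    apply/trivIsetP => i j _ _ ij.
    rewrite predeqE => -[k m] /=; split => //= -[] [_] _ [<-{k} _].
    by move=> [m' _] [] /esym/eqP; rewrite (negbTE ij).
  rewrite -(image_id [set: nat]) -fun_true esum_pred_image//; last first.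
    by move=> k _; exact: esum_ge0.
  apply: eq_eseriesr => /= j _.
  rewrite -(esum_pred_image v (pair j) predT)//=; last first.
    by move=> ? ? _ _; exact: (@can_inj _ _ _ snd).
  by congr esum; rewrite predeqE => -[a b]; split; move=> [i _ <-]; exists i.
apply: lee_nneseries => k; last by move=> _; exact: (PG k).2.
by move=> *; apply: nneseries_ge0 => j _ _; exact: v_ge0.
Qed.

HB.instance Definition _ := isOuterMeasure.Build R _ lebesgue_outer
  lebesgue_outer0 lebesgue_outer_ge0 le_lebesgue_outer
  lebesgue_outer_sigma_subadditive.

Definition leb : set (caratheodory_type lebesgue_outer) -> \bar R :=
  lebesgue_outer.

HB.instance Definition _ := Measure.copy leb
  ((lebesgue_outer : {outer_measure set _ -> \bar R})
     : set (caratheodory_type lebesgue_outer) -> \bar R).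

End lebesgue.

(* Lebesgue (rather than Borel) measurability of real functions on a subset. *)
Definition leb_measurable_fun {R : realType} {n : nat}
    (D : set 'rV[R]_n.+1) (f : 'rV[R]_n.+1 -> R) : Prop :=
  @measurable_fun _ _ (caratheodory_type (@lebesgue_outer R n)) R D f.

Section euclidean.
Context {R : realType} {n : nat}.
Implicit Types (x y v : 'rV[R]_n.+1) (A : 'M[R]_n.+1) (U : set 'rV[R]_n.+1)
  (f : 'rV[R]_n.+1 -> R).

Definition dot x y : R := \sum_i x 0 i * y 0 i.

Definition enorm x : R := Num.sqrt (dot x x).

(* The column vector A v, written as a row vector. *)
Definition mulv A v : 'rV[R]_n.+1 := v *m A^T.

Definition psd A : Prop := A^T = A /\ forall v, 0 <= dot (mulv A v) v.

(* For A psd there is exactly one such S, by the spectral theorem. *)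
Definition psd_sqrt A : 'M[R]_n.+1 := xget 0 [set S | psd S /\ S *m S = A].

Definition op_norm A : R := sup [set enorm (mulv A v) | v in [set v | enorm v = 1]].

(* Partial derivatives are total functions, with a junk value where the limit
   does not exist; for Lipschitz f this is a null set. *)
Definition grad f x : 'rV[R]_n.+1 := \row_i 'D_(delta_mx 0 i) f x.

Definition compactly_inside (D U : set 'rV[R]_n.+1) : Prop :=
  bounded_set D /\ closure D `<=` U.

Definition fsupp f : set 'rV[R]_n.+1 := closure [set x | f x != 0].

(* Functions with compact support in U are taken to be extended by 0. The class
   of Lipschitz functions is the same for the sup norm as for [enorm]. *)
Definition Lip0 U : set ('rV[R]_n.+1 -> R) :=
  [set f | lipschitz f /\ compactly_inside (fsupp f) U].

End euclidean.

Section lebesgue_spaces.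
Context {R : realType} {n : nat}.
Implicit Types (D B : set 'rV[R]_n.+1) (q : \bar R) (f : 'rV[R]_n.+1 -> R)
  (Q : 'rV[R]_n.+1 -> 'M[R]_n.+1) (g : 'rV[R]_n.+1 -> 'rV[R]_n.+1).

(* Essential supremum over D of a nonnegative function. *)
Definition esssup_on D f : \bar R := ess_sup leb ((EFin \o f) \_ D).

Definition Lnorm_on D q f : \bar R := Lnorm leb q ((EFin \o f) \_ D).

Definition Lp D q f : Prop :=
  leb_measurable_fun D f /\ (Lnorm_on D q f < +oo)%E.

Definition Q_abs Q g (x : 'rV[R]_n.+1) : R := enorm (mulv (psd_sqrt (Q x)) (g x)).

Definition LQ D (p : R) Q g : Prop :=
  (forall i, leb_measurable_fun D (fun x => g x 0 i)) /\
  (Lnorm_on D p%:E (Q_abs Q g) < +oo)%E.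

Definition Lloc_matrix (Omega : set 'rV[R]_n.+1) (r : R) Q : Prop :=
  (forall i j, leb_measurable_fun Omega (fun x => Q x i j)) /\
  forall K, compact K -> K `<=` Omega ->
    (\int[leb]_(x in K) (op_norm (Q x) `^ r)%R%:E < +oo)%E.

Definition mean B f : R :=
  fine ((leb B)^-1 * \int[leb]_(x in B) (f x)%:E)%E.

(* The normalized norm (|B|^-1 \int_B |f|^q)^(1/q), 1 <= q <= oo. *)
Definition mean_norm B q f : \bar R :=
  match q with
  | r%:E => ((leb B)^-1 * \int[leb]_(x in B) (`|f x| `^ r)%R%:E) `^ r^-1
  | +oo => esssup_on B (fun x => `|f x|%R)
  | -oo => 0
  end%E.

End lebesgue_spaces.

Section quasi_metric_spaces.
Context {R : realType} {n : nat}.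
Variables (Omega : set 'rV[R]_n.+1) (rho : 'rV[R]_n.+1 -> 'rV[R]_n.+1 -> R).

Definition quasi_metric : Prop :=
  exists2 kappa : R, 1 <= kappa &
  forall x y z, Omega x -> Omega y -> Omega z ->
    [/\ rho x y = 0 <-> x = y,
        rho x y = rho y x &
        rho x y <= kappa * (rho x z + rho z y)].

Definition qball (x : 'rV[R]_n.+1) (r : R) : set 'rV[R]_n.+1 :=
  [set y | Omega y /\ rho x y < r].

Definition eball (x : 'rV[R]_n.+1) (r : R) : set 'rV[R]_n.+1 :=
  [set y | Omega y /\ enorm (x - y) < r].

Definition euclidean_compatible : Prop :=
  forall x, Omega x ->
    (forall e : R, 0 < e -> exists2 d : R, 0 < d & eball x d `<=` qball x e) /\
    (forall d : R, 0 < d -> exists2 e : R, 0 < e & qball x e `<=` eball x d).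

Variables (Q : 'rV[R]_n.+1 -> 'M[R]_n.+1) (r1 : 'rV[R]_n.+1 -> R).

Definition local_sobolev (p sigma : R) : Prop :=
  exists2 C0 : R, 0 < C0 &
  forall y r, Omega y -> 0 < r < r1 y ->
  forall f, Lip0 (qball y r) f ->
    (mean_norm (qball y r) (p * sigma)%:E f <=
       (C0 * r)%:E * mean_norm (qball y r) p%:E (Q_abs Q (grad f))
       + C0%:E * mean_norm (qball y r) p%:E f)%E.

(* A Lipschitz function on a set extends to a Lipschitz function on the whole
   space, and the gradients of two extensions agree almost everywhere on the
   set: Lip(B(y, beta r)) is represented by Lipschitz functions on the space, so
   that [grad] does not see values outside a ball which need not be open. *)
Definition local_poincare (p : R) (gain : \bar R) : Prop :=
  exists C1 beta : R, [/\ 0 < C1, 1 <= beta &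
  forall y r, Omega y -> 0 < beta * r < r1 y ->
  forall f : 'rV[R]_n.+1 -> R, lipschitz f ->
    Lp (qball y (beta * r)) p%:E (Q_abs Q (grad f)) ->
    (mean_norm (qball y r) (p%:E * gain) (fun x => f x - mean (qball y r) f)%R <=
       (C1 * r)%:E * mean_norm (qball y (beta * r)) p%:E (Q_abs Q (grad f)))%E].

(* The value of psi at index 0 is irrelevant: sequences start at 1. *)
Definition cutoff_condition (s : \bar R) : Prop :=
  exists C3 N alpha : R, [/\ 0 < C3, 0 < N, 0 < alpha < 1 &
  forall x r, Omega x -> 0 < r < r1 x ->
  exists psi : nat -> 'rV[R]_n.+1 -> R,
    fsupp (psi 1%N) `<=` qball x r /\
    forall j, (0 < j)%N ->
    [/\ Lip0 (qball x r) (psi j),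
        forall y, 0 <= psi j y <= 1,
        qball x (alpha * r) `<=` [set y | qball x r y /\ psi j y = 1],
        fsupp (psi j.+1) `<=` [set y | qball x r y /\ psi j y = 1] &
        (mean_norm (qball x r) s (Q_abs Q (grad (psi j)))
           <= (C3 * (N ^+ j / r))%:E)%E]].

End quasi_metric_spaces.

Section dirichlet_problem.
Context {R : realType} {n : nat}.
Variables (Theta : set 'rV[R]_n.+1) (p : R) (Q : 'rV[R]_n.+1 -> 'M[R]_n.+1).
Implicit Types (u phi : 'rV[R]_n.+1 -> R)
  (g : 'rV[R]_n.+1 -> 'rV[R]_n.+1).

Definition H1_norm u g : \bar R :=
  ((Lnorm_on Theta p%:E u `^ p + Lnorm_on Theta p%:E (Q_abs Q g) `^ p)
    `^ p^-1)%E.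

(* Representatives (u, g) of the elements of the closure of
   {(f, grad f) : f in Lip0 Theta} in L^p x L^p_Q. *)
Definition H1_0 u g : Prop :=
  [/\ Lp Theta p%:E u, LQ Theta p Q g &
  forall e : R, 0 < e -> exists2 f, Lip0 Theta f &
    (H1_norm (fun x => u x - f x)%R (fun x => g x - grad f x)%R < e%:E)%E].

(* Since 0 `^ a = 0 for a != 0, the integrands vanish where sqrt(Q) g = 0,
   resp. u = 0, also for p < 2. *)
Definition weak_solution (tau : R) phi u g : Prop :=
  H1_0 u g /\
  forall v, Lip0 Theta v ->
    \int[leb]_(x in Theta)
      (dot (mulv (Q x) (g x)) (g x) `^ ((p - 2) / 2) *
       dot (mulv (Q x) (g x)) (grad v x))
    + tau * \int[leb]_(x in Theta) (`|u x| `^ (p - 2) * u x * v x)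
    = - \int[leb]_(x in Theta) (phi x * v x).

End dirichlet_problem.

(* Main.v *)
Require Import Defs.
From mathcomp Require Import all_boot all_order all_algebra.
From mathcomp Require Import all_classical all_reals all_analysis.
From mathcomp Require Import ess_sup_inf measurable_realfun ring lra.
From mathcomp Require complex.

Set Implicit Arguments.
Unset Strict Implicit.
Unset Printing Implicit Defensive.

Import Order.TTheory GRing.Theory Num.Theory.
Import numFieldNormedType.Exports.

Local Open Scope classical_set_scope.
Local Open Scope ring_scope.

(* The proof bounds the level sets of u directly; no Moser iteration is used.

   On Lip_0(Theta) there is a weak-type Sobolev inequality without zeroth-order
   term: |{|f| > l}| <= C (w / l^p)^sigma if w bounds the energy
   \int_Theta |sqrt(Q) grad f|^p. First, the Poincare property gives such a bound
   with exponent t' in place of sigma, on small balls: it holds near a point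
   outside closure(Theta), where f vanishes, and it passes from one ball to
   another that overlaps it, hence to all of the connected set Omega. Second,
   this bound absorbs the zeroth-order term and the cutoff energy
   \int_{f > l/2} |sqrt(Q) grad eta|^p (Hoelder, exponents s/p = t and t') when
   the Sobolev property is applied to min((f - l/2)_+, c eta). This
   minimum takes the place of a product of eta and a truncation of f: its
   gradient is grad f or c grad eta, with c <= l / 2.

   Testing the equation with T(f), where f in Lip_0(Theta) approximates u and T
   is a smooth odd ramp vanishing on [-k, k] and constant beyond h, gives for
   a(k) = |{|u| > k}| the decay
     a(h) <= K ||phi||_q^sigma (h - k)^(-(p-1) sigma) a(k)^((1-1/q) sigma),
   whose last exponent exceeds 1 exactly because q > sigma'. Stampacchia's lemma
   concludes.

   Partial derivatives that do not exist are 0 in [grad], so the chain rule for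
   T o f with T of class C^{1,1} holds at every point and Rademacher's theorem is
   never needed. *)

(** * Lebesgue measure of open sets *)

(** The absorption rests on a cancellation of exponents. On {f > k}, k = l / 2, the energy of c eta
    is at most a constant times c^p |{f > k}|^(1/t'), while the Poincare property bounds |{f > k}|
    by a multiple of (w / k^p)^t'. As c <= k, the powers of k cancel and w is left; this is why the
    gain t' has to match the order s = p t.

    A product of eta and f is avoided because for partial derivatives with default value 0 the
    product rule fails even as an inequality: two functions without a derivative can have a
    differentiable product. A minimum is harmless except where its branches meet, and the free
    height c is there to make that set cheap.

    T(u) need not be an admissible test function. With T(f) the errors involve the energy of the
    solution itself, but for fixed k and h they can be made small before the level estimate is
    closed, so C depends neither on the solution nor on tau.

    The exponent p - 1 arises because T has height and width proportional to h - k: the source term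
    brings one factor h - k into the energy, and the weak-type inequality divides by (h - k)^p. *)

Section rV_norm.
Context {R : realType} {n : nat}.
Implicit Types (x : 'rV[R]_n) (e : R).

Lemma rV_norm_ltP x e : 0 < e -> `|x| < e <-> forall i, `|x 0 i| < e.
Proof.
move=> e0; rewrite /Num.norm/= mx_normrE; split=> [/bigmax_ltP[_ h] i|h].
  exact: (h (0, i)).
by apply: bigmax_lt => // -[i0 i] _; rewrite ord1 /=; exact: h.
Qed.

Lemma rV_coord_le x i : `|x 0 i| <= `|x|.
Proof.
rewrite {2}/Num.norm/= mx_normrE.
by apply: (le_bigmax _ (fun j : 'I_1 * 'I_n => `|x j.1 j.2|) (0, i)).
Qed.

End rV_norm.

Notation lmeasurable := (lebesgue_outer.-cara.-measurable).

Section lebesgue_measurable_sets.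
Context {R : realType} {n : nat}.
Implicit Types (a b x y : 'rV[R]_n.+1) (A U : set 'rV[R]_n.+1) (i : 'I_n.+1).

Lemma box_volumeD1 (c : 'rV[R]_n.+1 * 'rV[R]_n.+1) i : box_volume c =
  Num.max (c.2 0 i - c.1 0 i) 0 *
  \prod_(j < n.+1 | j != i) Num.max (c.2 0 j - c.1 0 j) 0.
Proof. by rewrite /box_volume (bigD1 i). Qed.

(** Caratheodory's criterion, tested on coverings: the hyperplane [x 0 i = r] cuts each half-open
    box into two, possibly empty, whose volumes add up. *)
Lemma lmeasurable_halfspace i (r : R) :
  lmeasurable [set x : 'rV[R]_n.+1 | x 0 i <= r].
Proof.
apply: le_caratheodory_measurable => X.
apply: le_ereal_inf_tmp => _ [c Xc <-] /=.
pose c1 k : 'rV[R]_n.+1 * 'rV[R]_n.+1 :=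
  ((c k).1, \row_j if j == i then Num.min ((c k).2 0 i) r else (c k).2 0 j).
pose c2 k : 'rV[R]_n.+1 * 'rV[R]_n.+1 :=
  (\row_j if j == i then Num.max ((c k).1 0 i) r else (c k).1 0 j, (c k).2).
have vE k : box_volume (c k) = box_volume (c1 k) + box_volume (c2 k).
  rewrite !(box_volumeD1 _ i)/= !mxE !eqxx.
  rewrite [\prod_(j < n.+1 | j != i) Num.max ((c k).2 0 j - (c2 k).1 0 j) 0](eq_bigr
    (fun j => Num.max ((c1 k).2 0 j - (c1 k).1 0 j) 0)); last first.
    by move=> j ji; rewrite !mxE (negbTE ji).
  rewrite -mulrDl; congr (_ * _); last first.
    by apply: eq_bigr => j ji; rewrite !mxE (negbTE ji).
  move: ((c k).1 0 i) ((c k).2 0 i) => u v.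
  have [h1|h1] := leP v r; have [h2|h2] := leP u r; rewrite !maxEle;
    by do ![case: ifPn; rewrite -?ltNge => ?]; lra.
under eq_eseriesr do rewrite vE EFinD.
rewrite nneseriesD; [|by move=> *; rewrite lee_fin box_volume_ge0..].
apply: leeD; apply: ereal_inf_lbound.
  exists c1 => //= x [Xx /= xr]; have [k _ ckx] := Xc _ Xx; exists k => // j /=.
  have /andP[-> ?] := ckx j; rewrite mxE; case: eqP => [->|_//].
  by rewrite le_min xr (andP (ckx i)).2.
exists c2 => //= x [Xx /= /negP]; rewrite -ltNge => xr.
have [k _ ckx] := Xc _ Xx; exists k => // j /=.
have /andP[? ->] := ckx j; rewrite mxE andbT; case: eqP => [->|_//].
by rewrite gt_max xr (andP (ckx i)).1.
Qed.

(** An open set is the union of the countably many cubes inside it with rational centre and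
    half-side [1 / (m + 1)]. If [2 / (m + 1) < e], such a cube through [x] lies in the sup-norm ball
    of radius [e] about [x]. *)
Lemma open_lmeasurable U : open U -> lmeasurable U.
Proof.
move=> oU.
pose q (c : 'rV[rat]_n.+1 * nat) : set 'rV[R]_n.+1 :=
  [set y | forall i, ratr (c.1 0 i) - c.2.+1%:R^-1 < y 0 i <= ratr (c.1 0 i) + c.2.+1%:R^-1].
have mq c : lmeasurable (q c).
  have -> : q c = \bigcap_(i in [set: 'I_n.+1])
     ((~` [set y : 'rV[R]_n.+1 | y 0 i <= ratr (c.1 0 i) - c.2.+1%:R^-1]) `&`
      [set y : 'rV[R]_n.+1 | y 0 i <= ratr (c.1 0 i) + c.2.+1%:R^-1]).
    apply/seteqP; split=> y /= yq.
      by move=> i _; have /andP[] := yq i; split => //; apply/negP; rewrite -ltNge.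
    by move=> i; have [/negP + ->] := yq i Logic.I; rewrite andbT -ltNge.
  apply: fin_bigcap_measurable => // i _.
  apply: measurableI; last exact: lmeasurable_halfspace.
  by apply: measurableC; exact: lmeasurable_halfspace.
have -> : U = \bigcup_c (if pselect (q c `<=` U) then q c else set0).
  apply/seteqP; split=> [x Ux|x [c _]]; last first.
    by case: pselect => [sub /= qx|//]; exact: sub.
  have /nbhs_ballP[e /= e0 eU] := open_nbhs_nbhs (conj oU Ux).
  pose m := Num.truncn (2 / e).
  have m0 : (0 : R) < m.+1%:R^-1 by rewrite invr_gt0.
  have me : m.+1%:R^-1 * 2 < e.
    rewrite mulrC ltr_pdivrMr// -ltr_pdivrMl// mulrC; exact: truncnS_gt.
  have /choice[z zP] : forall i, exists z : rat,
      x 0 i - m.+1%:R^-1 < ratr z < x 0 i + m.+1%:R^-1.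
    move=> i; have xi : x 0 i - m.+1%:R^-1 < x 0 i + m.+1%:R^-1.
      by rewrite ltrBlDr -addrA ltrDl addr_gt0.
    by have [z zi] := rat_in_itvoo xi; exists z; rewrite in_itv/= in zi.
  pose c : 'rV[rat]_n.+1 * nat := (\row_i z i, m).
  have qx : q c x.
    move=> i; rewrite mxE /=; have /andP[h1 h2] := zP i.
    by move: h1 h2; set k := _^-1; set s := ratr _; move: (x _ _) => w *; apply/andP; split; lra.
  exists c => //; case: pselect => // -[]; move=> y qy; apply: eU.
  rewrite mx_norm_ball /ball_/=; apply/rV_norm_ltP => // i; rewrite !mxE.
  apply: le_lt_trans me; rewrite ler_norml.
  have /andP[] := qx i; have /andP[] := qy i.
  rewrite !mxE/=; set k := _^-1; set s := ratr _; move: (x _ _) (y _ _) => w w' *.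
  by apply/andP; split; lra.
apply: countable_bigcupT_measurable => // c.
by case: (pselect _) => ? /=; [exact: mq|exact: measurable0].
Qed.

Lemma closed_lmeasurable U : closed U -> lmeasurable U.
Proof.
by move=> cU; rewrite -(setCK U); apply/measurableC/open_lmeasurable/closed_openC.
Qed.

End lebesgue_measurable_sets.

(** * Volumes of boxes and bounds for Lebesgue measure *)

Section lebesgue_box.
Context {R : realType} {n : nat}.
Implicit Types (x y : 'rV[R]_n.+1) (A U : set 'rV[R]_n.+1) (i : 'I_n.+1)
  (c : 'rV[R]_n.+1 * 'rV[R]_n.+1).

(* The integral of the indicator function of a box over its first m variables. *)
Let partial_vol (m : nat) c x : R := \prod_(i < n.+1)
  if (i < m)%N then Num.max (c.2 0 i - c.1 0 i) 0
  else \1_(`]c.1 0 i, c.2 0 i]%classic) (x 0 i).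

Let partial_vol_ge0 m c x : 0 <= partial_vol m c x.
Proof.
apply: prodr_ge0 => i _; case: ifP => // _; by rewrite le_max lexx orbT.
Qed.

Let partial_volS m c x (mn : (m < n.+1)%N) :
  let y s : 'rV[R]_n.+1 := \row_j if j == Ordinal mn then s else x 0 j in
  (\int[lebesgue_measure]_s (partial_vol m c (y s))%:E = (partial_vol m.+1 c x)%:E)%E.
Proof.
move=> y; set i := Ordinal mn.
pose K := \prod_(j < n.+1 | j != i)
  if (j < m)%N then Num.max (c.2 0 j - c.1 0 j) 0
  else \1_(`]c.1 0 j, c.2 0 j]%classic) (x 0 j) : R.
have K0 : 0 <= K.
  by apply: prodr_ge0 => j _; case: ifP => // _; rewrite le_max lexx orbT.
have vE s : partial_vol m c (y s) = K * \1_(`]c.1 0 i, c.2 0 i]%classic) s.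
  rewrite /partial_vol (bigD1 i)//= ltnn mxE eqxx mulrC; congr (_ * _).
  by apply: eq_bigr => j ji; rewrite mxE (negbTE ji).
under eq_integral do rewrite vE EFinM.
rewrite ge0_integralZl_EFin//; last exact/measurable_EFinP/measurable_indic.
rewrite integral_indic//= setIT lebesgue_measure_itv/=.
rewrite /partial_vol (bigD1 i)//= ltnSn mulrC EFinM; congr (_ * _)%E.
  congr EFin; apply: eq_bigr => j ji; rewrite [(j < m.+1)%N]ltnS [(j <= m)%N]leq_eqVlt.
  by rewrite -[nat_of_ord j == m]/(j == i) (negbTE ji).
by rewrite lte_fin; case: ltP => ?; rewrite maxEle; case: leP => // ?; congr EFin; lra.
Qed.

(** The covering is an inequality between indicator functions. Integrating it over one coordinate at
    a time, with monotone convergence for the series, gives the inequality of volumes without a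
    compactness argument. *)
Lemma box_volume_le_cover c (d : nat -> 'rV[R]_n.+1 * 'rV[R]_n.+1) :
  box c `<=` \bigcup_k box (d k) ->
  ((box_volume c)%:E <= \sum_(k <oo) (box_volume (d k))%:E)%E.
Proof.
move=> cd.
have step m : (m <= n.+1)%N -> forall x,
    ((partial_vol m c x)%:E <= \sum_(k <oo) (partial_vol m (d k) x)%:E)%E.
  elim: m => [_ x|m IH mn x].
    have v1 c' : box c' x -> partial_vol 0 c' x = 1.
      move=> bx; rewrite /partial_vol big1// => i _.
      by rewrite /= indicE mem_set//= in_itv/=; exact: bx.
    have [bx|nbx] := pselect (box c x).
      have [k _ dkx] := cd _ bx; rewrite v1//.
      rewrite (nneseriesD1 (n := k))//; last by move=> *; rewrite lee_fin.
      rewrite v1// leeDl//; apply: nneseries_ge0 => *; by rewrite lee_fin.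
    suff -> : partial_vol 0 c x = 0 by apply: nneseries_ge0 => *; rewrite lee_fin.
    have [i ni] : exists i, ~ (c.1 0 i < x 0 i <= c.2 0 i) by exact/existsNP.
    by rewrite /partial_vol (bigD1 i)//= indicE memNset ?mul0r//= in_itv.
  pose y s : 'rV[R]_n.+1 := \row_j if j == Ordinal mn then s else x 0 j.
  have mv c' : measurable_fun setT (fun s => (partial_vol m c' (y s))%:E).
    apply/measurable_EFinP; rewrite /partial_vol.
    apply: measurable_prod => i _; have [im|im] := boolP (i < m)%N => //.
    apply: (measurableT_comp (f := \1_(`]c'.1 0 i, c'.2 0 i]%classic) : R -> R)).
      exact: measurable_indic.
    rewrite /y; under eq_fun do rewrite mxE; by case: eqP => _; [exact: measurable_id|exact: measurable_cst].
  rewrite -(partial_volS c x mn).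
  under [leRHS]eq_eseriesr do rewrite -(partial_volS _ x mn).
  rewrite -integral_nneseries//; [|by move=> ?; exact: mv|by move=> *; rewrite lee_fin].
  apply: ge0_le_integral => //.
  - by move=> *; rewrite lee_fin.
  - exact: mv.
  - by apply: (ge0_emeasurable_sum (P := xpredT)
      (h := fun k s => (partial_vol m (d k) (y s))%:E)) => [? *|k _];
      [rewrite lee_fin|exact: mv].
  - by move=> s _; exact: IH (ltnW mn) _.
have := step n.+1 (leqnn _) 0.
have vE c' : partial_vol n.+1 c' 0 = box_volume c'.
  by apply: eq_bigr => i _; rewrite ltn_ord.
by rewrite vE; under eq_eseriesr do rewrite vE.
Qed.

Lemma box_lebesgue_ge c A : box c `<=` A -> ((box_volume c)%:E <= leb A)%E.
Proof.
move=> cA; apply: le_ereal_inf_tmp => _ [d Ad <-].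
by apply: box_volume_le_cover; exact: subset_trans cA Ad.
Qed.

Lemma open_lebesgue_gt0 U : open U -> U !=set0 -> (0 < leb U)%E.
Proof.
move=> oU [x Ux].
have /nbhs_ballP[e /= e0 eU] := open_nbhs_nbhs (conj oU Ux).
pose c : 'rV[R]_n.+1 * 'rV[R]_n.+1 := (x, x + const_mx (e / 2)).
apply: (@lt_le_trans _ _ (box_volume c)%:E).
  rewrite lte_fin; apply: prodr_gt0 => i _; rewrite !mxE lt_max.
  by rewrite addrAC subrr add0r divr_gt0.
apply: box_lebesgue_ge => y cy; apply: eU.
rewrite mx_norm_ball /ball_/=; apply/rV_norm_ltP => // i; rewrite !mxE.
have := cy i; rewrite !mxE/= => /andP[h1 h2]; rewrite ler0_norm; lra.
Qed.

Lemma bounded_lebesgue_fin A : bounded_set A -> (leb A < +oo)%E.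
Proof.
move=> [M [_ AM]].
(* The lower corner is moved to [- K - 1] because a box does not contain its lower faces. *)
pose K := `|M| + 1; pose c : 'rV[R]_n.+1 * 'rV[R]_n.+1 :=
  (const_mx (- K - 1), const_mx K).
have Ac : A `<=` box c.
  move=> x Ax i; rewrite !mxE.
  have : `|x| <= K by apply: AM => //; rewrite /K; have := ler_norm M; lra.
  move=> /(le_trans (rV_coord_le x i)); rewrite ler_norml.
  by move=> /andP[? ->]; rewrite andbT; lra.
apply: (@le_lt_trans _ _ (box_volume c)%:E); last exact: ltry.
apply: ereal_inf_lbound.
exists (fun k => if k == 0%N then c else (0, 0)).
  by move=> x Ax; exists 0%N => //; exact: Ac.
rewrite (nneseriesD1 (n := 0%N))//; last by move=> *; rewrite lee_fin box_volume_ge0.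
rewrite eseries0 ?adde0// => k _ k0; rewrite (negbTE k0).
by rewrite /box_volume big_ord_recl/= !mxE subrr maxxx mul0r.
Qed.

End lebesgue_box.

(** * Square roots of positive semi-definite matrices *)

Section psd_sqrt_exists.
Context {R : realType} {n : nat}.
Implicit Types (A : 'M[R]_n.+1) (v w : 'rV[R]_n.+1).

Lemma interpolation_exists (s : seq R) (F : R -> R) :
  exists p : {poly R}, {in s, forall x, p.[x] = F x}.
Proof.
elim: s => [|a s [p ps]]; first by exists 0.
have [as_|as_] := boolP (a \in s).
  by exists p => x; rewrite inE => /orP[/eqP->|]; exact: ps.
pose m := \prod_(b <- s) ('X - b%:P).
have ma0 : m.[a] != 0.
  by rewrite -[_ == 0]/(root m a) root_prod_XsubC.
exists (p + ((F a - p.[a]) / m.[a]) *: m) => x; rewrite inE hornerD hornerZ.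
have [-> _|xa /= xs] := eqVneq x a; first by rewrite divfK// addrC subrK.
by have /rootP-> : root m x; rewrite ?root_prod_XsubC// mulr0 addr0 ps.
Qed.

Lemma horner_mx_diagonalized (F : fieldType) m (A P : 'M[F]_m.+1) (d : 'rV_m.+1) r :
  P \in unitmx -> A = invmx P *m diag_mx d *m P ->
  horner_mx A r = invmx P *m diag_mx (map_mx (horner r) d) *m P.
Proof. by move=> Pu ->; rewrite horner_mx_uconjC// horner_mx_diag. Qed.

Lemma mul_row_col v w : v *m w^T = (dot v w)%:M.
Proof.
by apply/matrixP => i j; rewrite !ord1 !mxE eqxx mulr1n; apply: eq_bigr => k _; rewrite mxE.
Qed.

Lemma dotE v w : dot v w = (v *m w^T) 0 0.
Proof. by rewrite mul_row_col mxE eqxx mulr1n. Qed.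

Lemma dotC v w : dot v w = dot w v.
Proof. by apply: eq_bigr => i _; rewrite mulrC. Qed.

Lemma dot_ge0 v : 0 <= dot v v.
Proof. by apply: sumr_ge0 => i _; rewrite -expr2 sqr_ge0. Qed.

Lemma dot_eq0 v : (dot v v == 0) = (v == 0).
Proof.
apply/eqP/eqP => [v0|->]; last by rewrite /dot big1// => i _; rewrite mxE mul0r.
apply/rowP => i; rewrite mxE; apply/eqP; rewrite -sqrf_eq0 expr2.
have /psumr_eq0P : forall j, true -> 0 <= v 0 j * v 0 j.
  by move=> j _; rewrite -expr2 sqr_ge0.
by move=> /(_ v0)->.
Qed.

Import complex.
Let toC := (@real_complex R).

(* A is diagonalizable over the complex numbers with real nonnegative
   eigenvalues, so a real polynomial interpolating x^(1/4) at the eigenvalues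
   gives a real symmetric fourth root of A, whose square is positive. *)
Lemma psd_sqrt_exists A : psd A -> exists S, psd S /\ S *m S = A.
Proof.
move=> [Asym Apsd].
pose AC := map_mx toC A.
have ACherm : AC \is hermsymmx.
  apply: realsym_hermsym.
    by apply/is_hermitianmxP; rewrite expr0 scale1r map_mx_id// map_trmx Asym.
  by apply/mxOverP => i j; rewrite mxE complex_real.
have /hermitian_normalmx/orthomx_spectralP := ACherm.
set P := spectralmx AC; set d := spectral_diag AC => ACE.
have Pu : P \in unitmx by exact: spectral_unit.
have dE i : exists2 l : R, 0 <= l & d 0 i = toC l.
  have /mxOverP/(_ 0 i)/complex_realP[l] := hermitian_spectral_diag_real ACherm.
  rewrite -/d => dl; exists l => //.
  have : eigenvalue AC (d 0 i).
    apply/eigenvalueP; exists (row i P); last first.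
      apply/eqP => r0; have := Pu; rewrite -row_free_unit => /row_freeP[B PB].
      have := congr1 (fun M => (row i M) 0 i) PB.
      by rewrite row_mul r0 mul0mx !mxE eqxx => /esym/eqP; rewrite oner_eq0.
    rewrite -row_mul {1}ACE !mulmxA mulmxV// mul1mx mul_diag_mx.
    by apply/rowP => j; rewrite !mxE.
  (* A real eigenvalue of [AC] is an eigenvalue of [A], with a real eigenvector [v] on which
     positivity can be tested. *)
  rewrite dl eigenvalue_map => /eigenvalueP[v vA v0].
  have := Apsd v; rewrite /mulv Asym vA /dot.
  rewrite (eq_bigr (fun j => l * (v 0 j * v 0 j))); last first.
    by move=> j _; rewrite !mxE mulrA.
  by rewrite -mulr_sumr pmulr_lge0// lt_def dot_eq0 v0 dot_ge0.
have /choice[l lP] : forall i, exists l : R, 0 <= l /\ d 0 i = toC l.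
  by move=> i; have [l l0 dl] := dE i; exists l.
have [p pE] := interpolation_exists [seq l i | i <- enum 'I_n.+1]
  (fun x => Num.sqrt (Num.sqrt x)).
pose T := horner_mx A p.
have Tsym : T^T = T.
  rewrite /T; elim/poly_ind: (p) => [|q c IH]; first by rewrite rmorph0 trmx0.
  rewrite rmorphD rmorphM /= horner_mx_X horner_mx_C linearD/= tr_scalar_mx.
  by rewrite trmx_mul Asym IH; congr (_ + _); exact: comm_mx_horner.
have T4 : T *m T *m (T *m T) = A.
  have -> : T *m T *m (T *m T) = horner_mx A (p * p * (p * p)).
    by rewrite !rmorphM.
  apply: (@map_mx_inj _ _ toC); rewrite map_horner_mx -/AC [in LHS]ACE.
  rewrite -ACE (horner_mx_diagonalized _ Pu ACE) [RHS]ACE.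
  suff -> : map_mx (horner (map_poly toC (p * p * (p * p)))) d = d by [].
  apply/rowP => i; rewrite mxE.
  have [li0 dli] := lP i; rewrite dli horner_map; congr toC.
  have pl : p.[l i] = Num.sqrt (Num.sqrt (l i)).
    by apply: pE; apply: map_f; rewrite mem_enum.
  by rewrite !hornerM pl -!expr2 !sqr_sqrtr// sqrtr_ge0.
exists (T *m T); split => //; split; first by rewrite trmx_mul Tsym.
move=> v; rewrite /mulv trmx_mul Tsym mulmxA.
have -> : dot (v *m T *m T) v = dot (v *m T) (v *m T).
  by rewrite !dotE trmx_mul Tsym !mulmxA.
exact: dot_ge0.
Qed.

End psd_sqrt_exists.

(** * The seminorm defined by a positive semi-definite matrix *)

Section psd_seminorm.
Context {R : realType} {n : nat}.
Implicit Types (A : 'M[R]_n.+1) (v w : 'rV[R]_n.+1) (a : R).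

Lemma dotDl v1 v2 w : dot (v1 + v2) w = dot v1 w + dot v2 w.
Proof. by rewrite /dot -big_split; apply: eq_bigr => i _; rewrite mxE mulrDl. Qed.

Lemma dotZl a v w : dot (a *: v) w = a * dot v w.
Proof. by rewrite /dot mulr_sumr; apply: eq_bigr => i _; rewrite mxE mulrA. Qed.

Lemma dotDr v w1 w2 : dot v (w1 + w2) = dot v w1 + dot v w2.
Proof. by rewrite dotC dotDl !(dotC _ v). Qed.

Lemma dotZr a v w : dot v (a *: w) = a * dot v w.
Proof. by rewrite dotC dotZl dotC. Qed.

Lemma enorm_ge0 v : 0 <= enorm v. Proof. exact: sqrtr_ge0. Qed.

Lemma sqr_enorm v : enorm v ^+ 2 = dot v v.
Proof. by rewrite sqr_sqrtr// dot_ge0. Qed.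

Lemma ler_dot v w : `|dot v w| <= enorm v * enorm w.
Proof.
have [->|w0] := eqVneq w 0.
  rewrite /dot big1 ?normr0 ?mulr_ge0 ?enorm_ge0// => i _.
  by rewrite mxE mulr0.
have ww : 0 < dot w w by rewrite lt_def dot_eq0 w0 dot_ge0.
rewrite -(ler_sqr (_ : _ \in Num.nneg)) ?nnegrE ?mulr_ge0 ?enorm_ge0//.
rewrite exprMn !sqr_enorm real_normK ?num_real// -subr_ge0 -(pmulr_rge0 _ ww).
have := dot_ge0 (dot w w *: v - dot v w *: w).
rewrite -scaleNr !(dotDl, dotDr, dotZl, dotZr) (dotC w v); congr (0 <= _).
ring.
Qed.

Lemma ler_enormD v w : enorm (v + w) <= enorm v + enorm w.
Proof.
rewrite -(ler_sqr (_ : _ \in Num.nneg)) ?nnegrE ?addr_ge0 ?enorm_ge0//.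
rewrite sqrrD !sqr_enorm dotDl !dotDr (dotC w v).
have := le_trans (ler_norm _) (ler_dot v w); lra.
Qed.

Lemma enormZ a v : enorm (a *: v) = `|a| * enorm v.
Proof. by rewrite /enorm dotZl dotZr mulrA -expr2 sqrtrM ?sqr_ge0// sqrtr_sqr. Qed.

Lemma psd_sqrtP A : psd A -> psd (psd_sqrt A) /\ psd_sqrt A *m psd_sqrt A = A.
Proof. by move=> /psd_sqrt_exists ex; have := xgetPex 0 ex. Qed.

Lemma mulvDr A v w : mulv A (v + w) = mulv A v + mulv A w.
Proof. exact: mulmxDl. Qed.

Lemma mulvZr A a v : mulv A (a *: v) = a *: mulv A v.
Proof. by rewrite /mulv -scalemxAl. Qed.

Lemma dot_mulv_sqrt A v w : psd A ->
  dot (mulv A v) w = dot (mulv (psd_sqrt A) v) (mulv (psd_sqrt A) w).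
Proof.
move=> Apsd; have [[Ssym _] SA] := psd_sqrtP Apsd.
rewrite !dotE /mulv Apsd.1 -{1}SA Ssym trmx_mul Ssym.
by rewrite !mulmxA.
Qed.

Lemma sqr_enorm_sqrt A v : psd A ->
  enorm (mulv (psd_sqrt A) v) ^+ 2 = dot (mulv A v) v.
Proof. by move=> Apsd; rewrite sqr_enorm -dot_mulv_sqrt. Qed.

Lemma enorm_sqrtE A v : psd A ->
  enorm (mulv (psd_sqrt A) v) = Num.sqrt (dot (mulv A v) v).
Proof.
by move=> Apsd; rewrite -sqr_enorm_sqrt// sqrtr_sqr ger0_norm// enorm_ge0.
Qed.

Lemma ler_dot_mulv A v w : psd A -> `|dot (mulv A v) w| <=
  enorm (mulv (psd_sqrt A) v) * enorm (mulv (psd_sqrt A) w).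
Proof. by move=> Apsd; rewrite dot_mulv_sqrt//; exact: ler_dot. Qed.

Lemma dot_mulvE A v w : dot (mulv A v) w = \sum_i \sum_j A i j * v 0 j * w 0 i.
Proof.
rewrite /dot; apply: eq_bigr => i _; rewrite mxE mulr_suml.
by apply: eq_bigr => j _; rewrite mxE (mulrC (v 0 j)).
Qed.

(** A substitute for [op_norm] whose measurability in x follows at once from that of the entries of
    [Q x]; [op_norm] controls it up to a dimensional factor. *)
Definition entry_sum A : R := \sum_i \sum_j `|A i j|.

Lemma entry_sum_ge0 A : 0 <= entry_sum A.
Proof. by apply: sumr_ge0 => i _; apply: sumr_ge0. Qed.

Lemma dot_mulv_le A v L : 0 <= L -> (forall i, `|v 0 i| <= L) ->
  dot (mulv A v) v <= entry_sum A * L ^+ 2.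
Proof.
move=> L0 vL; rewrite dot_mulvE /entry_sum mulr_suml; apply: ler_sum => i _.
rewrite mulr_suml; apply: ler_sum => j _; apply: (le_trans (ler_norm _)).
by rewrite !normrM -mulrA ler_wpM2l// expr2 ler_pM.
Qed.

Lemma op_norm_ge_entry A i j : `|A i j| <= op_norm A.
Proof.
have entry_le v k : `|v 0 k| <= enorm v.
  rewrite -sqrtr_sqr ler_sqrt ?dot_ge0// /dot (bigD1 k)//= -expr2 lerDl.
  by apply: sumr_ge0 => l _; rewrite -expr2 sqr_ge0.
pose e : 'rV[R]_n.+1 := delta_mx 0 j.
have ee : enorm e = 1.
  rewrite /enorm /dot (bigD1 j)//= big1 => [|k kj].
    by rewrite !mxE !eqxx mulr1 addr0 sqrtr1.
  by rewrite !mxE (negbTE kj) andbF mulr0.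
have Ae : `|A i j| <= enorm (mulv A e).
  apply: le_trans (entry_le _ i); rewrite /mulv -rowE !mxE//.
apply: (le_trans Ae); apply: ub_le_sup; last by exists e.
(* [op_norm] is a supremum, so a finite upper bound has to be exhibited: coordinates of a unit
   vector are at most 1, and the row sums of absolute values bound those of its image. *)
exists (Num.sqrt (\sum_(k < n.+1) (\sum_(l < n.+1) `|A k l|) ^+ 2)).
move=> _ [v /= v1 <-]; rewrite ler_sqrt; last first.
  by apply: sumr_ge0 => k _; rewrite sqr_ge0.
apply: ler_sum => k _; rewrite -expr2 -[leLHS]real_normK ?num_real//.
rewrite ler_sqr ?nnegrE// ?sumr_ge0// mxE; apply: (le_trans (ler_norm_sum _ _ _)).
apply: ler_sum => l _; rewrite normrM mxE mulrC ler_piMr//.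
by rewrite -v1 entry_le.
Qed.

Lemma entry_sum_le_op_norm A : entry_sum A <= (n.+1 * n.+1)%:R * op_norm A.
Proof.
apply: (@le_trans _ _ (\sum_(i < n.+1) \sum_(j < n.+1) op_norm A)).
  by apply: ler_sum => i _; apply: ler_sum => j _; exact: op_norm_ge_entry.
by rewrite !sumr_const !card_ord -mulrnA mulr_natl.
Qed.

End psd_seminorm.

(** * Gradients of Lipschitz functions *)

Section lipschitz.
Context {R : realType} {n : nat}.
Implicit Types (f g : 'rV[R]_n.+1 -> R) (x y v : 'rV[R]_n.+1) (L : R).

Lemma lipschitzP f : lipschitz f <->
  exists2 L, 0 <= L & forall x y, `|f x - f y| <= L * `|x - y|.
Proof.
split=> [|[L L0 fL]].
  move=> [M [_ Mf]].
  exists (`|M| + 1); first by rewrite addr_ge0.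
  move=> x y; apply: (Mf (`|M| + 1) _ (x, y)) => //.
  by rewrite (le_lt_trans (ler_norm M))// ltrDl.
exists L; split; first exact: num_real.
move=> M LM [x y] _ /=; apply: le_trans (fL x y) _.
by rewrite ler_wpM2r// ltW.
Qed.

Lemma lipschitz_cont f : lipschitz f -> continuous f.
Proof.
move=> /lipschitzP[L L0 fL] x; apply/(cvgrPdist_lt (F := nbhs x)) => e e0.
have L1 : 0 < L + 1 by rewrite ltr_wpDl.
near=> y; apply: (le_lt_trans (fL x y)).
apply: (@le_lt_trans _ _ ((L + 1) * `|x - y|)).
  by rewrite ler_wpM2r// lerDl.
rewrite -ltr_pdivlMl//; near: y; apply: cvgr_dist_lt => //.
by rewrite mulr_gt0// invr_gt0.
Unshelve. all: by end_near. Qed.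

Lemma continuous_leb_measurable D f : continuous f -> leb_measurable_fun D f.
Proof.
move=> cf; rewrite /leb_measurable_fun; apply: measurable_funTS.
apply: (measurability _ (RGenOInfty.measurableE R)) => //.
move=> _ [_ [r ->] <-]; rewrite setTI; apply: open_lmeasurable.
move/continuousP : cf; apply; exact: interval_open.
Qed.

End lipschitz.


(** * Partial derivatives with default value 0 *)

Section limit_or_zero.
Context {R : realType}.
Implicit Types (a b : R -> R) (F : set_system R).

Lemma lim_dvg a F : ~ cvg (a @ F) -> lim (a @ F) = 0.
Proof. exact: dvgP. Qed.

(* Holds even where the limits do not exist, since they are then 0. *)
Lemma lim_scale F (FF : ProperFilter F) a b c :
  (fun h => a h - c * b h) @ F --> 0 -> lim (a @ F) = c * lim (b @ F).
Proof.
move=> r0; have aE : a = (fun h => c * b h + (a h - c * b h)).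
  by apply/funext => h; rewrite addrC subrK.
have [c0|c0] := eqVneq c 0.
  rewrite c0 mul0r; apply/cvg_lim => //; move: r0.
  by under eq_fun do rewrite c0 mul0r subr0.
have [/cvg_ex[l bl]|nb] := pselect (cvg (b @ F)).
  rewrite (cvg_lim _ bl)//; apply/cvg_lim => //; rewrite aE -[c * l]addr0.
  by apply: cvgD => //; exact: cvgMr.
rewrite (lim_dvg nb) mulr0 lim_dvg// => /cvg_ex[l al]; apply: nb.
apply/cvg_ex; exists (c^-1 * (l - 0)).
rewrite (_ : b = (fun h => c^-1 * (a h - (a h - c * b h)))).
  by apply: cvgMr; apply: cvgB.
by apply/funext => h; rewrite subKr mulKf.
Unshelve. all: by end_near. Qed.

End limit_or_zero.

Section gradient.
Context {R : realType} {n : nat}.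
Implicit Types (f g F : 'rV[R]_n.+1 -> R) (x y v : 'rV[R]_n.+1) (L : R) (i : 'I_n.+1).

Let basis i : 'rV[R]_n.+1 := delta_mx 0 i.

Definition dquot f i x h : R := h^-1 * (f (h *: basis i + x) - f x).

Lemma gradE f x i : grad f x 0 i = lim (dquot f i x @ 0^').
Proof. by rewrite mxE. Qed.

Lemma norm_basis i : `|basis i| = 1.
Proof.
apply/eqP; rewrite eq_le; apply/andP; split.
  apply/ler_addgt0Pr => e e0; apply/ltW/rV_norm_ltP => [|j]; first exact: addr_gt0.
  by rewrite mxE; case: (_ && _); rewrite ?normr1 ?normr0 ?ltrDl// addr_gt0.
by apply: le_trans (rV_coord_le _ i); rewrite mxE !eqxx normr1.
Qed.

Lemma shift_dist i x h : `|h *: basis i + x - x| = `|h|.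
Proof. by rewrite addrK normrZ norm_basis mulr1. Qed.

Lemma near0_shift i x (U : set 'rV[R]_n.+1) : nbhs x U ->
  \forall h \near 0^', U (h *: basis i + x).
Proof.
move=> /nbhs_ballP[e /= e0 eU]; near=> h; apply: eU.
rewrite -ball_normE/= distrC shift_dist; near: h.
apply: cvg_within; apply/nbhs_ballP; exists e => // h.
by rewrite -ball_normE /= sub0r normrN.
Unshelve. all: by end_near. Qed.

Lemma lip_dquot f L i x h : (forall x y, `|f x - f y| <= L * `|x - y|) ->
  h != 0 -> `|dquot f i x h| <= L.
Proof.
move=> fL h0; rewrite normrM normfV mulrC ler_pdivrMr ?normr_gt0//.
by apply: le_trans (fL _ _) _; rewrite shift_dist.
Qed.

Lemma grad_le f L x i : 0 <= L -> (forall x y, `|f x - f y| <= L * `|x - y|) ->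
  `|grad f x 0 i| <= L.
Proof.
move=> L0 fL; rewrite gradE; have [|nd] := pselect (cvg (dquot f i x @ 0^')); last first.
  by rewrite lim_dvg// normr0.
move=> fc; rewrite ler_norml; have nL : \forall h \near 0^', `|dquot f i x h| <= L.
  by near=> h; apply: lip_dquot => //; near: h; exact: nbhs_dnbhs_neq.
apply/andP; split; [apply: limr_ge => //|apply: limr_le => //];
  by apply: filterS nL => h; rewrite ler_norml => /andP[].
Unshelve. all: by end_near. Qed.

(** The quadratic remainder makes the difference quotient of [T \o f] differ from [T' (f x)] times
    that of [f] by O(h); [lim_scale] then also covers points where [f] has no partial derivative. *)
Lemma grad_comp f (T T' : R -> R) K x : lipschitz f ->
  (forall s t, `|T t - T s - T' s * (t - s)| <= K * (t - s) ^+ 2) ->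
  grad (T \o f) x = T' (f x) *: grad f x.
Proof.
move=> /lipschitzP[L L0 fL] TK; apply/rowP => i.
rewrite [in RHS]mxE !gradE; apply: lim_scale.
apply/cvgr0Pnorm_le => e e0.
have KL0 : 0 < `|K| * L ^+ 2 + 1 by rewrite ltr_wpDl// mulr_ge0// sqr_ge0.
near=> h.
have h0 : h != 0 by near: h; exact: nbhs_dnbhs_neq.
have he : `|h| <= e / (`|K| * L ^+ 2 + 1).
  near: h; apply: cvg_within; apply/nbhs_ballP.
  exists (e / (`|K| * L ^+ 2 + 1)) => /=; first by rewrite divr_gt0.
  by move=> h; rewrite -ball_normE /= sub0r normrN => /ltW.
set y := h *: basis i + x.
have -> : dquot (T \o f) i x h - T' (f x) * dquot f i x h =
    h^-1 * (T (f y) - T (f x) - T' (f x) * (f y - f x)).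
  by rewrite /dquot /=; ring.
rewrite normrM normfV mulrC ler_pdivrMr ?normr_gt0//.
apply: (le_trans (TK _ _)).
have fyx : (f y - f x) ^+ 2 <= (L * `|h|) ^+ 2.
  rewrite -real_normK ?num_real// ler_sqr ?nnegrE ?mulr_ge0//.
  by apply: le_trans (fL _ _) _; rewrite shift_dist.
apply: (@le_trans _ _ (`|K| * (L * `|h|) ^+ 2)).
  apply: (@le_trans _ _ (`|K| * (f y - f x) ^+ 2)).
    by rewrite ler_wpM2r ?sqr_ge0// ler_norm.
  by rewrite ler_wpM2l.
rewrite exprMn mulrA expr2 mulrA -expr2 ler_wpM2r//.
rewrite ler_pdivlMr// in he; apply: le_trans he; rewrite mulrC ler_wpM2l//.
by rewrite lerDl.
Unshelve. all: by end_near. Qed.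

Lemma grad_near f g x (c : R) : (\forall y \near x, f y = g y + c) ->
  grad f x = grad g x.
Proof.
move=> fg; apply/rowP => i; rewrite !gradE -[RHS]mul1r; apply: lim_scale.
have fgx := nbhs_singleton fg.
apply: (@cvg_trans _ ((fun=> 0 : R) @ (0 : R)^')); last exact: cvg_cst.
apply: near_eq_cvg; near=> h; rewrite mul1r /dquot fgx.
have -> : f (h *: basis i + x) = g (h *: basis i + x) + c.
  by near: h; exact: (near0_shift i fg).
by rewrite [g x + c]addrC opprD addrA addrK subrr.
Unshelve. all: by end_near. Qed.

(** At a minimum the left and right difference quotients have opposite signs, so a limit can only be
    0; without a limit the default value is 0 as well. *)
Lemma grad_min0 f x : (forall y, 0 <= f y) -> f x = 0 -> grad f x = 0.
Proof.
move=> f0 fx; apply/rowP => i; rewrite gradE [RHS]mxE.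
have [fc|] := pselect (cvg (dquot f i x @ 0^')); last exact: lim_dvg.
have qE h : dquot f i x h = h^-1 * f (h *: basis i + x) by rewrite /dquot fx subr0.
have nn : \forall h \near (0 : R)^'-, dquot f i x h <= 0.
  by near=> h; rewrite qE mulr_le0_ge0// invr_le0; near: h; exact: nbhs_left_le.
have np : \forall h \near (0 : R)^'+, 0 <= dquot f i x h.
  by near=> h; rewrite qE mulr_ge0// invr_ge0; near: h; exact: nbhs_right_ge.
have /cvg_ex[l ql] := fc.
have lr := cvg_dnbhs_at_right ql; have ll := cvg_dnbhs_at_left ql.
rewrite (cvg_lim _ ql)//; apply/eqP; rewrite eq_le; apply/andP; split.
  by rewrite -(cvg_lim _ ll)//; apply: limr_le => //; exact: (cvgP _ ll).
by rewrite -(cvg_lim _ lr)//; apply: limr_ge => //; exact: (cvgP _ lr).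
Unshelve. all: by end_near. Qed.

End gradient.

(** * Measurability of partial derivatives *)

Section gradient_measurable.
Context {R : realType} {n : nat}.
Implicit Types (f : 'rV[R]_n.+1 -> R) (x : 'rV[R]_n.+1) (i : 'I_n.+1).

Let small (m : nat) (h : R) : Prop := 0 < `|h| < m.+1%:R^-1.

(** The Cauchy criterion for the difference quotients at 0, with countably many tolerances and
    radii: the set where the partial derivative exists. *)
Let diff_set f i : set 'rV[R]_n.+1 := \bigcap_k \bigcup_m
  [set x | forall h h', small m h -> small m h' ->
    `|dquot f i x h - dquot f i x h'| <= k.+1%:R^-1].

Let diff_setP f i x : diff_set f i x <-> cvg (dquot f i x @ 0^').
Proof.
split=> [fx|/cvg_ex[l fl] k _].
  apply: cauchy_cvg; apply: cauchy_exP => e /= e0.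
  have [m _ mh] := fx (Num.truncn e^-1) Logic.I.
  (* The increment [m.+2%:R^-1] is positive and strictly below [m.+1%:R^-1], hence admissible for
     [m]. *)
  exists (dquot f i x (m.+2%:R^-1)); near=> h; rewrite -ball_normE/=.
  apply: (@le_lt_trans _ _ (Num.truncn e^-1).+1%:R^-1); last first.
    by rewrite invf_plt ?posrE//; exact: truncnS_gt.
  apply: mh.
    by rewrite /small ger0_norm// invr_gt0 ltf_pV2 ?posrE// ltr_nat ltnS leqnn andbT ltr0n.
  rewrite /small normr_gt0; apply/andP; split; first by near: h; exact: nbhs_dnbhs_neq.
  near: h; apply: cvg_within; apply/nbhs_ballP; exists m.+1%:R^-1 => //=.
  by move=> h; rewrite -ball_normE /= sub0r normrN.
have k0 : 0 < k.+1%:R^-1 / 2 :> R by rewrite divr_gt0.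
have /cvgrPdist_lt/(_ _ k0) := fl.
rewrite near_withinE => /nbhs_ballP[e /= e0 eh].
exists (Num.truncn e^-1) => // h h' /andP[h0 he] /andP[h'0 h'e].
have ee : (Num.truncn e^-1).+1%:R^-1 < e.
  by rewrite invf_plt ?posrE//; exact: truncnS_gt.
have lh : `|l - dquot f i x h| < k.+1%:R^-1 / 2.
  by apply: eh; rewrite -?normr_gt0// -ball_normE/= sub0r normrN (lt_trans he).
have lh' : `|l - dquot f i x h'| < k.+1%:R^-1 / 2.
  by apply: eh; rewrite -?normr_gt0// -ball_normE/= sub0r normrN (lt_trans h'e).
rewrite (_ : _ - _ = (l - dquot f i x h') - (l - dquot f i x h)); last ring.
by apply: (le_trans (ler_normB _ _)); rewrite [leRHS]splitr lerD// ltW.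
Unshelve. all: by end_near. Qed.

Let cont_dquot f i h : continuous f -> continuous (fun x => dquot f i x h).
Proof.
move=> cf x; apply: (@continuousM _ _ (fun=> h^-1)
  (fun x => f (h *: delta_mx 0 i + x) - f x)); first exact: cst_continuous.
apply: (@continuousB _ _ _ (fun x => f (h *: delta_mx 0 i + x))); last exact: cf.
apply: (@continuous_comp _ _ _ (fun x => h *: delta_mx 0 i + x) f); last exact: cf.
apply: (@continuousD _ _ _ (fun=> h *: delta_mx 0 i) id).
  exact: cst_continuous.
exact: cvg_id.
Qed.

(** Uncountably many increments [h], [h'] occur in the inner condition, but as [f] is continuous
    they define an intersection of closed sets. *)
Let diff_set_measurable f i : continuous f -> lmeasurable (diff_set f i).
Proof.
move=> cf; apply: bigcap_measurableType => k _; apply: bigcup_measurable => m _.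
have -> : [set x | forall h h', small m h -> small m h' ->
    `|dquot f i x h - dquot f i x h'| <= k.+1%:R^-1] =
  \bigcap_(p in [set p : R * R | small m p.1 /\ small m p.2])
    [set x | `|dquot f i x p.1 - dquot f i x p.2| <= k.+1%:R^-1].
  by apply/seteqP; split=> x H => [[h h'] [? ?]|h h' ? ?];
    [exact: H|exact: (H (h, h'))].
apply: closed_lmeasurable; apply: closed_bigI => p _.
apply: (@preimage_closed _ _ (fun x => dquot f i x p.1 - dquot f i x p.2)
  [set y | `|y| <= k.+1%:R^-1]).
  move=> x _; apply: (@continuousB _ _ _ (dquot f i ^~ p.1) (dquot f i ^~ p.2)); exact: cont_dquot.
rewrite (_ : mkset _ = `[- k.+1%:R^-1, k.+1%:R^-1]%classic).
  exact: interval_closed.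
by apply/seteqP; split=> y /=; rewrite in_itv/= ler_norml.
Qed.

Lemma grad_measurable D f i : lipschitz f ->
  leb_measurable_fun D (fun x => grad f x 0 i).
Proof.
move=> /lipschitz_cont cf; rewrite /leb_measurable_fun; apply: measurable_funTS.
(* The indicator makes the sequence converge at every point: to the derivative where it exists, to
   the default value 0 elsewhere. *)
pose q (m : nat) x : R := \1_(diff_set f i) x * dquot f i x m.+1%:R^-1.
apply: (@measurable_fun_cvg _ (caratheodory_type (@lebesgue_outer R n)) R setT q) => [m|x _].
  apply: measurable_funM.
    by apply/measurable_indicP; exact: diff_set_measurable.
  by apply: continuous_leb_measurable; exact: cont_dquot.
rewrite gradE /q; have [dx|ndx] := pselect (diff_set f i x).
  rewrite indicE mem_set//; under eq_fun do rewrite mul1r.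
  have /diff_setP/cvg_ex[l fl] := dx; rewrite (cvg_lim _ fl)//.
  apply: cvg_comp fl => A A0.
  have h : \forall m \near \oo, harmonic m != 0 -> A (harmonic m) := cvg_harmonic A0.
  by apply: (@filterS _ \oo _ _ _ _ h) => m; apply; exact: lt0r_neq0 (harmonic_gt0 m).
rewrite indicE memNset//; under eq_fun do rewrite mul0r.
rewrite lim_dvg; first exact: cvg_cst.
by move=> fc; apply: ndx; apply/diff_setP.
Qed.

End gradient_measurable.

(** * Integral estimates *)

Lemma gt0_powRD (R : realType) (x r s : R) : 0 < x ->
  x `^ (r + s) = x `^ r * x `^ s.
Proof. by move=> x0; apply: powRD; rewrite (gt_eqF x0) implybT. Qed.

Lemma gt0_powRB (R : realType) (x r s : R) : 0 < x ->
  x `^ (r - s) = x `^ r / x `^ s.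
Proof. by move=> x0; rewrite gt0_powRD// powRN. Qed.

Lemma powR_div (R : realType) (x y a : R) : 0 <= x -> 0 <= y ->
  (x / y) `^ a = x `^ a / y `^ a.
Proof.
move=> x0 y0; rewrite powRM ?invr_ge0//; congr (_ * _).
by rewrite -(powR_inv1 y0) -powRrM mulN1r powRN.
Qed.

Section integral_estimates.
Context d (T : measurableType d) (R : realType) (mu : {measure set T -> \bar R}).
Implicit Types (A D : set T) (h : T -> R).

Lemma chebyshev_integral D h l : measurable D -> measurable_fun D h ->
  (forall x, D x -> 0 <= h x) -> 0 <= l ->
  (l%:E * mu (D `&` [set x | (l <= h x)%R]) <= \int[mu]_(x in D) (h x)%:E)%E.
Proof.
move=> mD mh h0 l0.
have mE : measurable (D `&` [set x | l <= h x]).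
  rewrite (_ : [set x | _] = h @^-1` `[l, +oo[%classic); first exact: mh.
  by apply/seteqP; split => x /=; rewrite in_itv/= andbT.
rewrite -integral_cst//.
apply: (@le_trans _ _ (\int[mu]_(x in D `&` [set x | (l <= h x)%R]) (h x)%:E)%E).
  apply: ge0_le_integral => //.
  - by apply/measurable_EFinP; apply: measurable_funS mh => //; exact: subIsetl.
  - by move=> x [_ /=]; rewrite lee_fin.
apply: ge0_subset_integral => //; first exact/measurable_EFinP.
Qed.

Lemma powR_interpolation (a b k y : R) : 0 < a -> a <= b -> 0 < k -> 0 <= y ->
  y `^ a <= k `^ a + k `^ (a - b) * y `^ b.
Proof.
move=> a0 ab k0 y0; have [yk|ky] := leP y k.
  rewrite ler_wpDr ?mulr_ge0 ?powR_ge0//.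
  by rewrite ge0_ler_powR ?nnegrE// ltW.
rewrite ler_wpDl ?powR_ge0//.
have yp : 0 < y by exact: lt_trans ky.
have -> : y `^ a = y `^ (a - b) * y `^ b by rewrite -gt0_powRD// subrK.
rewrite ler_wpM2r ?powR_ge0//.
rewrite -[a - b]opprB !powRN lef_pV2 ?posrE ?powR_gt0//.
by rewrite ge0_ler_powR ?nnegrE ?subr_ge0// ltW.
Qed.

(* A Hoelder inequality up to the factor 2, obtained by integrating
   [powR_interpolation] with the optimal threshold k. *)
Lemma integral_powR_le D A h (a b M V : R) : measurable D -> measurable A ->
  A `<=` D -> measurable_fun D h -> (forall x, D x -> 0 <= h x) ->
  0 < a -> a <= b -> 0 < M -> 0 < V ->
  (\int[mu]_(x in D) (h x `^ b)%:E <= M%:E)%E -> (mu A <= V%:E)%E ->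
  (\int[mu]_(x in A) (h x `^ a)%:E <= (2 * (M `^ (a / b) * V `^ (1 - a / b)))%:E)%E.
Proof.
move=> mD mA AD mh h0 a0 ab M0 V0 hM AV.
have b0 : 0 < b by exact: lt_le_trans ab.
(* This [k] balances the two terms: [k^a V = k^(a - b) M]. *)
pose k := (M / V) `^ b^-1; have k0 : 0 < k by rewrite powR_gt0// divr_gt0.
have mhA : measurable_fun A h by exact: measurable_funS mh.
have mhb c : measurable_fun A (fun x => (h x `^ c)%:E).
  by apply/measurable_EFinP; exact: (measurableT_comp (measurable_powR _) mhA).
have mhbD : measurable_fun D (fun x => (h x `^ b)%:E).
  by apply/measurable_EFinP; exact: (measurableT_comp (measurable_powR _) mh).
apply: (@le_trans _ _ (\int[mu]_(x in A)
    ((k `^ a)%:E + (k `^ (a - b))%:E * (h x `^ b)%:E))%E).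
  apply: ge0_le_integral => //.
  - by move=> x Ax; rewrite lee_fin powR_ge0.
  - apply: emeasurable_funD => //; apply: emeasurable_funM => //; exact: mhb.
  - by move=> x Ax; rewrite lee_fin powR_interpolation// h0//; exact: AD.
rewrite ge0_integralD//; last 3 first.
  - by move=> x _; rewrite lee_fin powR_ge0.
  - by move=> x _; rewrite -EFinM lee_fin mulr_ge0// powR_ge0.
  - by apply: emeasurable_funM => //; exact: mhb.
rewrite integral_cst// ge0_integralZl_EFin ?powR_ge0//; last first.
  by move=> x _; rewrite lee_fin powR_ge0.
apply: (@le_trans _ _ ((k `^ a)%:E * V%:E + (k `^ (a - b))%:E * M%:E)%E).
  apply: leeD; first by rewrite lee_wpmul2l// lee_fin powR_ge0.
  rewrite lee_wpmul2l ?lee_fin ?powR_ge0//; apply: le_trans hM.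
  by apply: ge0_subset_integral => // x _; rewrite lee_fin powR_ge0.
rewrite -!EFinM -EFinD lee_fin mulr2n mulrDl !mul1r.
have MV : M / V != 0 by rewrite gt_eqF// divr_gt0.
have bb : b^-1 * b = 1 by rewrite mulVf// gt_eqF.
have kE c : k `^ c = M `^ (c / b) / V `^ (c / b).
  by rewrite /k -powRrM [b^-1 * c]mulrC powR_div// ltW.
rewrite !kE mulrBl divff ?gt_eqF//.
have [M1 V1] := (ltW M0, ltW V0); rewrite !(gt0_powRB, powRr1)//.
have := powR_gt0 (a / b) M0; have := powR_gt0 (a / b) V0.
set x := M `^ _; set y := V `^ _ => y0 x0.
rewrite le_eqVlt; apply/orP; left; apply/eqP; field.
by rewrite !gt_eqF.
Qed.

End integral_estimates.

Section mean_norm.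
Context {R : realType} {n : nat}.
Implicit Types (B : set 'rV[R]_n.+1) (f : 'rV[R]_n.+1 -> R) (r b M I : R).

Lemma mean_norm_integral_le B f r b M : leb B = b%:E -> 0 < b -> 0 < r -> 0 <= M ->
  (mean_norm B r%:E f <= M%:E)%E ->
  (\int[leb]_(x in B) (`|f x| `^ r)%:E <= (b * M `^ r)%:E)%E.
Proof.
move=> Bb b0 r0 M0; rewrite /mean_norm Bb => fM.
have I0 : (0 <= \int[leb]_(x in B) (`|f x| `^ r)%:E)%E.
  by apply: integral_ge0 => x _; rewrite lee_fin powR_ge0.
move: I0 fM; set I := (\int[leb]_(x in B) _)%E => I0 fM.
have ib0 : (0 <= (b%:E)^-1 * I)%E by rewrite mule_ge0// inver gt_eqF// lee_fin invr_ge0 ltW.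
have : (((b%:E)^-1 * I) `^ r^-1 `^ r <= M%:E `^ r)%E.
  apply: gt0_ler_poweR => //; rewrite ?ltW// in_itv/= leey andbT// ?lee_fin//.
  exact: poweR_ge0.
rewrite -poweRrM mulVf ?gt_eqF// poweRe1// poweR_EFin inver gt_eqF//.
by rewrite EFinM lee_pdivrMl.
Qed.

Lemma mean_norm_le B f r b I : leb B = b%:E -> 0 < b -> 0 < r -> 0 <= I ->
  (\int[leb]_(x in B) (`|f x| `^ r)%:E <= I%:E)%E ->
  (mean_norm B r%:E f <= ((I / b) `^ r^-1)%:E)%E.
Proof.
move=> Bb b0 r0 I0 fI; rewrite /mean_norm Bb -poweR_EFin.
have J0 : (0 <= \int[leb]_(x in B) (`|f x| `^ r)%:E)%E.
  by apply: integral_ge0 => x _; rewrite lee_fin powR_ge0.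
have b1 := ltW b0; rewrite inver gt_eqF//; apply: gt0_ler_poweR; rewrite ?invr_ge0//; [exact: ltW|..|].
- by rewrite in_itv/= leey andbT mule_ge0// lee_fin invr_ge0.
- by rewrite in_itv/= leey andbT lee_fin divr_ge0//.
by rewrite [I / b]mulrC EFinM lee_wpmul2l// lee_fin invr_ge0.
Qed.

Lemma Lnorm_onE B f r : 0 < r ->
  Lnorm_on B r%:E f = ((\int[leb]_(x in B) (`|f x| `^ r)%:E) `^ r^-1)%E.
Proof.
move=> r0; rewrite /Lnorm_on unlock; congr (_ `^ _)%E.
rewrite [RHS]integral_mkcond; apply: eq_integral => x _.
rewrite !patchE; case: ifPn => //= _.
by rewrite normr0 powR0// gt_eqF.
Qed.

End mean_norm.

Section integral_monotone.
Context d (T : measurableType d) (R : realType) (mu : {measure set T -> \bar R}).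

(* Unlike [ge0_le_integral], measurability is not assumed. *)
Lemma le_integral_nonneg D (f g : T -> \bar R) :
  (forall x, D x -> 0 <= f x)%E -> (forall x, D x -> f x <= g x)%E ->
  (\int[mu]_(x in D) f x <= \int[mu]_(x in D) g x)%E.
Proof.
move=> f0 fg; rewrite (integral_mkcond D f) (integral_mkcond D g).
have f0' x : (0 <= (f \_ D) x)%E by apply: erestrict_ge0.
have fg' x : ((f \_ D) x <= (g \_ D) x)%E by apply: lee_restrict.
(* The integral of a nonnegative function is a supremum over the simple functions below it, and that
   supremum is monotone. *)
rewrite !ge0_integralTE//; last by move=> x; exact: le_trans (fg' x).
apply: le_ereal_sup => _ [h hf <-]; exists h => // x.
exact: le_trans (hf x) (fg' x).
Qed.

End integral_monotone.

Section leb_measurable_fun.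
Context {R : realType} {n : nat}.
Implicit Types (D E : set 'rV[R]_n.+1) (f g : 'rV[R]_n.+1 -> R).

Lemma leb_measurable_comp D (F : R -> R) f : measurable_fun setT F ->
  leb_measurable_fun D f -> leb_measurable_fun D (fun x => F (f x)).
Proof. exact: measurableT_comp. Qed.

Lemma leb_measurableS D E f : lmeasurable E -> D `<=` E ->
  leb_measurable_fun E f -> leb_measurable_fun D f.
Proof. exact: measurable_funS. Qed.

Lemma leb_measurable_powR D f a : leb_measurable_fun D f ->
  leb_measurable_fun D (fun x => f x `^ a).
Proof. exact: (leb_measurable_comp (measurable_powR a)). Qed.

Lemma leb_measurable_norm D f : leb_measurable_fun D f ->
  leb_measurable_fun D (fun x => `|f x|).
Proof. exact: (leb_measurable_comp (@normr_measurable _ setT)). Qed.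

Lemma leb_measurableM D f g : leb_measurable_fun D f -> leb_measurable_fun D g ->
  leb_measurable_fun D (fun x => f x * g x).
Proof. exact: measurable_funM. Qed.

Lemma leb_measurableB D f g : leb_measurable_fun D f -> leb_measurable_fun D g ->
  leb_measurable_fun D (fun x => f x - g x).
Proof. exact: measurable_funB. Qed.

Lemma leb_measurable_EFin D f : leb_measurable_fun D f ->
  @measurable_fun _ _ (caratheodory_type (@lebesgue_outer R n)) (\bar R) D (EFin \o f).
Proof. by move=> mf; apply/measurable_EFinP. Qed.

Lemma leb_measurable_level D f r : lmeasurable D -> leb_measurable_fun D f ->
  lmeasurable (D `&` [set x | r < f x]).
Proof.
move=> mD mf; rewrite (_ : [set x | _] = f @^-1` `]r, +oo[%classic); first exact: mf.
by apply/seteqP; split => x /=; rewrite in_itv/= andbT.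
Qed.

End leb_measurable_fun.

(** * Degenerate energy *)

Section degenerate_gradient.
Context {R : realType} {n : nat}.
Variables (Omega : set 'rV[R]_n.+1) (p : R) (Q : 'rV[R]_n.+1 -> 'M[R]_n.+1).
Hypotheses (Omega_open : open Omega) (p_gt0 : 0 < p)
  (Q_psd : forall x, Omega x -> psd (Q x)) (Q_loc : Lloc_matrix Omega (p / 2) Q).
Implicit Types (D : set 'rV[R]_n.+1) (f : 'rV[R]_n.+1 -> R)
  (g : 'rV[R]_n.+1 -> 'rV[R]_n.+1) (L : R).

Lemma dot_mulv_measurable D g1 g2 : lmeasurable D -> D `<=` Omega ->
  (forall i, leb_measurable_fun D (fun x => g1 x 0 i)) ->
  (forall i, leb_measurable_fun D (fun x => g2 x 0 i)) ->
  leb_measurable_fun D (fun x => dot (mulv (Q x) (g1 x)) (g2 x)).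
Proof.
move=> mD DO mg1 mg2; rewrite /leb_measurable_fun.
under eq_fun do rewrite dot_mulvE.
apply: measurable_sum => i; apply: measurable_sum => j.
apply: leb_measurableM; last exact: mg2.
apply: leb_measurableM; last exact: mg1.
exact: leb_measurableS (open_lmeasurable Omega_open) DO (Q_loc.1 i j).
Qed.

Lemma Q_abs_measurable D g : lmeasurable D -> D `<=` Omega ->
  (forall i, leb_measurable_fun D (fun x => g x 0 i)) ->
  leb_measurable_fun D (Q_abs Q g).
Proof.
move=> mD DO mg; rewrite /leb_measurable_fun.
apply: (@eq_measurable_fun _ _ (caratheodory_type (@lebesgue_outer R n)) R D
  (fun x => Num.sqrt (dot (mulv (Q x) (g x)) (g x)))).
  by move=> x /set_mem Dx; rewrite /Q_abs enorm_sqrtE//; apply: Q_psd; exact: DO.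
apply: leb_measurable_comp; last exact: dot_mulv_measurable.
by apply: continuous_measurable_fun; exact: sqrt_continuous.
Qed.

Lemma Q_abs_grad_measurable D f : lmeasurable D -> D `<=` Omega -> lipschitz f ->
  leb_measurable_fun D (Q_abs Q (grad f)).
Proof.
by move=> mD DO lf; apply: Q_abs_measurable => // i; exact: grad_measurable.
Qed.

Lemma Q_abs_ge0 g x : 0 <= Q_abs Q g x. Proof. exact: enorm_ge0. Qed.

Lemma Q_abs_le g L x : Omega x -> 0 <= L -> (forall i, `|g x 0 i| <= L) ->
  Q_abs Q g x `^ p <= (entry_sum (Q x) * L ^+ 2) `^ (p / 2).
Proof.
move=> Ox L0 gL.
have Q0 := dot_mulv_le (Q x) L0 gL.
have qp : 0 <= dot (mulv (Q x) (g x)) (g x) by exact: (Q_psd Ox).2.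
rewrite /Q_abs enorm_sqrtE; last exact: Q_psd.
rewrite -powR12_sqrt// -powRrM mulrC ge0_ler_powR// ?nnegrE//.
- by rewrite divr_ge0// ltW.
- by rewrite mulr_ge0 ?entry_sum_ge0// sqr_ge0.
Qed.

Lemma entry_sum_measurable D L : lmeasurable D -> D `<=` Omega ->
  leb_measurable_fun D (fun x => (entry_sum (Q x) * L) `^ (p / 2)).
Proof.
move=> mD DO; apply: leb_measurable_powR; apply: leb_measurableM; last exact: measurable_cst.
apply: measurable_sum => i; apply: measurable_sum => j.
apply: leb_measurable_norm.
exact: leb_measurableS (open_lmeasurable Omega_open) DO (Q_loc.1 i j).
Qed.

Lemma entry_sum_integral_fin (K : set 'rV[R]_n.+1) L : compact K -> K `<=` Omega -> 0 <= L ->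
  (\int[leb]_(x in K) ((entry_sum (Q x) * L) `^ (p / 2))%:E < +oo)%E.
Proof.
move=> cK KO L0.
have opn0 A : 0 <= op_norm A :> R.
  by apply: le_trans (op_norm_ge_entry A ord0 ord0).
pose N : R := (n.+1 * n.+1)%:R; have N0 : 0 < N by rewrite ltr0n.
have mK : lmeasurable K.
  by apply: closed_lmeasurable; apply: compact_closed => //; exact: norm_hausdorff.
have -> : (\int[leb]_(x in K) ((entry_sum (Q x) * L) `^ (p / 2))%:E =
    ((N * L) `^ (p / 2))%:E * \int[leb]_(x in K) ((entry_sum (Q x) / N) `^ (p / 2))%:E)%E.
  rewrite -ge0_integralZl_EFin ?powR_ge0//; last 2 first.
  - by move=> x _; rewrite lee_fin powR_ge0.
  - by apply/measurable_EFinP; exact: entry_sum_measurable.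
  apply: eq_integral => x _; rewrite -EFinM -powRM ?mulr_ge0 ?invr_ge0 ?entry_sum_ge0 ?(ltW N0)//.
  by congr (_ `^ _)%:E; field; rewrite gt_eqF.
apply: lte_mul_pinfty => //; first by rewrite lee_fin powR_ge0.
apply: le_lt_trans (Q_loc.2 K cK KO).
apply: le_integral_nonneg => x Kx; rewrite lee_fin ?powR_ge0//.
rewrite ge0_ler_powR ?nnegrE ?divr_ge0 ?(ltW p_gt0) ?entry_sum_ge0 ?(ltW N0)//.
by rewrite ler_pdivrMr// mulrC entry_sum_le_op_norm.
Qed.

Lemma grad_notin_fsupp f x : ~ fsupp f x -> grad f x = 0.
Proof.
move=> nx; rewrite (@grad_near _ _ f (fun=> 0) x 0).
  by apply: grad_min0.
have oC : open (~` fsupp f) by apply: closed_openC; exact: closed_closure.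
have := open_nbhs_nbhs (conj oC nx : open_nbhs x (~` fsupp f)).
apply: filterS => y ny; rewrite addr0; apply/eqP/negP => /negP fy.
by apply: ny; exact: subset_closure.
Qed.

Lemma Q_abs_grad0 f x : grad f x = 0 -> Q_abs Q (grad f) x = 0.
Proof. by rewrite /Q_abs => ->; rewrite /mulv mul0mx /enorm dotE mul0mx mxE sqrtr0. Qed.

Lemma Lip0_compact_supp U f : Lip0 U f -> compact (fsupp f) /\ fsupp f `<=` U.
Proof.
move=> [_ [bf fU]]; split.
  by apply: bounded_closed_compact => //; exact: closed_closure.
by apply: subset_trans fU; exact: subset_closure.
Qed.

(* fsupp f is compact and |sqrt(Q) grad f|^p <= (c |Q|)^(p/2) with Q in L^(p/2)_loc. *)
Lemma energy_fin U D f : U `<=` Omega -> Lip0 U f -> lmeasurable D -> D `<=` Omega ->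
  (\int[leb]_(x in D) (Q_abs Q (grad f) x `^ p)%:E < +oo)%E.
Proof.
move=> UO f0 mD DO; have [cK KU] := Lip0_compact_supp f0.
have [/lipschitzP[L L0 fL] _] := f0.
have KO := subset_trans KU UO.
have mK : lmeasurable (fsupp f) by apply: closed_lmeasurable; exact: closed_closure.
rewrite integral_mkcond.
apply: (@le_lt_trans _ _ (\int[leb]_(x in fsupp f) ((entry_sum (Q x) * L ^+ 2) `^ (p / 2))%:E)%E); last first.
  by apply: entry_sum_integral_fin => //; exact: sqr_ge0.
rewrite [leRHS]integral_mkcond.
apply: le_integral_nonneg => x _; rewrite !patchE.
  by case: ifP => // _; rewrite lee_fin powR_ge0.
have [xK|xK] := boolP (x \in fsupp f).
  case: ifP => [xD|_]; last by rewrite lee_fin powR_ge0.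
  rewrite lee_fin; apply: Q_abs_le => //; first by apply: KO; exact/set_mem.
  by move=> i; exact: grad_le.
case: ifP => // _; rewrite Q_abs_grad0 ?powR0 ?gt_eqF//.
by apply: grad_notin_fsupp => /mem_set; apply/negP.
Qed.

Lemma energy_le_supp U D f : lmeasurable U -> lmeasurable D -> Lip0 U f ->
  (\int[leb]_(x in D) (Q_abs Q (grad f) x `^ p)%:E
    <= \int[leb]_(x in U) (Q_abs Q (grad f) x `^ p)%:E)%E.
Proof.
move=> mU mD f0; have [_ KU] := Lip0_compact_supp f0.
rewrite integral_mkcond [leRHS]integral_mkcond.
apply: le_integral_nonneg => x _; rewrite !patchE.
  by case: ifP => // _; rewrite lee_fin powR_ge0.
have [xK|xK] := boolP (x \in U); first by case: ifP; rewrite ?lee_fin ?powR_ge0.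
case: ifP => // _; rewrite Q_abs_grad0 ?powR0 ?gt_eqF//.
by apply: grad_notin_fsupp => /KU /mem_set; apply/negP.
Qed.

End degenerate_gradient.

Section Lip0.
Context {R : realType} {n : nat}.
Implicit Types (U : set 'rV[R]_n.+1) (f g : 'rV[R]_n.+1 -> R).

Lemma Lip0_sub U f g : Lip0 U f -> lipschitz g -> (forall x, f x = 0 -> g x = 0) ->
  Lip0 U g.
Proof.
move=> [_ [[M [Mr bf]] fU]] lg fg; split => //.
have gf : fsupp g `<=` fsupp f.
  by apply: closure_subset => x /= /negP gx; apply/negP => /eqP/fg/eqP.
split; last by apply: subset_trans fU; exact: closure_subset.
by exists M; split => // M' MM' x /gf; exact: bf.
Qed.

Lemma lipschitz_comp_real f (T : R -> R) K : lipschitz f ->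
  (forall s t, `|T s - T t| <= K * `|s - t|) -> lipschitz (T \o f).
Proof.
move=> /lipschitzP[L L0 fL] TK; apply/lipschitzP; exists (`|K| * L).
  exact: mulr_ge0.
move=> x y /=; apply: le_trans (TK _ _) _; rewrite -mulrA.
apply: (@le_trans _ _ (`|K| * `|f x - f y|)).
  by rewrite ler_wpM2r// ler_norm.
by rewrite ler_wpM2l.
Qed.

Lemma Lip0_comp U f (T : R -> R) K : Lip0 U f -> T 0 = 0 ->
  (forall s t, `|T s - T t| <= K * `|s - t|) -> Lip0 U (T \o f).
Proof.
move=> f0 T0 TK; apply: (Lip0_sub f0) => [|x /= ->//].
exact: lipschitz_comp_real f0.1 TK.
Qed.

Lemma Lip0N U f : Lip0 U f -> Lip0 U (fun x => - f x).
Proof.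
move=> f0; apply: (@Lip0_comp _ _ -%R 1); rewrite ?oppr0// => s t.
by rewrite -opprD normrN mul1r.
Qed.

Lemma gradN f x : lipschitz f -> grad (fun x => - f x) x = - grad f x.
Proof.
move=> lf; rewrite (@grad_comp _ _ f -%R (fun=> -1) 0) ?scaleN1r// => s t.
by rewrite mul0r mulN1r (_ : _ - _ - _ = 0) ?normr0//; ring.
Qed.

Lemma Lip0_eq0 U f x : Lip0 U f -> ~ U x -> f x = 0.
Proof.
move=> /Lip0_compact_supp[_ fU] Ux; apply/eqP/negP => /negP fx; apply: Ux.
by apply: fU; exact: subset_closure.
Qed.

End Lip0.

(** * Level sets and the Poincare property *)

Section balls.
Context {R : realType} {n : nat}.
Variables (Omega : set 'rV[R]_n.+1) (rho : 'rV[R]_n.+1 -> 'rV[R]_n.+1 -> R).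
Hypotheses (Omega_open : open Omega) (rho_compatible : euclidean_compatible Omega rho).
Implicit Types (x y : 'rV[R]_n.+1) (r d e : R).

Lemma enorm_le_norm x : enorm x <= n.+1%:R * `|x|.
Proof.
have n0 : 0 <= n.+1%:R * `|x| by rewrite mulr_ge0.
rewrite -(ler_sqr (_ : _ \in Num.nneg)) ?nnegrE ?enorm_ge0// sqr_enorm exprMn.
apply: (@le_trans _ _ (n.+1%:R * `|x| ^+ 2)).
  have -> : n.+1%:R * `|x| ^+ 2 = \sum_(i < n.+1) `|x| ^+ 2.
    by rewrite sumr_const card_ord mulr_natl.
  apply: ler_sum => i _.
  by rewrite -expr2 -[leLHS]real_normK ?num_real// ler_sqr ?nnegrE// rV_coord_le.
by rewrite ler_wpM2r ?sqr_ge0// expr2 ler_peMl// ler1n.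
Qed.

Lemma norm_le_enorm x : `|x| <= enorm x.
Proof.
apply/ler_addgt0Pr => e e0; apply/ltW/rV_norm_ltP => [|i].
  by rewrite ltr_wpDl ?enorm_ge0.
apply: le_lt_trans (_ : enorm x < _); last by rewrite ltrDl.
rewrite -sqrtr_sqr ler_sqrt ?dot_ge0// /dot (bigD1 i)//= -expr2 lerDl.
by apply: sumr_ge0 => l _; rewrite -expr2 sqr_ge0.
Qed.

Lemma eball_nbhs x d : Omega x -> 0 < d -> nbhs x (eball Omega x d).
Proof.
move=> Ox d0; apply: filterI; first exact: open_nbhs_nbhs.
apply/nbhs_ballP; exists (d / n.+1%:R) => /=; first by rewrite divr_gt0.
move=> y; rewrite -ball_normE /= ltr_pdivlMr// mulrC => h.
by apply: le_lt_trans (enorm_le_norm _) h.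
Qed.

(** A quasi-metric ball need not be open; compatibility makes it a neighbourhood of its centre,
    hence the use of interiors of balls below. *)
Lemma qball_nbhs x r : Omega x -> 0 < r -> nbhs x (qball Omega rho x r).
Proof.
move=> Ox r0; have [/(_ _ r0)[d d0 dr] _] := rho_compatible Ox.
by apply: filterS dr _; exact: eball_nbhs.
Qed.

Lemma qball_sub x r e : r <= e -> qball Omega rho x r `<=` qball Omega rho x e.
Proof. by move=> re y [Oy yr]; split => //; exact: lt_le_trans re. Qed.

Lemma qball_small x : Omega x ->
  exists2 e, 0 < e & bounded_set (qball Omega rho x e).
Proof.
move=> Ox; have [_ /(_ _ ltr01)[e e0 ed]] := rho_compatible Ox; exists e => //.
exists (1 + `|x|); split => [|M Mx y /ed[_ yx]]; first exact: num_real.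
apply: le_trans (ltW Mx); rewrite -[y](subrK x) -opprB.
apply: (le_trans (ler_normD _ _)); rewrite normrN lerD2r.
by apply: le_trans (norm_le_enorm _) (ltW yx).
Qed.

Lemma qball_lebesgue x r : Omega x -> 0 < r -> bounded_set (qball Omega rho x r) ->
  exists2 b, 0 < b & leb (qball Omega rho x r) = b%:E.
Proof.
move=> Ox r0 bB; have fB := bounded_lebesgue_fin bB.
have pB : (0 < leb (qball Omega rho x r))%E.
  apply: (@lt_le_trans _ _ (leb (qball Omega rho x r)°)).
    apply: open_lebesgue_gt0; first exact: open_interior.
    by exists x; exact: qball_nbhs.
  by apply: le_lebesgue_outer; exact: interior_subset.
move: pB fB; case: (leb _) => [b| |]//; rewrite lte_fin => b0 _; by exists b.
Qed.

End balls.

Section compact_union.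
Context {T : ptopologicalType}.

(** Heine-Borel as an induction principle, meant for [level_bound], whose constant may grow with the
    number of sets in a finite cover. *)
Lemma compact_ind (P : set T -> Prop) (K : set T) : compact K -> P set0 ->
  (forall A B, A `<=` B -> P B -> P A) -> (forall A B, P A -> P B -> P (A `|` B)) ->
  (forall x, K x -> exists2 U, nbhs x U & P U) -> P K.
Proof.
rewrite compact_cover => cK P0 Psub PU Ploc.
have /choice[f fP] : forall x, exists U, K x -> nbhs x U /\ P U.
  move=> x; have [/Ploc[U xU PU']|nK] := pselect (K x); first by exists U.
  by exists set0.
have [|x Kx|D DK KD] := cK T K (fun x => (f x)°).
- by move=> x _; exact: open_interior.
- by exists x => //; have [] := fP x Kx.
have PD (s : seq T) : {subset s <= K} -> P (\big[setU/set0]_(i <- s) (f i)°).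
  elim: s => [_|i s IH sK]; first by rewrite big_nil.
  rewrite big_cons; apply: PU; last first.
    by apply: IH => j js; apply: sK; rewrite inE js orbT.
  have /set_mem Ki : i \in K by apply: sK; rewrite mem_head.
  by apply: Psub (fP i Ki).2; exact: interior_subset.
by apply: Psub KD _; rewrite /cover bigcup_seq; exact: PD.
Qed.

End compact_union.

Section level_bound.
Context {R : realType} {n : nat}.
Variables (Theta : set 'rV[R]_n.+1) (p : R) (Q : 'rV[R]_n.+1 -> 'M[R]_n.+1).
Implicit Types (A B : set 'rV[R]_n.+1) (f : 'rV[R]_n.+1 -> R) (a w l : R).

Definition energy f : \bar R :=
  (\int[leb]_(x in Theta) (Q_abs Q (grad f) x `^ p)%:E)%E.

(* Weak-type inequality on A: the weak L^(p a) quasi-norm of f is bounded by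
   the L^p norm of sqrt(Q) grad f. *)
Definition level_bound a A : Prop := exists2 C : R, 0 < C &
  forall f, Lip0 Theta f -> forall w, 0 < w -> (energy f <= w%:E)%E ->
  forall l, 0 < l ->
  (leb (A `&` [set x | (l < `|f x|)%R]) <= (C * (w / l `^ p) `^ a)%:E)%E.

Lemma level_bound0 a : level_bound a set0.
Proof.
exists 1 => // f _ w w0 _ l l0; rewrite set0I measure0 lee_fin.
by rewrite mul1r powR_ge0.
Qed.

Lemma level_bound_sub a A B : A `<=` B -> level_bound a B -> level_bound a A.
Proof.
move=> AB [C C0 CP]; exists C => // f f0 w w0 fw l l0.
apply: le_trans (CP f f0 w w0 fw l l0).
by apply: le_lebesgue_outer; exact: setSI.
Qed.

Lemma level_boundU a A B : level_bound a A -> level_bound a B ->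
  level_bound a (A `|` B).
Proof.
move=> [C C0 CP] [D D0 DP]; exists (C + D); first exact: addr_gt0.
move=> f f0 w w0 fw l l0; rewrite setIUl mulrDl EFinD.
apply: (@le_trans _ _ (leb (A `&` [set x | (l < `|f x|)%R]) +
    leb (B `&` [set x | (l < `|f x|)%R])))%E.
  exact: outer_measureU2.
by apply: leeD; [exact: CP|exact: DP].
Qed.

End level_bound.

(** * Propagation of level bounds through overlapping balls *)

Section poincare.
Context {R : realType} {n : nat}.
Variables (Omega : set 'rV[R]_n.+1) (rho : 'rV[R]_n.+1 -> 'rV[R]_n.+1 -> R).
Hypotheses (Omega_open : open Omega) (Omega_connected : connected Omega)
  (rho_measurable : forall x r, Omega x -> 0 < r -> lmeasurable (qball Omega rho x r))
  (rho_compatible : euclidean_compatible Omega rho).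
Variables (p a : R) (Q : 'rV[R]_n.+1 -> 'M[R]_n.+1) (r1 : 'rV[R]_n.+1 -> R).
Hypotheses (p_gt0 : 0 < p) (a_gt0 : 0 < a)
  (Q_psd : forall x, Omega x -> psd (Q x)) (Q_loc : Lloc_matrix Omega (p / 2) Q)
  (r1_gt0 : forall x, Omega x -> 0 < r1 x).
Variables (C1 beta : R).
Hypotheses (C1_gt0 : 0 < C1) (beta_ge1 : 1 <= beta)
  (poincare : forall y r, Omega y -> 0 < beta * r < r1 y ->
    forall f : 'rV[R]_n.+1 -> R, lipschitz f ->
    Lp (qball Omega rho y (beta * r)) p%:E (Q_abs Q (grad f)) ->
    (mean_norm (qball Omega rho y r) (p%:E * a%:E)
        (fun x => f x - mean (qball Omega rho y r) f)%R
     <= (C1 * r)%:E * mean_norm (qball Omega rho y (beta * r)) p%:E (Q_abs Q (grad f)))%E).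
Variable Theta : set 'rV[R]_n.+1.
Hypotheses (Theta_open : open Theta) (Theta_inside : compactly_inside Theta Omega).

Let B x r := qball Omega rho x r.

Let ThetaO : Theta `<=` Omega.
Proof. by apply: subset_trans Theta_inside.2; exact: subset_closure. Qed.

(** Boundedness of the dilated ball gives both balls finite positive measure, so that normalized
    norms can be turned into integrals. *)
Definition admissible x r : Prop :=
  [/\ 0 < r, beta * r < r1 x & bounded_set (qball Omega rho x (beta * r))].

Lemma admissible_exists x : Omega x -> exists r, admissible x r.
Proof.
move=> Ox; have [e e0 be] := qball_small rho_compatible Ox.
have b0 : 0 < beta by exact: lt_le_trans beta_ge1.
exists (Num.min e (r1 x / 2) / beta).
have m0 : 0 < Num.min e (r1 x / 2) by rewrite lt_min e0 divr_gt0// r1_gt0.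
have bE m : beta * (m / beta) = m by rewrite mulrCA divff ?gt_eqF// mulr1.
rewrite /admissible bE divr_gt0//; split => //.
  by rewrite gt_min ltr_pdivrMr// ltr_pMr ?r1_gt0// ltr1n orbT.
have mb : qball Omega rho x (Num.min e (r1 x / 2)) `<=` qball Omega rho x e.
  by apply: qball_sub; rewrite ge_min lexx.
by case: be => M [Mr bM]; exists M; split => // M' /bM + y /mb; exact.
Qed.

Lemma admissible_ball x r : Omega x -> admissible x r ->
  exists2 b, 0 < b & leb (B x r) = b%:E.
Proof.
move=> Ox [r0 _ bb]; apply: qball_lebesgue => //.
have sub : B x r `<=` B x (beta * r) by apply: qball_sub; rewrite ler_peMl// ltW.
by case: bb => M [Mr bM]; exists M; split => // M' /bM + y /sub; exact.
Qed.

Lemma lebesgue_le_powR (D : set 'rV[R]_n.+1) (h : 'rV[R]_n.+1 -> R) r (l c : R) :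
  lmeasurable D -> leb_measurable_fun D h ->
  0 < r -> 0 < l ->
  (\int[leb]_(x in D) (`|h x| `^ r)%:E <= c%:E)%E ->
  (leb (D `&` [set x | (l < `|h x|)%R]) <= (c / l `^ r)%:E)%E.
Proof.
move=> mD mh r0 l0 hc.
have lr : 0 < l `^ r by exact: powR_gt0.
have := @chebyshev_integral _ (caratheodory_type (@lebesgue_outer R n)) R leb D
  (fun x => `|h x| `^ r) (l `^ r) mD.
move=> /(_ _ (fun x _ => powR_ge0 _ _) (ltW lr)) H.
rewrite [c / _]mulrC EFinM lee_pdivlMl//.
apply: (le_trans _ (le_trans (H _) hc)).
  apply: lee_wpmul2l; first by rewrite lee_fin ltW.
  apply: le_lebesgue_outer => x [Dx /= lx].
  by split => //=; rewrite ge0_ler_powR ?nnegrE ?(ltW r0) ?(ltW l0) ?(ltW lx).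
exact/leb_measurable_powR/leb_measurable_norm.
Qed.

(** The Poincare property followed by Chebyshev's inequality, with [m] the mean of [f] on the ball.
    The radius and the measures of both balls go into [C], which is the same for all [f]. *)
Lemma poincare_level x r : Omega x -> admissible x r -> exists2 C, 0 < C &
  forall f, Lip0 Theta f -> forall w, 0 < w -> (energy Theta p Q f <= w%:E)%E ->
  exists m : R, forall l, 0 < l ->
  (leb (B x r `&` [set y | (l < `|f y - m|)%R]) <= (C * (w / l `^ p) `^ a)%:E)%E.
Proof.
move=> Ox adm; have [b b0 Bb] := admissible_ball Ox adm.
have [r0 rr bb] := adm.
have br0 : 0 < beta * r by rewrite mulr_gt0// (lt_le_trans _ beta_ge1).
have [bB bB0 BbB] := qball_lebesgue Omega_open rho_compatible Ox br0 bb.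
exists (b * (C1 * r) `^ (p * a) / bB `^ a).
  by rewrite divr_gt0 ?powR_gt0// mulr_gt0// powR_gt0// mulr_gt0.
move=> f f0 w w0 fw; have lf := f0.1.
have mBb : lmeasurable (B x (beta * r)) by exact: rho_measurable.
have mB : lmeasurable (B x r) by exact: rho_measurable.
have qE : (\int[leb]_(y in B x (beta * r)) (`|Q_abs Q (grad f) y| `^ p)%:E <= w%:E)%E.
  apply: le_trans fw; rewrite /energy.
  under eq_integral do rewrite ger0_norm ?enorm_ge0//.
  by apply: energy_le_supp => //; exact: open_lmeasurable.
have pa0 : 0 < p * a by exact: mulr_gt0.
have := @poincare x r Ox _ f lf _.
rewrite br0 rr -EFinM => /(_ isT) H.
exists (mean (B x r) f) => l l0.
have lq : Lp (B x (beta * r)) p%:E (Q_abs Q (grad f)).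
  split; first by apply: (Q_abs_grad_measurable Omega_open Q_psd Q_loc mBb _ lf) => y [].
  rewrite Lnorm_onE// poweR_lty//; apply: le_lt_trans qE _; exact: ltry.
have {H} H := H lq.
have H2 := mean_norm_le BbB bB0 p_gt0 (ltW w0) qE.
have M0 : 0 <= C1 * r * (w / bB) `^ p^-1 by rewrite !mulr_ge0 ?powR_ge0// ltW.
have H3 : (\int[leb]_(y in B x r) (`|f y - mean (B x r) f| `^ (p * a))%:E <=
     (b * (C1 * r * (w / bB) `^ p^-1) `^ (p * a))%:E)%E.
  apply: mean_norm_integral_le => //; apply: (le_trans H).
  rewrite (EFinM (C1 * r)); apply: lee_wpmul2l => //.
  by rewrite lee_fin mulr_ge0// ltW.
apply: (le_trans (lebesgue_le_powR _ _ pa0 l0 H3)) => //.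
  apply: continuous_leb_measurable; apply: lipschitz_cont.
  apply: (lipschitz_comp_real (T := fun t => t - mean (B x r) f) (K := 1) lf) => s t.
  by rewrite mul1r (_ : _ - _ = s - t)//; ring.
have [[w1 bB1] lp1] := (ltW w0, ltW bB0, powR_ge0 l p).
have C1r : 0 <= C1 * r by rewrite mulr_ge0 ?ltW.
have e1 : ((w / bB) `^ p^-1) `^ (p * a) = w `^ a / bB `^ a.
  by rewrite -powRrM mulrA mulVf ?gt_eqF// mul1r powR_div.
have e2 : (w / l `^ p) `^ a = w `^ a / l `^ (p * a) by rewrite powR_div// -powRrM.
rewrite lee_fin powRM ?powR_ge0// e1 e2.
rewrite le_eqVlt; apply/orP; left; apply/eqP; field.
by rewrite !gt_eqF ?powR_gt0.
Qed.

(* If w / l^p is small, both f and f - m are at most l at a common point of V,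
   whence |m| <= 2l and |f - m| > l on the set where |f| > 3l. *)
Lemma level_bound_ball x r U : Omega x -> admissible x r -> open U ->
  level_bound Theta p Q a U -> (U `&` (B x r)°) !=set0 ->
  level_bound Theta p Q a (B x r).
Proof.
move=> Ox adm oU [C C0 CP] UB.
have [b b0 Bb] := admissible_ball Ox adm.
have [D D0 DP] := poincare_level Ox adm.
pose V := U `&` (B x r)°.
have oV : open V by apply: openI => //; exact: open_interior.
have VB : V `<=` B x r by move=> y [_ /interior_subset].
have [v v0 Vv] : exists2 v, 0 < v & leb V = v%:E.
  have := open_lebesgue_gt0 oV UB.
  have : (leb V <= b%:E)%E by rewrite -Bb; exact: le_lebesgue_outer.
  case: (leb V) => [v _|//|//]; rewrite lte_fin; by exists v.
(* [D] serves when [z] is small. Otherwise [b / v * (C + D) * z] is at least [b], the measure of the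
   ball, and the bound is trivial. The factor [3^p] passes from the level [k = l / 3] to [l]. *)
pose K := (D + b / v * (C + D)) * (3 `^ p) `^ a.
have bv0 : 0 < b / v * (C + D) by rewrite mulr_gt0 ?divr_gt0// addr_gt0.
have p30 : 0 < 3 `^ p by rewrite powR_gt0.
exists K; first by rewrite mulr_gt0 ?powR_gt0// addr_gt0.
move=> f f0 w w0 fw l l0.
pose k := l / 3; have k0 : 0 < k by rewrite divr_gt0.
have lk : l = 3 * k by rewrite mulrC divfK.
pose z := (w / k `^ p) `^ a.
have z0 : 0 < z by rewrite powR_gt0// divr_gt0// powR_gt0.
have -> : K * (w / l `^ p) `^ a = (D + b / v * (C + D)) * z.
  have wl : 0 <= w / l `^ p by rewrite divr_ge0 ?powR_ge0// ltW.
  rewrite /K -mulrA; congr (_ * _); rewrite -powRM ?powR_ge0//; congr (_ `^ a).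
  rewrite lk powRM ?(ltW k0)//; field.
  by rewrite !gt_eqF ?powR_gt0.
have [m mP] := DP f f0 w w0 fw.
have cf : continuous f by exact: lipschitz_cont f0.1.
have [small|large] := ltP ((C + D) * z) v; last first.
  apply: (@le_trans _ _ b%:E); first by rewrite -Bb; apply: le_lebesgue_outer => y [].
  rewrite lee_fin mulrDl; apply: ler_wpDl; first by rewrite mulr_ge0// ltW.
  have -> : b / v * (C + D) * z = b * ((C + D) * z / v) by ring.
  by rewrite ler_peMr ?(ltW b0)// ler_pdivlMr// mul1r.
(* Otherwise [V] would lie in the union of two sets of total measure less than [v]. *)
have [y [Vy [y1 y2]]] : exists y, V y /\ `|f y| <= k /\ `|f y - m| <= k.
  apply: contrapT => noy.
  have Vsub : V `<=` (U `&` [set y | (k < `|f y|)%R]) `|` (B x r `&` [set y | (k < `|f y - m|)%R]).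
    move=> y Vy; have [fk|fk] := leP `|f y| k; last by left; split => //; exact: Vy.1.
    right; split; first exact: VB.
    by rewrite /= ltNge; apply/negP => fm; apply: noy; exists y.
  have : (v%:E <= ((C + D) * z)%:E)%E.
    rewrite -Vv; apply: (le_trans (le_lebesgue_outer Vsub)).
    apply: (le_trans (outer_measureU2 _ _ _)); rewrite mulrDl EFinD.
    by apply: leeD; [exact: CP|exact: mP].
  by rewrite lee_fin leNgt small.
apply: (@le_trans _ _ (D * z)%:E); last first.
  by rewrite lee_fin ler_wpM2r ?(ltW z0)// lerDl ltW.
apply: le_trans (mP k k0); apply: le_lebesgue_outer => u [Bu /= lu]; split => //=.
have : `|f u| <= `|f u - m| + (`|f y| + `|f y - m|).
  rewrite -{1}(subrK m (f u)); apply: (le_trans (ler_normD _ _)); rewrite lerD2l.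
  by rewrite -{1}(subKr (f y) m); exact: ler_normB.
lra.
Qed.

Lemma closure_bounded (A : set 'rV[R]_n.+1) : bounded_set A -> bounded_set (closure A).
Proof.
move=> [M [Mr bA]]; exists (M + 2); split; first exact: num_real.
move=> K MK y cy.
have [z [Az]] : A `&` ball y 1 !=set0 by apply: cy; exact: nbhsx_ballx.
rewrite -ball_normE /= => yz.
have zM : `|z| <= M + 1 by apply: bA => //; rewrite ltrDl.
rewrite -(subrK z y); apply: le_trans (ler_normD _ _) _; lra.
Qed.

(** If [Omega] were equal to [closure Theta], it would be open, closed and bounded; but a nonempty
    open and closed set contains the whole line through [x] in the direction (1, ..., 1). *)
Lemma exists_outside x : Omega x -> exists y, Omega y /\ ~ closure Theta y.
Proof.
move=> Ox; apply: contrapT => noy.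
have OT : Omega = closure Theta.
  apply/seteqP; split; last exact: Theta_inside.2.
  by move=> y Oy; apply: contrapT => ny; apply: noy; exists y.
pose e : 'rV[R]_n.+1 := const_mx 1.
pose line (t : R) : 'rV[R]_n.+1 := x + t *: e.
have cl : continuous line.
  move=> t; apply: cvgD; first exact: cvg_cst.
  by apply: cvgZr_tmp; exact: cvg_id.
have lineT : line @^-1` Omega = setT.
  have : connected [set: R] by apply/connected_intervalP => ? ? ? ? ? ?.
  apply.
  - by exists 0; rewrite /= /line scale0r addr0.
  - exists (line @^-1` Omega); last by rewrite setTI.
    by move/continuousP : cl; exact.
  - exists (line @^-1` Omega); last by rewrite setTI.
    apply: preimage_closed; first by move=> t _; exact: cl.
    by rewrite OT; exact: closed_closure.
have [M [Mr bM]] := closure_bounded Theta_inside.1.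
pose t := `|M| + 1 + `|x|.
have Ot : Omega (line t) by have : [set: R] t by []; rewrite -lineT.
have lt : `|line t| <= `|M| + 2^-1.
  apply: bM; first by have := ler_norm M; lra.
  by rewrite -OT.
have te : t <= `|t *: e|.
  apply: le_trans (rV_coord_le _ ord0); rewrite !mxE mulr1; exact: ler_norm.
have tx : `|t *: e| <= `|line t| + `|x|.
  by have := ler_normB (line t) x; rewrite /line addrAC subrr add0r.
by move: te tx lt; rewrite {1}/t; lra.
Qed.

Lemma level_bound_balls x r : Omega x -> admissible x r ->
  level_bound Theta p Q a (B x r).
Proof.
move=> Ox adm.
(* [good] is open by construction and contains a point outside [closure Theta]. It is relatively
   closed because an admissible ball about a limit point meets an open set that already has a level
   bound. *)
pose good := [set x | exists U, [/\ open U, U x & level_bound Theta p Q a U]].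
have goodO : Omega `&` good = Omega.
  apply: Omega_connected.
  - have [y [Oy ny]] := exists_outside Ox.
    exists y; split => //; exists (~` closure Theta); split => //.
      by apply: closed_openC; exact: closed_closure.
    exists 1 => // f f0 w w0 _ l l0.
    rewrite [X in leb X](_ : _ = set0) ?measure0 ?lee_fin ?mul1r ?powR_ge0//.
    apply/seteqP; split => // u [nu /=]; rewrite (Lip0_eq0 f0) ?normr0 ?ltNge ?(ltW l0)//.
    by move=> Tu; apply: nu; exact: subset_closure.
  - exists good => //; rewrite openE => y [U [oU Uy lU]].
    rewrite /interior; apply: filterS (open_nbhs_nbhs (conj oU Uy)) => u Uu.
    by exists U.
  - exists (closure good); first exact: closed_closure.
    apply/seteqP; split => y [Oy gy]; split => //; first exact: subset_closure.
    have [e adm_y] := admissible_exists Oy.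
    have nB : nbhs y (B y e)°.
      by apply: nbhs_interior; apply: qball_nbhs => //; have [] := adm_y.
    have [u [[U [oU Uu lU]] Bu]] := gy _ nB.
    exists (B y e)°; split; [exact: open_interior| |].
      exact: nbhs_singleton nB.
    apply: level_bound_sub (@interior_subset _ _) _.
    by apply: (level_bound_ball Oy adm_y oU lU); exists u.
have [U [oU Ux lU]] : good x by have := Ox; rewrite -goodO => -[].
apply: (level_bound_ball Ox adm oU lU); exists x; split => //.
by apply: qball_nbhs => //; have [] := adm.
Qed.

End poincare.

(** * Weak-type Sobolev inequality *)

Section disjoint_small.
Context d (T : measurableType d) (R : realType) (mu : {measure set T -> \bar R}).

(** If every set carried more than [e], then more than [W / e] of the disjoint sets would exceed the
    finite total [W]. *)
Lemma trivIset_small_integral (K : set T) (E : (set T)^nat) (h : T -> \bar R) (e : R) :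
  measurable K -> (forall k, measurable (E k)) -> (forall k, E k `<=` K) ->
  trivIset setT E -> measurable_fun K h -> (forall x, K x -> 0 <= h x)%E ->
  (\int[mu]_(x in K) h x < +oo)%E -> 0 < e ->
  exists k, (\int[mu]_(x in E k) h x <= e%:E)%E.
Proof.
move=> mK mE EK tE mh h0 hfin e0; apply: contrapT => /forallNP noE.
have U_K : \bigcup_k E k `<=` K by move=> x [k _]; exact: EK.
have mU : measurable (\bigcup_k E k) by exact: bigcup_measurable.
have sumE : (\sum_(k <oo) \int[mu]_(x in E k) h x <= \int[mu]_(x in K) h x)%E.
  rewrite -ge0_integral_bigcup//.
  - exact: ge0_subset_integral.
  - exact: measurable_funS mh.
  - by move=> x /U_K; exact: h0.
have : (0 <= \int[mu]_(x in K) h x)%E by exact: integral_ge0.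
move: sumE hfin; case: (\int[mu]_(x in K) h x)%E => [W sumE _ _|//|//].
pose m := (Num.truncn (W / e)).+1.
have : ((e *+ m)%:E <= W%:E)%E.
  apply: le_trans sumE; apply: le_trans (nneseries_lim_ge (P := xpredT) m _); last first.
    by move=> k _ _; apply: integral_ge0 => x /EK; exact: h0.
  rewrite -[X in (e *+ X)%R](card_ord m) -sumr_const -sumEFin big_mkord.
  by apply: lee_sum => k _; rewrite ltW// ltNge; apply/negP/noE.
rewrite lee_fin -mulr_natl -ler_pdivlMr// leNgt => /negP; apply.
exact: truncnS_gt.
Qed.

End disjoint_small.

(** * Truncation by a multiple of a cutoff function *)

Section truncation.
Context {R : realType} {n : nat}.
Implicit Types (f eta : 'rV[R]_n.+1 -> R) (x y : 'rV[R]_n.+1) (k c L : R).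

Lemma near_gt f x k : {for x, continuous f} -> k < f x -> \forall y \near x, k < f y.
Proof. by move=> cf kf; exact: (@cvgr_gt _ _ (nbhs x) _ f (f x) cf k kf). Qed.

Definition truncate f eta k c x : R := Num.min (Num.max (f x - k) 0) (c * eta x).

Lemma truncate_lip f eta k c L L' : 0 <= c ->
  (forall x y, `|f x - f y| <= L * `|x - y|) ->
  (forall x y, `|eta x - eta y| <= L' * `|x - y|) ->
  forall x y, `|truncate f eta k c x - truncate f eta k c y| <= (L + c * L') * `|x - y|.
Proof.
move=> c0 fL eL x y.
have h2 : `|c * eta x - c * eta y| <= c * L' * `|x - y|.
  by rewrite -mulrBr normrM (ger0_norm c0) -mulrA ler_wpM2l.
apply: (@le_trans _ _ (`|f x - f y| + `|c * eta x - c * eta y|)); last first.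
  by rewrite mulrDl lerD.
rewrite /truncate; move: (f x) (f y) (c * eta x) (c * eta y); clear => s t u v.
have half s' t' u' v' : Num.min (Num.max (s' - k) 0) u' - Num.min (Num.max (t' - k) 0) v' <=
    `|s' - t'| + `|u' - v'|.
  have st := ler_norm (s' - t'); have uv := ler_norm (u' - v').
  have st0 := normr_ge0 (s' - t'); have uv0 := normr_ge0 (u' - v').
  have [_|_] := leP (Num.max (t' - k) 0) v'; last first.
    by have : Num.min (Num.max (s' - k) 0) u' <= u' by [rewrite ge_min lexx orbT]; lra.
  have h : Num.min (Num.max (s' - k) 0) u' <= Num.max (s' - k) 0 by rewrite ge_min lexx.
  have [t1 t2] : t' - k <= Num.max (t' - k) 0 /\ 0 <= Num.max (t' - k) 0.
    by rewrite !le_max !lexx orbT.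
  by move: h; have [_|_] := leP (s' - k) 0 => h; lra.
by rewrite ler_norml half lerNl opprB distrC [ `|u - v|]distrC half.
Qed.

(** A positive value is attained by one strictly smaller branch near x, unless both branches agree;
    a zero value is a minimum. Nothing is asserted about the gradient on the coincidence set. The
    condition [k < f x] in the third case confines the cutoff gradient to a level set of [f]. *)
Lemma truncate_grad f eta k c x : continuous f -> lipschitz eta ->
  (forall x, 0 <= eta x) -> 0 <= c ->
  [\/ grad (truncate f eta k c) x = 0,
      grad (truncate f eta k c) x = grad f x,
      grad (truncate f eta k c) x = c *: grad eta x /\ k < f x |
      0 < eta x /\ f x - k = c * eta x].
Proof.
move=> cf leta e0 c0; set F := truncate f eta k c.
have ce : continuous eta by exact: lipschitz_cont.
have F0 y : 0 <= F y by rewrite le_min le_max lexx orbT mulr_ge0.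
have [Fx|Fx] := eqVneq (F x) 0; first by apply: Or41; exact: grad_min0.
have : 0 < F x by rewrite lt_def Fx F0.
rewrite lt_min lt_max ltxx orbF subr_gt0 => /andP[kf ex].
have etax : 0 < eta x.
  by rewrite lt_def e0 andbT; apply/eqP => e; move: ex; rewrite e mulr0 ltxx.
have nk : \forall y \near x, k < f y by apply: near_gt => //; exact: cf.
have cce : {for x, continuous (fun y => c * eta y)}.
  by apply: (@continuousM _ _ (fun=> c) eta); [exact: cst_continuous|exact: ce].
have cfk : {for x, continuous (fun y => f y - k)}.
  by apply: (@continuousB _ _ _ f (fun=> k)); [exact: cf|exact: cst_continuous].
have cd : {for x, continuous (fun y => c * eta y - (f y - k))}.
  exact: (@continuousB _ _ _ (fun y => c * eta y) (fun y => f y - k)).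
have cd' : {for x, continuous (fun y => f y - k - c * eta y)}.
  exact: (@continuousB _ _ _ (fun y => f y - k) (fun y => c * eta y)).
have [fe|fe|fe] := ltgtP (f x - k) (c * eta x); last by apply: Or44.
- apply: Or42; apply: (@grad_near _ _ F f x (- k)); near=> y.
  rewrite /F /truncate max_l; last by rewrite subr_ge0 ltW//; near: y.
  rewrite min_l//; rewrite -subr_ge0 ltW//; near: y.
  by apply: (near_gt cd); rewrite subr_gt0.
- apply: Or43; split => //.
  rewrite (@grad_near _ _ F (fun y => c * eta y) x 0).
    rewrite (@grad_comp _ _ eta ( *%R c) (fun=> c) 0)// => s t.
    by rewrite mul0r (_ : _ - _ - _ = 0) ?normr0//; ring.
  near=> y; rewrite addr0 /F /truncate max_l; last by rewrite subr_ge0 ltW//; near: y.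
  rewrite min_r//; rewrite -subr_ge0 ltW//; near: y.
  by apply: (near_gt cd'); rewrite subr_gt0.
Unshelve. all: by end_near. Qed.

End truncation.

Lemma hoelder_conjugate_gt1 (R : realType) (t : \bar R) : (1 < t)%E ->
  exists a : R, [/\ hoelder_conjugate t = a%:E, 1 <= a &
    (t = +oo%E /\ a = 1) \/ (exists2 t0 : R, 1 < t0 & t = t0%:E /\ a^-1 = 1 - t0^-1)].
Proof.
case: t => [t0| _ |//]; last by exists 1; split; [rewrite hoelder_conjugatey| |left].
rewrite lte_fin => t1; have t0p : 0 < t0 by exact: lt_trans t1.
have t10 : 0 < t0 - 1 by rewrite subr_gt0.
exists (t0 / (t0 - 1)); split; last first.
- by right; exists t0 => //; split => //; field; rewrite !gt_eqF.
- by rewrite ler_pdivlMr// mul1r gerBl.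
rewrite /hoelder_conjugate/= eqe gt_eqF//.
by rewrite -EFinB inver gt_eqF.
Qed.

Section cutoff_energy.
Context {R : realType} {n : nat}.
Implicit Types (A B : set 'rV[R]_n.+1) (h : 'rV[R]_n.+1 -> R).

(** Hoelder's inequality on [A] with exponents [t] and [a = t'], up to a constant: the bound on the
    mean of order [p t] over [B] leaves [|A|] to the power [1 / a]. For [t = +oo] the essential
    supremum gives the same with [a = 1]. *)
Lemma cutoff_energy B b h (p a : R) (t : \bar R) (M : R) : lmeasurable B ->
  leb B = b%:E -> 0 < b -> leb_measurable_fun B h -> (forall x, 0 <= h x) ->
  0 < p -> 0 < M ->
  (t = +oo%E /\ a = 1) \/ (exists2 t0 : R, 1 < t0 & t = t0%:E /\ a^-1 = 1 - t0^-1) ->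
  (mean_norm B (p%:E * t) h <= M%:E)%E ->
  exists2 C, 0 < C & forall A, lmeasurable A -> A `<=` B -> forall V, 0 < V ->
  (leb A <= V%:E)%E -> (\int[leb]_(x in A) (h x `^ p)%:E <= (C * V `^ a^-1)%:E)%E.
Proof.
move=> mB Bb b0 mh h0 p0 M0 [[-> ->]|[t0 t1 [-> ->]]].
  rewrite mulry gtr0_sg// mul1e /mean_norm /esssup_on => /ess_supP hM.
  exists (M `^ p); first exact: powR_gt0.
  move=> A mA AB V V0 AV; rewrite invr1 powRr1 ?(ltW V0)//.
  apply: (@le_trans _ _ (\int[leb]_(x in A) (cst (M `^ p)%:E x))%E); last first.
    by rewrite integral_cst// EFinM lee_wpmul2l// lee_fin powR_ge0.
  apply: ae_ge0_le_integral => //.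
  - by move=> x _; rewrite lee_fin powR_ge0.
  - apply: leb_measurable_EFin; apply: leb_measurable_powR.
    exact: leb_measurableS mh.
  - by move=> x _; rewrite lee_fin powR_ge0.
  - apply: filterS hM => x hx Ax; rewrite lee_fin.
    move: hx; rewrite patchE mem_set/=; last exact: AB.
    rewrite lee_fin ger0_norm ?h0// => hx.
    by rewrite ge0_ler_powR ?nnegrE ?(ltW p0) ?(ltW M0).
have t00 : 0 < t0 by exact: lt_trans t1.
rewrite -EFinM => hM.
pose s := p * t0; have s0 : 0 < s by exact: mulr_gt0.
have hI : (\int[leb]_(x in B) (h x `^ s)%:E <= (b * M `^ s)%:E)%E.
  apply: le_trans (mean_norm_integral_le Bb b0 s0 (ltW M0) hM).
  by apply: le_integral_nonneg => x _; rewrite ?lee_fin ?powR_ge0// ger0_norm.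
have I0 : 0 < b * M `^ s by rewrite mulr_gt0// powR_gt0.
exists (2 * (b * M `^ s) `^ (p / s)); first by rewrite mulr_gt0// powR_gt0.
move=> A mA AB V V0 AV.
have ps : p / s = t0^-1 by rewrite /s; field; rewrite !gt_eqF.
rewrite -ps -mulrA; apply: (integral_powR_le mB mA AB mh) => //.
by rewrite /s ler_peMr ?ltW.
Qed.

End cutoff_energy.

Section sobolev.
Context {R : realType} {n : nat}.
Variables (Omega : set 'rV[R]_n.+1) (p sigma : R) (Q : 'rV[R]_n.+1 -> 'M[R]_n.+1).
Hypotheses (Omega_open : open Omega) (p_gt0 : 0 < p) (sigma_gt0 : 0 < sigma)
  (Q_psd : forall x, Omega x -> psd (Q x)) (Q_loc : Lloc_matrix Omega (p / 2) Q).

(** The radius and the measure of the fixed ball go into the constant; energy and zeroth-order term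
    enter through a common bound [w]. *)
Lemma sobolev_integral (B : set 'rV[R]_n.+1) (b c0 c1 : R) : leb B = b%:E -> 0 < b ->
  0 < c0 -> 0 < c1 ->
  (forall f, Lip0 B f -> (mean_norm B (p * sigma)%:E f <=
     c1%:E * mean_norm B p%:E (Q_abs Q (grad f)) + c0%:E * mean_norm B p%:E f)%E) ->
  exists2 C, 0 < C & forall f, Lip0 B f -> forall w, 0 < w ->
    (\int[leb]_(x in B) (Q_abs Q (grad f) x `^ p)%:E <= w%:E)%E ->
    (\int[leb]_(x in B) (`|f x| `^ p)%:E <= w%:E)%E ->
    (\int[leb]_(x in B) (`|f x| `^ (p * sigma))%:E <= (C * w `^ sigma)%:E)%E.
Proof.
move=> Bb b0 c00 c10 sob.
have c010 : 0 < c1 + c0 by exact: addr_gt0.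
exists (b * ((c1 + c0) `^ (p * sigma) / b `^ sigma)).
  by rewrite mulr_gt0// divr_gt0 ?powR_gt0.
move=> f f0 w w0 gw fw.
have gw' : (\int[leb]_(x in B) (`|Q_abs Q (grad f) x| `^ p)%:E <= w%:E)%E.
  apply: le_trans gw; apply: le_integral_nonneg => x _; first by rewrite lee_fin powR_ge0.
  by rewrite [ `|_|]ger0_norm ?enorm_ge0.
have H1 := mean_norm_le Bb b0 p_gt0 (ltW w0) gw'.
have H2 := mean_norm_le Bb b0 p_gt0 (ltW w0) fw.
have wb : 0 <= (w / b) `^ p^-1 by exact: powR_ge0.
have -> : b * ((c1 + c0) `^ (p * sigma) / b `^ sigma) * w `^ sigma =
    b * (((c1 + c0) * (w / b) `^ p^-1) `^ (p * sigma)).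
  rewrite powRM// ?(ltW c010)// -powRrM [p^-1 * _]mulrA mulVf ?gt_eqF// mul1r.
  by rewrite powR_div ?(ltW w0) ?(ltW b0)//; ring.
apply: mean_norm_integral_le => //; [exact: mulr_gt0|by rewrite mulr_ge0// ltW|].
apply: (le_trans (sob f f0)); rewrite mulrDl EFinD !EFinM.
have [c10' c00'] : (0 <= c1%:E)%E /\ (0 <= c0%:E)%E by rewrite !lee_fin !ltW.
exact: leeD (lee_wpmul2l c10' H1) (lee_wpmul2l c00' H2).
Qed.

End sobolev.

Lemma integral_le3 d (T : measurableType d) (R : realType)
    (mu : {measure set T -> \bar R}) (D : set T) (f f1 f2 f3 : T -> \bar R)
    (a1 a2 a3 : R) : measurable D ->
  measurable_fun D f1 -> measurable_fun D f2 -> measurable_fun D f3 ->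
  (forall x, 0 <= f x)%E -> (forall x, 0 <= f1 x)%E -> (forall x, 0 <= f2 x)%E ->
  (forall x, 0 <= f3 x)%E ->
  (forall x, D x -> f x <= f1 x + f2 x + f3 x)%E ->
  (\int[mu]_(x in D) f1 x <= a1%:E)%E -> (\int[mu]_(x in D) f2 x <= a2%:E)%E ->
  (\int[mu]_(x in D) f3 x <= a3%:E)%E ->
  (\int[mu]_(x in D) f x <= (a1 + a2 + a3)%:E)%E.
Proof.
move=> mD mf1 mf2 mf3 f0 f10 f20 f30 ff h1 h2 h3.
apply: (@le_trans _ _ (\int[mu]_(x in D) (f1 x + f2 x + f3 x))%E).
  exact: le_integral_nonneg.
rewrite ge0_integralD//; [|by move=> x _; exact: adde_ge0|exact: emeasurable_funD].
rewrite ge0_integralD// !EFinD.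
by apply: leeD => //; exact: leeD.
Qed.

Lemma leb_measurable_restrict (R : realType) (n : nat) (D E : set 'rV[R]_n.+1)
    (h : 'rV[R]_n.+1 -> R) :
  lmeasurable D -> lmeasurable E -> leb_measurable_fun (E `&` D) h ->
  @measurable_fun _ _ (caratheodory_type (@lebesgue_outer R n)) (\bar R) E ((EFin \o h) \_ D).
Proof.
move=> mD mE mh; apply: (proj1 (measurable_restrict _ mD mE)).
exact: leb_measurable_EFin.
Qed.

(** * The weak-type bound where a cutoff function equals 1 *)

Section truncate_level.
Context {R : realType} {n : nat}.
Variables (Omega Theta : set 'rV[R]_n.+1) (p a sigma : R) (Q : 'rV[R]_n.+1 -> 'M[R]_n.+1).
Hypotheses (Omega_open : open Omega) (Theta_open : open Theta) (ThetaO : Theta `<=` Omega)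
  (p_gt0 : 0 < p) (a_ge1 : 1 <= a) (sigma_gt0 : 0 < sigma)
  (Q_psd : forall x, Omega x -> psd (Q x)) (Q_loc : Lloc_matrix Omega (p / 2) Q).
Variables (B : set 'rV[R]_n.+1) (b : R) (eta : 'rV[R]_n.+1 -> R) (Ce Cs D : R).
Hypotheses (B_measurable : lmeasurable B) (BO : B `<=` Omega) (Bb : leb B = b%:E)
  (b_gt0 : 0 < b) (eta_lip0 : Lip0 B eta) (eta01 : forall x, 0 <= eta x <= 1)
  (Ce_gt0 : 0 < Ce) (Cs_gt0 : 0 < Cs) (D_gt0 : 0 < D).
Hypothesis eta_energy : forall A, lmeasurable A -> A `<=` B -> forall V, 0 < V ->
  (leb A <= V%:E)%E ->
  (\int[leb]_(x in A) (Q_abs Q (grad eta) x `^ p)%:E <= (Ce * V `^ a^-1)%:E)%E.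
Hypothesis sobolev : forall f, Lip0 B f -> forall w, 0 < w ->
  (\int[leb]_(x in B) (Q_abs Q (grad f) x `^ p)%:E <= w%:E)%E ->
  (\int[leb]_(x in B) (`|f x| `^ p)%:E <= w%:E)%E ->
  (\int[leb]_(x in B) (`|f x| `^ (p * sigma))%:E <= (Cs * w `^ sigma)%:E)%E.
Hypothesis level_B : forall f, Lip0 Theta f -> forall w, 0 < w ->
  (energy Theta p Q f <= w%:E)%E -> forall l, 0 < l ->
  (leb (B `&` [set x | (l < `|f x|)%R]) <= (D * (w / l `^ p) `^ a)%:E)%E.

Let E f k c : set 'rV[R]_n.+1 := [set y | 0 < eta y /\ f y - k = c * eta y].

Let E_measurable f k c : continuous f -> lmeasurable (E f k c).
Proof.
move=> cf; have ce : continuous eta by apply: lipschitz_cont; exact: eta_lip0.1.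
rewrite (_ : E f k c = [set y | 0 < eta y] `&` [set y | f y - k - c * eta y = 0]).
  apply: measurableI.
    apply: open_lmeasurable; apply: (@open_comp _ _ eta [set t | 0 < t]).
      by move=> x _; exact: ce.
    exact: open_gt.
  apply: closed_lmeasurable.
  apply: (@preimage_closed _ _ (fun y => f y - k - c * eta y) [set 0]); last exact: closed_eq.
  move=> x _; apply: (@continuousB _ _ _ (fun y => f y - k) (fun y => c * eta y)).
    by apply: (@continuousB _ _ _ f (fun=> k)); [exact: cf|exact: cst_continuous].
  by apply: (@continuousM _ _ (fun=> c) eta); [exact: cst_continuous|exact: ce].
apply/seteqP; split => y /= [e0 fe]; split => //; first by rewrite fe subrr.
by apply/eqP; rewrite -subr_eq0 fe.
Qed.

Let ia : R := a^-1.
Let ia01 : 0 < ia <= 1.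
Proof. by rewrite invr_gt0 invf_le1 ?(lt_le_trans _ a_ge1)//= a_ge1. Qed.

(* The constant c ranges over infinitely many values for which the sets
   {f - k = c eta} are disjoint, so one of them carries little energy; elsewhere
   the gradient of the truncation is that of one of its branches, or 0. *)
Lemma truncate_level : exists2 C, 0 < C & forall f, Lip0 Theta f ->
  forall w, 0 < w -> (energy Theta p Q f <= w%:E)%E -> forall l, 0 < l ->
  (leb (B `&` [set y | eta y = 1%R] `&` [set y | (l < f y)%R])
     <= (C * (w / l `^ p) `^ sigma)%:E)%E.
Proof.
(* Shares of [w]: the 2 pays for the energy of [f] and for the coincidence set, [Ce * D^(1/a)] for
   the cutoff energy, and [b^(1 - 1/a) * D^(1/a)] for the zeroth-order term. *)
pose K : R := 2 + (Ce + b `^ (1 - ia)) * D `^ ia.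
have K0 : 0 < K.
  by rewrite ltr_wpDr// mulr_ge0 ?powR_ge0// addr_ge0 ?powR_ge0// ltW.
exists (Cs * (K * 8 `^ p) `^ sigma).
  by rewrite mulr_gt0// powR_gt0// mulr_gt0// powR_gt0.
move=> f f0 w w0 fw l l0.
have lf := f0.1; have cf := lipschitz_cont lf.
have /lipschitzP[L L0 fL] := lf.
have /lipschitzP[L' L'0 eL] := eta_lip0.1.
pose k := l / 2; have k0 : 0 < k by rewrite divr_gt0.
(* [G] is a Lipschitz constant of the truncation for every [c <= k], so [wG] dominates all the
   energy densities before [c] is chosen. *)
pose G := L + k * L'; have G0 : 0 <= G by rewrite addr_ge0// mulr_ge0// ltW.
pose wG y : R := (entry_sum (Q y) * G ^+ 2) `^ (p / 2).
have [cK KB] := Lip0_compact_supp eta_lip0.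
have KO := subset_trans KB BO.
have mK : lmeasurable (fsupp eta) by apply: closed_lmeasurable; exact: closed_closure.
(* Infinitely many distinct heights in (l/4, l/2]. The upper bound [k] is needed for absorption, the
   lower bound keeps the truncation above [l / 8] where [eta = 1] and [f > l]. *)
pose cj j : R := l / 4 * (1 + j.+1%:R^-1).
have l4 : 0 < l / 4 by rewrite divr_gt0.
have cj_bd j : l / 4 < cj j <= k.
  rewrite /cj /k; apply/andP; split.
    by rewrite ltr_pMr// ltrDl invr_gt0.
  have -> : l / 2 = l / 4 * (1 + 1) by field.
  by rewrite ler_pM2l// lerD2l invf_le1// ler1n.
have [j Ej] : exists j, (\int[leb]_(y in E f k (cj j)) (wG y)%:E <= w%:E)%E.
  apply: (@trivIset_small_integral _ (caratheodory_type (@lebesgue_outer R n)) R leb (fsupp eta)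
     (fun j => E f k (cj j)) (fun y => (wG y)%:E) w mK _ _ _ _ _ _ w0).
  - by move=> j; exact: E_measurable.
  - by move=> j y [e0 _]; apply: subset_closure; rewrite /= gt_eqF.
  - apply/trivIsetP => i j _ _ ij; apply/seteqP; split => // y [[e0 fi] [_ fj]].
    have : cj i * eta y = cj j * eta y by rewrite -fi -fj.
    move=> /(mulIf (lt0r_neq0 e0))/(mulfI (lt0r_neq0 l4))/addrI/invr_inj/eqP.
    by rewrite eqr_nat eqSS => /eqP; exact/eqP.
  - by apply: leb_measurable_EFin; apply: (entry_sum_measurable Omega_open Q_loc).
  - by move=> y _; rewrite lee_fin powR_ge0.
  - by apply: (entry_sum_integral_fin Omega_open p_gt0 Q_loc) => //; exact: sqr_ge0.
have /andP[c1 c2] := cj_bd j; set c := cj j in Ej c1 c2.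
have c0 : 0 < c by exact: lt_trans c1.
pose F := truncate f eta k c.
have FG : forall x y, `|F x - F y| <= G * `|x - y|.
  move=> x y; apply: le_trans (truncate_lip k (ltW c0) fL eL x y) _.
  by rewrite ler_wpM2r// lerD2l ler_wpM2r.
have lF : lipschitz F by apply/lipschitzP; exists G.
have F0 : Lip0 B F.
  apply: (Lip0_sub eta_lip0) => // y ey.
  by rewrite /F /truncate ey mulr0 min_r// le_max lexx orbT.
pose A := B `&` [set y | k < f y].
have mA : lmeasurable A.
  by apply: leb_measurable_level => //; exact: continuous_leb_measurable.
have AB : A `<=` B by move=> y [].
pose V := D * (w / k `^ p) `^ a.
have V0 : 0 < V by rewrite mulr_gt0// powR_gt0// divr_gt0// powR_gt0.
have AV : (leb A <= V%:E)%E.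
  apply: le_trans (level_B f0 w0 fw k0); apply: le_lebesgue_outer => y [By /= ky].
  by split => //=; rewrite (lt_le_trans ky)// ler_norm.
have /andP[ia0 ia1] := ia01.
(* The level bound has the exponent [a] and Hoelder's inequality takes the power [1 / a] of it, so
   [k] disappears. *)
have Vk : k `^ p * V `^ ia = D `^ ia * w.
  rewrite /V powRM ?powR_ge0 ?(ltW D_gt0)// -powRrM divff; last first.
    by rewrite gt_eqF// (lt_le_trans _ a_ge1).
  rewrite powRr1 ?divr_ge0 ?powR_ge0 ?(ltW w0)//.
  by field; rewrite gt_eqF// powR_gt0.
have ck : c `^ p <= k `^ p by rewrite ge0_ler_powR ?nnegrE ?(ltW p_gt0) ?(ltW c0) ?(ltW k0).
have Kw : 0 < K * w by exact: mulr_gt0.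
have Di : 0 <= D `^ ia * w by rewrite mulr_ge0 ?powR_ge0// ltW.
have K_split : K * w = w + (Ce + b `^ (1 - ia)) * (D `^ ia * w) + w by rewrite /K; ring.
have cV : c `^ p * V `^ ia <= D `^ ia * w by rewrite -Vk ler_wpM2r ?powR_ge0.
have b1 : 0 <= b `^ (1 - ia) by exact: powR_ge0.
pose P1 : set 'rV[R]_n.+1 := [set y | k < f y].
have mQ g : lipschitz g -> leb_measurable_fun B (fun y => Q_abs Q (grad g) y `^ p).
  move=> lg; apply: leb_measurable_powR.
  exact: (Q_abs_grad_measurable Omega_open Q_psd Q_loc B_measurable BO lg).
have mP1 : lmeasurable P1.
  rewrite -[P1]setTI; apply: leb_measurable_level; first exact: measurableT.
  exact: continuous_leb_measurable.
have mwG : leb_measurable_fun B wG by exact: (entry_sum_measurable Omega_open Q_loc).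
have int1 : (\int[leb]_(x in B) (Q_abs Q (grad F) x `^ p)%:E <= (K * w)%:E)%E.
  pose f1 y := (Q_abs Q (grad f) y `^ p)%:E.
  pose f2 y := ((c `^ p)%:E * ((fun y => (Q_abs Q (grad eta) y `^ p)%:E) \_ P1) y)%E.
  pose f3 := (fun y => (wG y)%:E) \_ (E f k c).
  have f1_0 y : (0 <= f1 y)%E by rewrite lee_fin powR_ge0.
  have f2_0 y : (0 <= f2 y)%E.
    rewrite mule_ge0 ?lee_fin ?powR_ge0//; apply: erestrict_ge0 => z _.
    by rewrite lee_fin powR_ge0.
  have f3_0 y : (0 <= f3 y)%E.
    by apply: erestrict_ge0 => z _; rewrite lee_fin powR_ge0.
  have mf1 : @measurable_fun _ _ (caratheodory_type (@lebesgue_outer R n)) _ B f1.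
    by apply: leb_measurable_EFin; exact: mQ.
  have mf2' : @measurable_fun _ _ (caratheodory_type (@lebesgue_outer R n)) _ B
      ((fun y => (Q_abs Q (grad eta) y `^ p)%:E) \_ P1).
    apply: (leb_measurable_restrict mP1 B_measurable).
    by apply: leb_measurableS B_measurable _ (mQ _ eta_lip0.1) => y [].
  have mf2 : @measurable_fun _ _ (caratheodory_type (@lebesgue_outer R n)) _ B f2.
    by apply: emeasurable_funM => //; exact: mf2'.
  have mf3 : @measurable_fun _ _ (caratheodory_type (@lebesgue_outer R n)) _ B f3.
    apply: (leb_measurable_restrict (E_measurable k c cf) B_measurable).
    by apply: leb_measurableS B_measurable _ mwG => y [].
  rewrite K_split; apply: (integral_le3 B_measurable mf1 mf2 mf3 _ f1_0 f2_0 f3_0).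
  - by move=> y; rewrite lee_fin powR_ge0.
  - move=> y By; have Oy := BO By.
    have [Fy|Fy|[Fy kf]|Ey] := truncate_grad k y cf eta_lip0.1 (fun x => proj1 (andP (eta01 x))) (ltW c0).
    + by rewrite Q_abs_grad0// powR0 ?gt_eqF// !adde_ge0.
    + by rewrite /Q_abs Fy; apply: (@le_trans _ _ (f1 y)) => //; rewrite -addeA leeDl// adde_ge0.
    + apply: (@le_trans _ _ (f2 y)); last by rewrite addeAC leeDr// adde_ge0.
      rewrite /f2 patchE mem_set// /Q_abs Fy mulvZr enormZ (ger0_norm (ltW c0)).
      by rewrite powRM ?enorm_ge0 ?(ltW c0)// EFinM.
    + apply: (@le_trans _ _ (f3 y)); last by rewrite leeDr// adde_ge0.
      rewrite /f3 patchE mem_set// lee_fin; apply: (Q_abs_le p_gt0 Q_psd) => // i.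
      exact: grad_le.
  - apply: le_trans fw.
    exact: (energy_le_supp Q p_gt0 (open_lmeasurable Theta_open) B_measurable f0).
  - rewrite ge0_integralZl_EFin ?powR_ge0//; last first.
      by move=> y _; apply: erestrict_ge0 => z _; rewrite lee_fin powR_ge0.
    rewrite -integral_mkcondr.
    apply: (@le_trans _ _ ((c `^ p)%:E * (Ce * V `^ ia)%:E)%E).
      by apply: lee_wpmul2l; [rewrite lee_fin powR_ge0|exact: eta_energy].
    rewrite -EFinM lee_fin mulrCA; apply: (@le_trans _ _ (Ce * (D `^ ia * w))).
      by rewrite ler_wpM2l ?(ltW Ce_gt0).
    by rewrite ler_wpM2r// lerDl.
  - rewrite -integral_mkcondr setIidr// => y [e0 _].
    by apply: KB; apply: subset_closure; rewrite /= gt_eqF.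
have int2 : (\int[leb]_(x in B) (`|F x| `^ p)%:E <= (K * w)%:E)%E.
  apply: (@le_trans _ _ (\int[leb]_(y in B) ((cst (c `^ p)%:E) \_ P1) y)%E).
    apply: le_integral_nonneg => y By; first by rewrite lee_fin powR_ge0.
    have /andP[e0 e1] := eta01 y.
    have F_0 : 0 <= F y by rewrite le_min le_max lexx orbT mulr_ge0// ltW.
    rewrite patchE; case: ifPn => [_|/negP yP1]; rewrite lee_fin ger0_norm//.
      rewrite ge0_ler_powR ?nnegrE ?(ltW p_gt0) ?(ltW c0)//.
      by apply: (@le_trans _ _ (c * eta y)); rewrite ?ger_pMr// ge_min lexx orbT.
    have kf : f y <= k by rewrite leNgt; apply/negP => kf; apply: yP1; rewrite inE.
    rewrite (_ : F y = 0) ?powR0 ?gt_eqF//; apply/eqP; rewrite eq_le F_0 andbT.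
    by rewrite ge_min ge_max lexx subr_le0 kf.
  rewrite -integral_mkcondr integral_cst//.
  have [v v0 Av] : exists2 v, 0 <= v & leb A = v%:E.
    have : (leb A <= b%:E)%E by rewrite -Bb; exact: le_lebesgue_outer.
    have : (0 <= leb A)%E by exact: measure_ge0.
    by case: (leb A) => [v|//|//]; rewrite lee_fin => v0 _; exists v.
  have vV : v <= V by rewrite -lee_fin -Av.
  have vb : v <= b by rewrite -lee_fin -Av -Bb; exact: le_lebesgue_outer.
  (* Both [V] and [b] bound [v]; interpolating between them produces the same power of [V] as in the
     cutoff energy. *)
  have vv : v <= V `^ ia * b `^ (1 - ia).
    have -> : v = v `^ ia * v `^ (1 - ia).
      by rewrite -powRD ?(addrC ia) ?subrK ?powRr1// oner_eq0.
    by apply: ler_pM; rewrite ?powR_ge0// ge0_ler_powR ?nnegrE ?subr_ge0 ?(ltW ia0) ?(ltW V0) ?(ltW b_gt0).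
  rewrite [X in (_ * X)%E](_ : _ = v%:E) -?EFinM ?lee_fin; last exact: Av.
  apply: (@le_trans _ _ (b `^ (1 - ia) * (D `^ ia * w))).
    apply: (@le_trans _ _ (b `^ (1 - ia) * (c `^ p * V `^ ia))); last by rewrite ler_wpM2l.
    by rewrite mulrCA [b `^ _ * _]mulrC ler_wpM2l ?powR_ge0.
  rewrite K_split mulrDl; have := mulr_ge0 (ltW Ce_gt0) Di; move: (ltW w0); lra.
have int3 := sobolev F0 Kw int1 int2.
(* Where [eta = 1] and [f > l], [F] is the minimum of [f - k > l / 2] and [c > l / 4]. *)
have l8 : 0 < l / 8 by rewrite divr_gt0.
have ps0 : 0 < p * sigma by exact: mulr_gt0.
have mF : leb_measurable_fun B F by apply: continuous_leb_measurable; exact: lipschitz_cont.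
have := lebesgue_le_powR B_measurable mF ps0 l8 int3.
rewrite (_ : Cs * (K * w) `^ sigma / _ = Cs * (K * 8 `^ p) `^ sigma * (w / l `^ p) `^ sigma).
  apply: le_trans; apply: le_lebesgue_outer => y [[By ey] /= lfy]; split => //=.
  rewrite /F /truncate ey mulr1 max_l; last by rewrite subr_ge0 /k; lra.
  apply: lt_le_trans (ler_norm _); rewrite lt_min; apply/andP; split; rewrite /k; lra.
have [[K1 w1] l1] := (ltW K0, ltW w0, ltW l0).
rewrite powRM// [(K * _) `^ _]powRM ?powR_ge0// !powR_div ?powR_ge0//.
rewrite -!powRrM; field.
by rewrite !gt_eqF ?powR_gt0.
Qed.

End truncate_level.

(** About each point of [closure Theta] some ball [B(x, alpha r)] lies where a cutoff function
    equals 1, so [truncate_level] applies on it; compactness reduces these neighbourhoods to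
    finitely many. *)
Lemma weak_sobolev (R : realType) (n : nat)
    (Omega : set 'rV[R]_n.+1) (rho : 'rV[R]_n.+1 -> 'rV[R]_n.+1 -> R)
    (p : R) (t : \bar R) (Q : 'rV[R]_n.+1 -> 'M[R]_n.+1) (sigma : R)
    (r1 : 'rV[R]_n.+1 -> R) (Theta : set 'rV[R]_n.+1) :
  open Omega -> connected Omega ->
  (forall x r, Omega x -> 0 < r -> lmeasurable (qball Omega rho x r)) ->
  euclidean_compatible Omega rho -> 1 < p -> (1 < t)%E ->
  (forall x, Omega x -> psd (Q x)) -> Lloc_matrix Omega (p / 2) Q ->
  0 < sigma -> (forall x, Omega x -> 0 < r1 x) ->
  cutoff_condition Omega rho Q r1 (p%:E * t) ->
  local_poincare Omega rho Q r1 p (hoelder_conjugate t) ->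
  local_sobolev Omega rho Q r1 p sigma ->
  open Theta -> compactly_inside Theta Omega ->
  level_bound Theta p Q sigma Theta.
Proof.
move=> Oo Oc rm rc p1 t1 Qp Ql s0 r10 cut poi sob To Ti.
have p0 : 0 < p by exact: lt_trans p1.
have [a [tE a1 ta]] := hoelder_conjugate_gt1 t1.
have a0 : 0 < a by exact: lt_le_trans a1.
have [C1 [beta [C10 beta1 poi']]] := poi; rewrite tE in poi'.
have [C0 C00 sob'] := sob.
have [C3 [N [alpha [C30 N0 /andP[al0 al1] cut']]]] := cut.
have TO : Theta `<=` Omega by apply: subset_trans Ti.2; exact: subset_closure.
apply: (level_bound_sub (@subset_closure _ Theta)).
apply: (@compact_ind _ (level_bound Theta p Q sigma)).
- apply: bounded_closed_compact; last exact: closed_closure.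
  exact: closure_bounded Ti.1.
- exact: level_bound0.
- by move=> A B; exact: level_bound_sub.
- by move=> A B; exact: level_boundU.
move=> x /Ti.2 Ox.
have [r adm] := admissible_exists rc r10 beta1 Ox.
have [r0 br bb] := adm.
have rr : 0 < r < r1 x by rewrite r0 (le_lt_trans _ br)// ler_peMl// ltW.
have [b b0 Bb] := admissible_ball Oo rc beta1 Ox adm.
have [D D0 DP] := level_bound_balls Oo Oc rm rc p0 a0 Qp Ql r10 C10 beta1 poi' To Ti Ox adm.
have [psi [_ /(_ 1%N isT)[eta0 eta01 eta1 _ eta_norm]]] := cut' x r Ox rr.
set eta := psi 1%N in eta0 eta01 eta1 eta_norm.
set B := qball Omega rho x r in eta0 eta1 eta_norm Bb DP.
have mB : lmeasurable B by exact: rm.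
have BO : B `<=` Omega by move=> y [].
have meta : leb_measurable_fun B (Q_abs Q (grad eta)).
  exact: (Q_abs_grad_measurable Oo Qp Ql mB BO eta0.1).
have CN0 : 0 < C3 * (N ^+ 1 / r) by rewrite mulr_gt0// divr_gt0// exprn_gt0.
have [Ce Ce0 CeP] := cutoff_energy mB Bb b0 meta (Q_abs_ge0 _ _) p0 CN0 ta eta_norm.
have C0r : 0 < C0 * r by exact: mulr_gt0.
have [Cs Cs0 CsP] := sobolev_integral p0 s0 Bb b0 C00 C0r (sob' x r Ox rr).
have [C CC0 CP] := truncate_level Oo To p0 a1 s0 Qp Ql mB BO Bb b0 eta0 eta01
  Ce0 Cs0 D0 CeP CsP DP.
exists (qball Omega rho x (alpha * r)).
  by apply: qball_nbhs => //; exact: mulr_gt0.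
apply: (level_bound_sub (B := B `&` [set y | eta y = 1%R])).
  by move=> y /eta1.
(* [truncate_level] controls the set where [f > l]; it is applied to [f] and to [- f]. *)
exists (C + C); first exact: addr_gt0.
move=> f f0 w w0 fw l l0.
have fN : (energy Theta p Q (fun y => (- f y)%R) <= w%:E)%E.
  apply: le_trans fw; rewrite le_eqVlt; apply/orP; left; apply/eqP.
  apply: eq_integral => y _.
  have -> // : Q_abs Q (grad (fun y => - f y)) y = Q_abs Q (grad f) y.
  by rewrite /Q_abs (gradN _ f0.1) -[- _]scaleN1r mulvZr enormZ normrN1 mul1r.
have H1 := CP f f0 w w0 fw l l0.
have H2 := CP _ (Lip0N f0) w w0 fN l l0.
rewrite mulrDl EFinD.
apply: (@le_trans _ _ (leb (B `&` [set y | eta y = 1%R] `&` [set y | (l < f y)%R] `|`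
  B `&` [set y | eta y = 1%R] `&` [set y | (l < - f y)%R]))).
  apply: le_lebesgue_outer => y [By /=]; rewrite ltr_normr => /orP[lf|lf]; by [left|right].
apply: (le_trans (outer_measureU2 _ _ _)).
exact: leeD.
Qed.

(** * Decay of level sets of weak solutions *)

Section stampacchia.
Context {R : realType}.

(* The levels d (1 - 2^-j) increase to d and the decay estimate gives
   a (d (1 - 2^-j)) <= V 2^(- al j / (de - 1)). *)
Lemma stampacchia (a : R -> R) (V K al de : R) : 0 < K -> 0 < al -> 1 < de -> 0 < V ->
  (forall k, 0 <= k -> 0 <= a k <= V) ->
  (forall k h, 0 <= k -> k <= h -> a h <= a k) ->
  (forall k h, 0 <= k -> k < h -> a h <= K / (h - k) `^ al * a k `^ de) ->
  a ((K * V `^ (de - 1)) `^ al^-1 * 2 `^ (de / (de - 1))) = 0.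
Proof.
move=> K0 al0 de1 V0 aV amono adec.
have de0 : 0 < de - 1 by rewrite subr_gt0.
set d := (X in a X).
have KV : 0 < K * V `^ (de - 1) by rewrite mulr_gt0// powR_gt0.
have d0 : 0 < d by rewrite mulr_gt0// powR_gt0.
(* The rate at which the gain [2^(- mu (de - 1) j)] offsets the factor [2^(al j)] coming from the
   shrinking gaps; what remains is the equation [dal] for [d]. *)
pose mu := al / (de - 1); have mu0 : 0 < mu by rewrite divr_gt0.
have alE : al = mu * (de - 1) by rewrite divfK// gt_eqF.
have dal : d `^ al = K * V `^ (de - 1) * 2 `^ (de * mu).
  rewrite /d powRM ?powR_ge0// -!powRrM mulVf ?gt_eqF// powRr1 ?(ltW KV)//.
  by congr (_ * 2 `^ _); rewrite /mu; field; rewrite gt_eqF.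
clearbody d.
pose k (j : nat) := d * (1 - 2 `^ (- j%:R)).
have k0 j : 0 <= k j.
  rewrite mulr_ge0 ?(ltW d0)// subr_ge0 powRN invf_le1 ?powR_gt0//.
  by rewrite powR_mulrn// exprn_ege1// ler1n.
have kd j : k j <= d by rewrite ger_pMr// gerBl powR_ge0.
have kS j : k j.+1 - k j = d * 2 `^ (- j.+1%:R).
  rewrite /k -mulrBr; congr (_ * _).
  have -> : 2 `^ (- j%:R) = 2 * 2 `^ (- j.+1%:R) :> R.
    rewrite -[X in X * _](powRr1 (_ : 0 <= 2))// -gt0_powRD//; congr (_ `^ _).
    by rewrite -natr1; ring.
  by ring.
have claim j : a (k j) <= V * 2 `^ (- (mu * j%:R)).
  elim: j => [|j IH].
    by rewrite mulr0 oppr0 powRr0 mulr1; have /andP[] := aV _ (k0 0%N).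
  have kk : k j < k j.+1 by rewrite -subr_gt0 kS mulr_gt0// powR_gt0.
  apply: (le_trans (adec _ _ (k0 j) kk)); rewrite kS.
  have D0 : 0 < (d * 2 `^ (- j.+1%:R)) `^ al by rewrite powR_gt0// mulr_gt0// powR_gt0.
  apply: (@le_trans _ _ (K / (d * 2 `^ (- j.+1%:R)) `^ al * (V * 2 `^ (- (mu * j%:R))) `^ de)).
    apply: ler_wpM2l; first exact: divr_ge0 (ltW K0) (ltW D0).
    apply: ge0_ler_powR; rewrite ?nnegrE//.
    - by rewrite ltW// (lt_trans _ de1).
    - by have /andP[] := aV _ (k0 j).
    - by rewrite mulr_ge0 ?powR_ge0// ltW.
  rewrite le_eqVlt; apply/orP; left; apply/eqP.
  have [d1 V1] := (ltW d0, ltW V0).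
  rewrite !powRM ?powR_ge0// dal -!powRrM.
  have -> : V `^ de = V `^ (de - 1) * V.
    by rewrite -[X in _ = _ * X](powRr1 V1) -gt0_powRD// subrK.
  have -> : 2 `^ (- (mu * j.+1%:R)) =
      2 `^ (- (mu * j%:R) * de) / (2 `^ (de * mu) * 2 `^ (- j.+1%:R * al)) :> R.
    rewrite -gt0_powRD// -gt0_powRB//; congr (_ `^ _); rewrite alE -natr1; ring.
  by field; rewrite !gt_eqF ?powR_gt0.
apply/eqP; rewrite eq_le; have /andP[-> _] := aV d (ltW d0); rewrite andbT.
rewrite leNgt; apply/negP => ad.
have ln20 : 0 < mu * ln 2 by rewrite mulr_gt0// ln_gt0// ltr1n.
(* As [2^(mu j) >= 1 + mu j ln 2], this [j] makes [V 2^(- mu j)] smaller than [a d]. *)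
pose j := (Num.truncn (V / a d / (mu * ln 2))).+1.
have := le_trans (amono _ _ (k0 j) (kd j)) (claim j).
rewrite powRN ler_pdivlMr ?powR_gt0// leNgt => /negP; apply.
rewrite -ltr_pdivrMl// mulrC.
have : V / a d < j%:R * (mu * ln 2) by rewrite -ltr_pdivrMr//; exact: truncnS_gt.
move=> /lt_le_trans; apply; rewrite /powR pnatr_eq0/=.
apply: le_trans (expR_ge1Dx _); rewrite ler_wpDl//.
by rewrite le_eqVlt; apply/orP; left; apply/eqP; ring.
Qed.

End stampacchia.

(** * Smooth odd ramps *)

Section tent.
Context {R : realType}.
Implicit Types (s t x m k w : R).

Let ps t : R := Num.max t 0.

Let ps_sqr s t : 0 <= ps t ^+ 2 - ps s ^+ 2 - 2 * ps s * (t - s) <= (t - s) ^+ 2.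
Proof.
rewrite /ps; have h1 := sqr_ge0 (t - s); have h2 := sqr_ge0 s; have h3 := sqr_ge0 t.
have [t0|t0] := leP t 0; have [s0|s0] := leP s 0.
- by rewrite !mulr0 mul0r !subrr h1 lexx.
- by have h : t * s <= 0 by [rewrite mulr_le0_ge0// ltW]; apply/andP; split; lra.
- by have h : t * s <= 0 by [rewrite mulr_ge0_le0// ltW]; apply/andP; split; lra.
- by apply/andP; split; lra.
Qed.

Let ps_lip s t : `|ps t - ps s| <= `|t - s|.
Proof.
have := ler_norm (t - s); have := ler_norm (- (t - s)); rewrite normrN ler_norml /ps.
by move=> ? ?; have [?|?] := leP t 0; have [?|?] := leP s 0; apply/andP; split; lra.
Qed.

(** [D m] is the tent function on [0, 2m] of height m, and [N m] is twice its antiderivative.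
    Written with squared positive parts, [N] inherits its Taylor estimate from [ps_sqr]. *)
Let N m x := ps x ^+ 2 - 2 * ps (x - m) ^+ 2 + ps (x - 2 * m) ^+ 2.
Let D m x := ps x - 2 * ps (x - m) + ps (x - 2 * m).

Let N_bound m x : 0 < m -> 0 <= N m x <= 2 * m ^+ 2.
Proof.
rewrite /N /ps => m0; have [?|?] := leP x 0; have [?|?] := leP (x - m) 0;
have [?|?] := leP (x - 2 * m) 0; apply/andP; split; nra.
Qed.

Let N_le0 m x : 0 < m -> x <= 0 -> N m x = 0.
Proof.
by rewrite /N /ps => m0 x0; rewrite !max_r; [ring|lra|lra|lra].
Qed.

Let N_ge m x : 0 < m -> 2 * m <= x -> N m x = 2 * m ^+ 2.
Proof.
by rewrite /N /ps => m0 x0; rewrite !max_l; [ring|lra|lra|lra].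
Qed.

Let D_bound m x : 0 < m -> 0 <= D m x <= m.
Proof.
rewrite /D /ps => m0; have [?|?] := leP x 0; have [?|?] := leP (x - m) 0;
have [?|?] := leP (x - 2 * m) 0; apply/andP; split; lra.
Qed.

Let D_le0 m x : 0 < m -> x <= 0 -> D m x = 0.
Proof.
by rewrite /D /ps => m0 x0; rewrite !max_r; [ring|lra|lra|lra].
Qed.

(* An odd C^1 function vanishing on [-k, k] and constant on [k + w, oo), whose
   derivative on [k, k + w] is the tent function of height 1. *)
Definition ramp k w t : R := (N (w / 2) (t - k) - N (w / 2) (- t - k)) / w.
Definition ramp' k w t : R := 2 * (D (w / 2) (t - k) + D (w / 2) (- t - k)) / w.

Variables (k w : R).
Hypotheses (k_ge0 : 0 <= k) (w_gt0 : 0 < w).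

Let m0 : 0 < w / 2. Proof. by rewrite divr_gt0. Qed.

Lemma ramp0 : ramp k w 0 = 0.
Proof. by rewrite /ramp oppr0 subrr mul0r. Qed.

Lemma ramp_small t : `|t| <= k -> ramp k w t = 0.
Proof.
by rewrite ler_norml => /andP[? ?]; rewrite /ramp !N_le0 ?subrr ?mul0r//; lra.
Qed.

Lemma ramp'_bound t : 0 <= ramp' k w t <= 1.
Proof.
have [k0 w0] := (k_ge0, w_gt0).
rewrite /ramp'; have /andP[a1 a2] := D_bound (t - k) m0.
have /andP[b1 b2] := D_bound (- t - k) m0.
rewrite divr_ge0 ?(ltW w_gt0)//=; last by lra.
rewrite ler_pdivrMr// mul1r; have [t0|t0] := leP t 0.
  by rewrite (D_le0 m0 (_ : t - k <= 0)); lra.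
by rewrite (D_le0 m0 (_ : - t - k <= 0)); lra.
Qed.

Lemma ramp_sign t : 0 <= t * ramp k w t.
Proof.
have [k0 w0] := (k_ge0, w_gt0).
rewrite /ramp mulrA divr_ge0 ?(ltW w_gt0)//.
have /andP[a1 a2] := N_bound (t - k) m0; have /andP[b1 b2] := N_bound (- t - k) m0.
have [t0|t0] := leP t 0.
  by rewrite (N_le0 m0 (_ : t - k <= 0)); [rewrite mulr_le0// sub0r oppr_le0|lra].
by rewrite (N_le0 m0 (_ : - t - k <= 0)); [rewrite mulr_ge0 ?subr0// ltW|lra].
Qed.

Lemma ramp_bound t : `|ramp k w t| <= w / 2.
Proof.
have [k0 w0] := (k_ge0, w_gt0).
rewrite /ramp normrM normfV (gtr0_norm w_gt0) ler_pdivrMr//.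
have /andP[a1 a2] := N_bound (t - k) m0; have /andP[b1 b2] := N_bound (- t - k) m0.
rewrite ler_norml; have -> : w / 2 * w = 2 * (w / 2) ^+ 2 by field.
by apply/andP; split; lra.
Qed.

Lemma ramp_large t : k + w <= `|t| -> `|ramp k w t| = w / 2.
Proof.
have [k0 w0] := (k_ge0, w_gt0).
move=> tw; have e : 2 * (w / 2) ^+ 2 / w = w / 2 by field; rewrite gt_eqF.
have w2 : 0 <= w / 2 by exact: ltW.
rewrite /ramp; have [t0|t0] := leP t 0.
  rewrite (ler0_norm t0) in tw; rewrite (N_le0 m0 (_ : t - k <= 0)); last by lra.
  by rewrite (N_ge m0); [rewrite sub0r mulNr e normrN ger0_norm|lra].
rewrite (gtr0_norm t0) in tw; rewrite (N_le0 m0 (_ : - t - k <= 0)); last by lra.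
by rewrite (N_ge m0); [rewrite subr0 e ger0_norm|lra].
Qed.

(** Each of the two copies of [N] combines three squared positive parts with weights 1, 2, 1, whence
    at most 8. *)
Lemma ramp_taylor s t :
  `|ramp k w t - ramp k w s - ramp' k w s * (t - s)| <= 8 / w * (t - s) ^+ 2.
Proof.
have [k0 w0] := (k_ge0, w_gt0).
have H (z : R) (e : R) : e * (t - s) = (e * t - z) - (e * s - z) by ring.
have -> : ramp k w t - ramp k w s - ramp' k w s * (t - s) =
  (N (w / 2) (t - k) - N (w / 2) (s - k) - 2 * D (w / 2) (s - k) * (t - s) -
   (N (w / 2) (- t - k) - N (w / 2) (- s - k) + 2 * D (w / 2) (- s - k) * (t - s))) / w.
  by rewrite /ramp /ramp'; ring.
rewrite normrM normfV (gtr0_norm w_gt0) (mulrAC 8) ler_wpM2r ?invr_ge0 ?(ltW w_gt0)//.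
rewrite /N /D; set m := w / 2.
have sq0 := sqr_ge0 (t - s).
have /andP[a1 a2] := ps_sqr (s - k) (t - k).
have /andP[a3 a4] := ps_sqr (s - k - m) (t - k - m).
have /andP[a5 a6] := ps_sqr (s - k - 2 * m) (t - k - 2 * m).
have /andP[b1 b2] := ps_sqr (- s - k) (- t - k).
have /andP[b3 b4] := ps_sqr (- s - k - m) (- t - k - m).
have /andP[b5 b6] := ps_sqr (- s - k - 2 * m) (- t - k - 2 * m).
have E1 (z : R) : t - z - (s - z) = t - s by ring.
have E2 (z : R) : - t - z - (- s - z) = - (t - s) by ring.
rewrite -?addrA -?opprD ?E1 ?E2 ?sqrrN in a1 a2 a3 a4 a5 a6 b1 b2 b3 b4 b5 b6 *.
by rewrite ler_norml; apply/andP; split; lra.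
Qed.

(** For [|s - t| < w] the Taylor remainder contributes 8 and the derivative 1; farther apart the
    values differ by at most [w]. *)
Lemma ramp_lip s t : `|ramp k w s - ramp k w t| <= 9 * `|s - t|.
Proof.
have [k0 w0] := (k_ge0, w_gt0).
have [st|st] := leP w `|s - t|.
  apply: (@le_trans _ _ (w / 2 + w / 2)).
    by apply: (le_trans (ler_normB _ _)); apply: lerD; exact: ramp_bound.
  by rewrite -splitr; have := normr_ge0 (s - t); lra.
have := ramp_taylor t s; have /andP[r0 r1] := ramp'_bound t => H.
rewrite -[X in `|X|](subrK (ramp' k w t * (s - t))).
apply: (le_trans (ler_normD _ _)); apply: (@le_trans _ _ (8 * `|s - t| + `|s - t|)); last by lra.
apply: lerD.
  apply: (le_trans H); rewrite -real_normK ?num_real// expr2 mulrA ler_wpM2r//.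
  by rewrite mulrAC ler_pdivrMr// ler_wpM2l// ltW.
by rewrite normrM (ger0_norm r0) ler_piMl.
Qed.

Lemma ramp'_lip s t : `|ramp' k w s - ramp' k w t| <= 16 / w * `|s - t|.
Proof.
have [k0 w0] := (k_ge0, w_gt0).
have -> : ramp' k w s - ramp' k w t =
  2 * (D (w / 2) (s - k) - D (w / 2) (t - k) + (D (w / 2) (- s - k) - D (w / 2) (- t - k))) / w.
  by rewrite /ramp'; ring.
rewrite normrM normfV (gtr0_norm w_gt0) (mulrAC 16) ler_wpM2r ?invr_ge0 ?(ltW w_gt0)//.
rewrite /D; set m := w / 2.
have a1 := ps_lip (t - k) (s - k).
have a2 := ps_lip (t - k - m) (s - k - m).
have a3 := ps_lip (t - k - 2 * m) (s - k - 2 * m).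
have b1 := ps_lip (- t - k) (- s - k).
have b2 := ps_lip (- t - k - m) (- s - k - m).
have b3 := ps_lip (- t - k - 2 * m) (- s - k - 2 * m).
move: a1 a2 a3 b1 b2 b3.
have E z z' : z' = s - t -> `|z| <= `|z'| -> - `|s - t| <= z <= `|s - t|.
  by move=> ->; rewrite ler_norml.
have E' z z' : z' = - (s - t) -> `|z| <= `|z'| -> - `|s - t| <= z <= `|s - t|.
  by move=> ->; rewrite normrN ler_norml.
move=> /E-/(_ ltac:(ring))/andP[? ?] /E-/(_ ltac:(ring))/andP[? ?] /E-/(_ ltac:(ring))/andP[? ?].
move=> /E'-/(_ ltac:(ring))/andP[? ?] /E'-/(_ ltac:(ring))/andP[? ?] /E'-/(_ ltac:(ring))/andP[? ?].
by rewrite ler_norml; apply/andP; split; lra.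
Qed.

End tent.

(** * Pointwise inequalities for the p-Laplacian flux *)

Section pointwise.
Context {R : realType}.
Implicit Types (a b d p : R).

(** Young's inequality with simple constants: one term on the right suffices alone, according to
    whether [b <= d * a]. *)
Lemma young_eps p d a b : 1 < p -> 0 < d -> 0 <= a -> 0 <= b ->
  a `^ (p - 1) * b <= d * a `^ p + d `^ (1 - p) * b `^ p.
Proof.
move=> p1 d0 a0 b0; have p0 : 0 < p by exact: lt_trans p1.
have p10 : 0 <= p - 1 by rewrite subr_ge0 ltW.
have [bd|bd] := leP b (d * a).
  apply: (@le_trans _ _ (d * a `^ p)); last by rewrite lerDl mulr_ge0 ?powR_ge0.
  have -> : d * a `^ p = a `^ (p - 1) * (d * a) by rewrite -(mulr_powRB1 a0 p0); ring.
  by rewrite ler_wpM2l ?powR_ge0.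
apply: (@le_trans _ _ (d `^ (1 - p) * b `^ p)); last by rewrite lerDr mulr_ge0 ?powR_ge0// ltW.
have ab : a `^ (p - 1) <= (b / d) `^ (p - 1).
  by rewrite ge0_ler_powR ?nnegrE ?divr_ge0 ?(ltW d0)// ler_pdivlMr// mulrC ltW.
apply: (le_trans (ler_wpM2r b0 ab)).
have -> : 1 - p = - (p - 1) by ring.
rewrite -(mulr_powRB1 b0 p0) powR_div ?(ltW d0)// powRN.
rewrite le_eqVlt; apply/orP; left; apply/eqP; field.
by rewrite gt_eqF ?powR_gt0.
Qed.

Context {n : nat}.
Implicit Types (A : 'M[R]_n.+1) (v w : 'rV[R]_n.+1).

Let nrm A v : R := enorm (mulv (psd_sqrt A) v).

Let dot_pow A v p : psd A -> nrm A v != 0 ->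
  dot (mulv A v) v `^ ((p - 2) / 2) = nrm A v `^ (p - 2).
Proof.
move=> Ap v0; rewrite -sqr_enorm_sqrt// -/(nrm A v) -powR_mulrn ?enorm_ge0//.
by rewrite -powRrM mulrC divfK// pnatr_eq0.
Qed.

Let dot0 A v w : psd A -> nrm A v = 0 -> dot (mulv A v) w = 0.
Proof.
move=> Ap v0; apply/eqP; rewrite -normr_le0.
by apply: (le_trans (ler_dot_mulv v w Ap)); rewrite -/(nrm A v) v0 mul0r.
Qed.

Lemma p_flux_le A v w p : psd A -> 1 < p ->
  `|dot (mulv A v) v `^ ((p - 2) / 2) * dot (mulv A v) w| <=
  nrm A v `^ (p - 1) * nrm A w.
Proof.
move=> Ap p1; have [v0|v0] := eqVneq (nrm A v) 0.
  (* At a degenerate point the second factor vanishes, whatever value the power of 0 takes. *)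
  by rewrite (dot0 w Ap v0) mulr0 normr0 mulr_ge0 ?powR_ge0// enorm_ge0.
rewrite dot_pow// normrM ger0_norm ?powR_ge0//.
have vp : 0 < nrm A v by rewrite lt_def v0 enorm_ge0.
have -> : nrm A v `^ (p - 1) = nrm A v `^ (p - 2) * nrm A v.
  by rewrite -[X in _ = _ * X](powRr1 (ltW vp)) -gt0_powRD//; congr (_ `^ _); ring.
by rewrite -mulrA ler_wpM2l ?powR_ge0//; exact: ler_dot_mulv.
Qed.

(** Meant for [v = g], [w = grad f], [c = T' (f x)]: the flux of the solution against the gradient
    of the test function recovers the weighted energy of [g], up to an error in [g - grad f]. *)
Lemma p_flux_ge A v w c p : psd A -> 1 < p -> 0 <= c <= 1 ->
  c * nrm A v `^ p <= dot (mulv A v) v `^ ((p - 2) / 2) * dot (mulv A v) (c *: w)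
    + nrm A v `^ (p - 1) * nrm A (v - w).
Proof.
move=> Ap p1 /andP[c0 c1]; have p0 : 0 < p by exact: lt_trans p1.
have [v0|v0] := eqVneq (nrm A v) 0.
  by rewrite (dot0 (c *: w) Ap v0) v0 !powR0 ?gt_eqF ?subr_gt0// !mulr0 mul0r addr0.
rewrite dot_pow// dotZr.
have vp : 0 < nrm A v by rewrite lt_def v0 enorm_ge0.
set G := nrm A v in vp v0 *; set H := nrm A (v - w).
have GP : 0 <= G `^ (p - 2) by exact: powR_ge0.
have e1 : G `^ (p - 1) = G `^ (p - 2) * G.
  by rewrite -[X in _ = _ * X](powRr1 (ltW vp)) -gt0_powRD//; congr (_ `^ _); ring.
have e2 : G `^ p = G `^ (p - 2) * G ^+ 2.
  by rewrite -(powR_mulrn 2 (ltW vp)) -gt0_powRD// subrK.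
have dw : G ^+ 2 - G * H <= dot (mulv A v) w.
  have -> : dot (mulv A v) w = dot (mulv A v) v - dot (mulv A v) (v - w).
    by rewrite (_ : v - w = v + -1 *: w); [rewrite dotDr dotZr; ring|rewrite scaleN1r].
  rewrite -sqr_enorm_sqrt// lerD2l lerN2.
  exact: le_trans (ler_norm _) (ler_dot_mulv _ _ Ap).
have H0 : 0 <= H by exact: enorm_ge0.
rewrite e1 e2 mulrCA -!mulrA -mulrDr ler_wpM2l//.
have GH : 0 <= G * H by rewrite mulr_ge0// ltW.
have := ler_wpM2l c0 dw; have : c * (G * H) <= G * H by rewrite ler_piMl.
lra.
Qed.

Lemma powR_sign_norm p a b : 1 < p -> `| `|a| `^ (p - 2) * a * b| = `|a| `^ (p - 1) * `|b|.
Proof.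
move=> p1; rewrite normrM; congr (_ * _).
have [->|a0] := eqVneq a 0; first by rewrite mulr0 normr0 powR0// gt_eqF// subr_gt0.
have ap : 0 < `|a| by rewrite normr_gt0.
rewrite normrM ger0_norm ?powR_ge0// -[X in _ * X](powRr1 (ltW ap)) -gt0_powRD//.
by congr (_ `^ _); ring.
Qed.

(* The zeroth-order term has a good sign because T is odd and increasing. *)
Lemma zeroth_order_ge (T : R -> R) L p a b : 1 < p -> 0 <= L ->
  (forall s, 0 <= s * T s) -> (forall s t, `|T s - T t| <= L * `|s - t|) ->
  - (L * (`|a| `^ (p - 1) * `|a - b|)) <= `|a| `^ (p - 2) * a * T b.
Proof.
move=> p1 L0 Ts TL.
have -> : `|a| `^ (p - 2) * a * T b =
  `|a| `^ (p - 2) * (a * T a) - `|a| `^ (p - 2) * a * (T a - T b) by ring.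
apply: (@le_trans _ _ (- (`|a| `^ (p - 2) * a * (T a - T b)))); last first.
  by rewrite lerDr mulr_ge0 ?powR_ge0.
rewrite lerN2; apply: (le_trans (ler_norm _)); rewrite powR_sign_norm//.
by rewrite [leRHS]mulrCA ler_wpM2l ?powR_ge0.
Qed.

End pointwise.

Section leb_integrable.
Context {R : realType} {n : nat}.
Variable D : set 'rV[R]_n.+1.
Hypothesis mD : lmeasurable D.
Implicit Types (f g h : 'rV[R]_n.+1 -> R).

Definition lint h : Prop :=
  @integrable _ (caratheodory_type (@lebesgue_outer R n)) R leb D (EFin \o h).

Lemma lint_nonneg h : leb_measurable_fun D h -> (forall x, D x -> 0 <= h x) ->
  (\int[leb]_(x in D) (h x)%:E < +oo)%E -> lint h.
Proof.
move=> mh h0 hfin; apply/integrableP; split; first exact: leb_measurable_EFin.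
apply: le_lt_trans hfin; apply: le_integral_nonneg => x Dx; first exact: abse_ge0.
by rewrite /= ger0_norm ?h0.
Qed.

Lemma lint_powR h p c : leb_measurable_fun D (fun x => h x `^ p) ->
  (\int[leb]_(x in D) (h x `^ p)%:E <= c%:E)%E -> lint (fun x => h x `^ p).
Proof.
move=> mh hc; apply: lint_nonneg => // [x _|]; first exact: powR_ge0.
by apply: le_lt_trans hc _; rewrite ltry.
Qed.

Lemma lint_dom h g : leb_measurable_fun D h -> (forall x, D x -> `|h x| <= g x) ->
  lint g -> lint h.
Proof.
move=> mh hg ig; apply: (le_integrable mD (leb_measurable_EFin mh) _ ig) => x Dx.
by rewrite /= lee_fin (le_trans (hg x Dx))// ler_norm.
Qed.

Lemma lintD f g : lint f -> lint g -> lint (fun x => f x + g x).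
Proof. exact: integrableD. Qed.

Lemma lintZl c f : lint f -> lint (fun x => c * f x).
Proof. exact: integrableZl. Qed.

Lemma lint_cst c : (leb D < +oo)%E -> lint (fun=> c).
Proof.
move=> fD; apply: (@lint_dom _ (fun=> `|c|)) => //; first exact: measurable_cst.
apply: lint_nonneg => //; first exact: measurable_cst.
have -> : (\int[leb]_(x in D) `|c|%:E = \int[leb]_(x in D) (cst `|c|%:E) x)%E by [].
by rewrite integral_cst//; apply: lte_mul_pinfty.
Qed.

Lemma integral_comb_le f g (A B a b : R) : leb_measurable_fun D f ->
  leb_measurable_fun D g -> (forall x, 0 <= f x) -> (forall x, 0 <= g x) ->
  0 <= a -> 0 <= b ->
  (\int[leb]_(x in D) (f x)%:E <= A%:E)%E -> (\int[leb]_(x in D) (g x)%:E <= B%:E)%E ->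
  (\int[leb]_(x in D) (a * f x + b * g x)%:E <= (a * A + b * B)%:E)%E.
Proof.
move=> mf mg f0 g0 a0 b0 fA gB.
have mcf (c : R) (h : 'rV[R]_n.+1 -> R) : leb_measurable_fun D h ->
    @measurable_fun _ _ (caratheodory_type (@lebesgue_outer R n)) (\bar R) D
      (fun x => (c%:E * (h x)%:E)%E).
  move=> mh; apply: (leb_measurable_EFin (f := fun x => c * h x)).
  by apply: leb_measurableM => //; exact: measurable_cst.
have h0 (c : R) (h : 'rV[R]_n.+1 -> R) : 0 <= c -> (forall x, 0 <= h x) ->
    forall x, D x -> (0 <= c%:E * (h x)%:E)%E.
  by move=> c0 hh x _; rewrite -EFinM lee_fin mulr_ge0.
under eq_integral do rewrite EFinD !EFinM.
rewrite (ge0_integralD leb mD (h0 a f a0 f0) (mcf a f mf) (h0 b g b0 g0) (mcf b g mg)).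
have hZ (c : R) h (h0' : forall x, 0 <= h x) mh c0 :=
  ge0_integralZl_EFin leb mD (f1 := EFin \o h) (fun x _ => h0' x)
    (leb_measurable_EFin mh) (k := c) c0.
rewrite (hZ a f f0 mf a0) (hZ b g g0 mg b0).
rewrite EFinD !EFinM.
by apply: leeD; apply: lee_wpmul2l; rewrite ?lee_fin.
Qed.

Lemma lint_measurable f : lint f -> leb_measurable_fun D f.
Proof. by move=> /integrableP[/measurable_EFinP]. Qed.

End leb_integrable.

(** * The equation tested with T(f) *)

Section test_estimate.
Context {R : realType} {n : nat}.
Variables (Omega Theta : set 'rV[R]_n.+1) (p q tau : R) (Q : 'rV[R]_n.+1 -> 'M[R]_n.+1)
  (phi u : 'rV[R]_n.+1 -> R) (g : 'rV[R]_n.+1 -> 'rV[R]_n.+1).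
Hypotheses (Omega_open : open Omega) (Theta_open : open Theta)
  (ThetaO : Theta `<=` Omega) (Theta_fin : (leb Theta < +oo)%E) (p_gt1 : 1 < p)
  (Q_psd : forall x, Omega x -> psd (Q x)) (Q_loc : Lloc_matrix Omega (p / 2) Q)
  (q_gt1 : 1 < q) (tau01 : 0 < tau < 1)
  (phi_measurable : leb_measurable_fun Theta phi)
  (phi_fin : (\int[leb]_(x in Theta) (`|phi x| `^ q)%:E < +oo)%E)
  (weak : weak_solution Theta p Q tau phi u g).
Variables (T T' : R -> R) (K K' L M Wg U : R).
Hypotheses (T0 : T 0 = 0)
  (T_taylor : forall s t, `|T t - T s - T' s * (t - s)| <= K * (t - s) ^+ 2)
  (T_lip : forall s t, `|T s - T t| <= L * `|s - t|)
  (T_sign : forall t, 0 <= t * T t) (T_bound : forall t, `|T t| <= M)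
  (T'_bound : forall t, 0 <= T' t <= 1)
  (T'_lip : forall s t, `|T' s - T' t| <= K' * `|s - t|) (L_ge0 : 0 <= L).

Let G x : R := Q_abs Q g x.

Hypotheses (gW : (\int[leb]_(x in Theta) (Q_abs Q g x `^ p)%:E <= Wg%:E)%E)
  (uU : (\int[leb]_(x in Theta) (`|u x| `^ p)%:E <= U%:E)%E).

Let p0 : 0 < p. Proof. exact: lt_trans p_gt1. Qed.
Let mT : lmeasurable Theta. Proof. exact: open_lmeasurable. Qed.
Let mu : leb_measurable_fun Theta u. Proof. by have [[[]]] := weak. Qed.
Let mg i : leb_measurable_fun Theta (fun x => g x 0 i).
Proof. by have [[_ [mg _] _] _] := weak. Qed.

Let mQ (h : 'rV[R]_n.+1 -> 'rV[R]_n.+1) : (forall i, leb_measurable_fun Theta (fun x => h x 0 i)) ->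
  leb_measurable_fun Theta (fun x => Q_abs Q h x `^ p).
Proof.
by move=> mh; apply: leb_measurable_powR; exact: (Q_abs_measurable Omega_open Q_psd Q_loc mT ThetaO mh).
Qed.

(** Replacing [u] by [f] in the test function costs terms in [g - grad f] and [u - f]. Young's
    inequality splits them into [d] times quantities fixed by the solution and [d^(1 - p)] times the
    approximation error [e]. The term with [tau] is nonnegative up to such an error, and [tau < 1]
    bounds the latter uniformly. *)
Lemma test_estimate f e d : Lip0 Theta f -> 0 < d ->
  (\int[leb]_(x in Theta) (`|u x - f x| `^ p)%:E <= e%:E)%E ->
  (\int[leb]_(x in Theta) (Q_abs Q (fun x => (g x - grad f x)%R) x `^ p)%:E <= e%:E)%E ->
  (\int[leb]_(x in Theta) (T' (f x) * Q_abs Q g x `^ p)%:E <=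
   \int[leb]_(x in Theta) (`|phi x| * `|T (f x)|)%:E +
   (d * (Wg + L * U) + d `^ (1 - p) * ((1 + L) * e))%:E)%E.
Proof.
move=> f0 d0 ufe Dfe; have /andP[tau0 tau1] := tau01.
pose v := T \o f.
have lf := f0.1.
have v0 : Lip0 Theta v by exact: (Lip0_comp f0 T0 T_lip).
have gradv x : grad v x = T' (f x) *: grad f x by exact: (grad_comp _ lf T_taylor).
have mv : leb_measurable_fun Theta v.
  by apply: continuous_leb_measurable; apply: lipschitz_cont; exact: v0.1.
have mf : leb_measurable_fun Theta f.
  by apply: continuous_leb_measurable; exact: lipschitz_cont.
have mT' : leb_measurable_fun Theta (T' \o f).
  apply: continuous_leb_measurable; apply: lipschitz_cont.
  exact: (lipschitz_comp_real lf T'_lip).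
have mgf i : leb_measurable_fun Theta (fun x => grad f x 0 i) by exact: grad_measurable.
have mgv i : leb_measurable_fun Theta (fun x => grad v x 0 i).
  by apply: grad_measurable; exact: v0.1.
pose D x := Q_abs Q (fun x => g x - grad f x) x.
have mDi i : leb_measurable_fun Theta (fun x => (g x - grad f x) 0 i).
  rewrite (_ : (fun x => _) = (fun x => g x 0 i - grad f x 0 i)).
    exact: leb_measurableB.
  by apply/funext => x; rewrite !mxE.
have iG : lint Theta (fun x => G x `^ p) by apply: lint_powR gW; exact: mQ.
have iD : lint Theta (fun x => D x `^ p) by apply: lint_powR Dfe; exact: mQ.
have iU : lint Theta (fun x => `|u x| `^ p).
  by apply: lint_powR uU; apply: leb_measurable_powR; exact: leb_measurable_norm.
have iUF : lint Theta (fun x => `|u x - f x| `^ p).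
  apply: lint_powR ufe; apply: leb_measurable_powR; apply: leb_measurable_norm.
  exact: leb_measurableB.
have iP : lint Theta (fun x => `|phi x| `^ q).
  by apply: lint_nonneg => //; apply: leb_measurable_powR; exact: leb_measurable_norm.
have iV : lint Theta (fun x => Q_abs Q (grad v) x `^ p).
  apply: lint_nonneg; [exact: mQ|by move=> x _; exact: powR_ge0|].
  exact: (energy_fin Omega_open p0 Q_psd Q_loc ThetaO v0 mT ThetaO).
have M0 : 0 <= M by exact: le_trans (T_bound 0).
have young1 a b : 0 <= a -> 0 <= b -> a `^ (p - 1) * b <= a `^ p + b `^ p.
  move=> a0 b0; have := young_eps p_gt1 ltr01 a0 b0.
  by rewrite powR1 !mul1r.
pose i1 x := dot (mulv (Q x) (g x)) (g x) `^ ((p - 2) / 2) * dot (mulv (Q x) (g x)) (grad v x).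
pose i2 x := `|u x| `^ (p - 2) * u x * v x.
pose i3 x := phi x * v x.
(* The weak formulation is stated with real-valued integrals, and their additivity requires
   integrability of each integrand. *)
have ii1 : lint Theta i1.
  apply: (lint_dom mT (g := fun x => G x `^ p + Q_abs Q (grad v) x `^ p)).
  - apply: leb_measurableM; last exact: (dot_mulv_measurable Omega_open Q_loc).
    by apply: leb_measurable_powR; exact: (dot_mulv_measurable Omega_open Q_loc).
  - move=> x Tx; apply: (le_trans (p_flux_le _ _ (Q_psd (ThetaO Tx)) p_gt1)).
    by apply: young1; exact: enorm_ge0.
  - exact: lintD.
have ii2 : lint Theta i2.
  apply: (lint_dom mT (g := fun x => `|u x| `^ p + M `^ p)).
  - by do 2?apply: leb_measurableM => //; apply: leb_measurable_powR; exact: leb_measurable_norm.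
  - move=> x Tx; rewrite powR_sign_norm//; apply: (@le_trans _ _ (`|u x| `^ (p - 1) * M)).
      by rewrite ler_wpM2l ?powR_ge0//; exact: T_bound.
    exact: young1.
  - by apply: lintD => //; exact: lint_cst.
have phi1 x : `|phi x| <= 1 + `|phi x| `^ q.
  have := @powR_interpolation R 1 q 1 `|phi x| ltr01 (ltW q_gt1) ltr01 (normr_ge0 _).
  by rewrite !powR1 powRr1// mul1r.
have ip : lint Theta (fun x => M * (1 + `|phi x| `^ q)).
  by apply: lintZl => //; apply: lintD => //; exact: lint_cst.
have ii3 : lint Theta i3.
  apply: (lint_dom mT (g := fun x => M * (1 + `|phi x| `^ q))) => //.
    exact: leb_measurableM.
  by move=> x Tx; rewrite normrM mulrC ler_pM// T_bound.
pose S3 x := `|phi x| * `|T (f x)|.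
have iS3 : lint Theta S3.
  apply: (lint_dom mT (g := fun x => M * (1 + `|phi x| `^ q))) => //.
    by apply: leb_measurableM; apply: leb_measurable_norm.
  by move=> x Tx; rewrite normrM !normr_id mulrC ler_pM// T_bound.
have J0 : (\int[leb]_(x in Theta) (i1 x + tau * i2 x + i3 x)%:E = 0)%E.
  have weq := weak.2 v v0.
  have it2 : lint Theta (fun x => tau * i2 x) by exact: lintZl.
  have iJ : lint Theta (fun x => i1 x + tau * i2 x + i3 x) by do 2!apply: lintD => //.
  have eJ : \int[leb]_(x in Theta) (i1 x + tau * i2 x + i3 x) = 0.
    rewrite RintegralD//; last exact: lintD.
    by rewrite RintegralD// RintegralZl// weq addNr.
  rewrite -(fineK (integrable_fin_num mT iJ)); congr EFin; exact: eJ.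
pose S1 x := d * (G x `^ p) + (d * L) * (`|u x| `^ p).
pose S2 x := d `^ (1 - p) * (D x `^ p) + (d `^ (1 - p) * L) * (`|u x - f x| `^ p).
have [d1 dp] : 0 <= d /\ 0 <= d `^ (1 - p) by split; [exact: ltW|exact: powR_ge0].
have S1_0 x : 0 <= S1 x by rewrite addr_ge0// !mulr_ge0 ?powR_ge0.
have S2_0 x : 0 <= S2 x by rewrite addr_ge0// !mulr_ge0 ?powR_ge0.
have iS1 : lint Theta S1 := lintD mT (lintZl mT d iG) (lintZl mT (d * L) iU).
have iS2 : lint Theta S2 := lintD mT (lintZl mT _ iD) (lintZl mT _ iUF).
have iS : lint Theta (fun x => 1 * S1 x + 1 * S2 x) :=
  lintD mT (lintZl mT 1 iS1) (lintZl mT 1 iS2).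
have iJ : lint Theta (fun x => i1 x + tau * i2 x + i3 x).
  by apply: lintD => //; apply: lintD => //; exact: lintZl.
(* The first group integrates to 0 by the equation; the others make the sum dominate
   [T' (f x) * Q_abs Q g x ^ p] pointwise. *)
pose P x := (i1 x + tau * i2 x + i3 x) + (S3 x + (1 * S1 x + 1 * S2 x)).
apply: (@le_trans _ _ (\int[leb]_(x in Theta) (P x)%:E)%E).
  apply: le_integral_nonneg => x Tx; rewrite lee_fin.
    by have /andP[h _] := T'_bound (f x); rewrite mulr_ge0 ?powR_ge0.
  have Qx := Q_psd (ThetaO Tx).
  have h1 := p_flux_ge (g x) (grad f x) Qx p_gt1 (T'_bound (f x)).
  have h2 := zeroth_order_ge (u x) (f x) p_gt1 L_ge0 T_sign T_lip.
  have h3 : - S3 x <= i3 x by rewrite lerNl /S3 /i3 -normrM -normrN ler_norm.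
  have h4 := young_eps p_gt1 d0 (enorm_ge0 (mulv (psd_sqrt (Q x)) (g x)))
    (enorm_ge0 (mulv (psd_sqrt (Q x)) (g x - grad f x))).
  have h5 := young_eps p_gt1 d0 (normr_ge0 (u x)) (normr_ge0 (u x - f x)).
  have h6 : - (L * (`|u x| `^ (p - 1) * `|u x - f x|)) <= tau * i2 x.
    apply: (@le_trans _ _ (tau * - (L * (`|u x| `^ (p - 1) * `|u x - f x|)))).
      rewrite mulrN lerN2 ler_piMl// ?(ltW tau1)//.
      by rewrite !mulr_ge0 ?powR_ge0.
    by rewrite ler_wpM2l// ltW.
  have h7 := ler_wpM2l L_ge0 h5.
  move: h1 h3 h4 h6 h7; rewrite /P /S1 /S2 /G /D /i1 /Q_abs gradv.
  rewrite /S3 /i2 /i3.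
  lra.
have -> : (\int[leb]_(x in Theta) (P x)%:E =
   \int[leb]_(x in Theta) (i1 x + tau * i2 x + i3 x)%:E +
   (\int[leb]_(x in Theta) (S3 x)%:E + \int[leb]_(x in Theta) (1 * S1 x + 1 * S2 x)%:E))%E.
  by rewrite -integralD_EFin// -integralD_EFin//; exact: lintD.
rewrite J0 add0e leeD2l//.
have -> : d * (Wg + L * U) + d `^ (1 - p) * ((1 + L) * e) =
  1 * (d * Wg + (d * L) * U) + 1 * (d `^ (1 - p) * e + (d `^ (1 - p) * L) * e) by ring.
apply: integral_comb_le => //; [exact: lint_measurable iS1|exact: lint_measurable iS2|..].
  exact: (integral_comb_le mT (lint_measurable iG) (lint_measurable iU)
    (fun=> powR_ge0 _ _) (fun=> powR_ge0 _ _) (ltW d0) (mulr_ge0 (ltW d0) L_ge0) gW uU).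
exact: (integral_comb_le mT (lint_measurable iD) (lint_measurable iUF)
  (fun=> powR_ge0 _ _) (fun=> powR_ge0 _ _) (powR_ge0 _ _)
  (mulr_ge0 (powR_ge0 _ _) L_ge0) Dfe ufe).
Qed.

End test_estimate.

Lemma powR_sum_le (R : realType) (p a b : R) : 0 <= p -> 0 <= a -> 0 <= b ->
  (a + b) `^ p <= 2 `^ p * (a `^ p + b `^ p).
Proof.
move=> p0 a0 b0.
have H c d : 0 <= c -> 0 <= d -> c <= d -> (c + d) `^ p <= 2 `^ p * d `^ p.
  move=> c0 d0 cd; rewrite -powRM// ge0_ler_powR ?nnegrE ?addr_ge0 ?mulr_ge0//; lra.
have P2 : 0 <= 2 `^ p :> R by exact: powR_ge0.
have [ab|ba] := leP a b.
  by apply: (le_trans (H _ _ a0 b0 ab)); rewrite ler_wpM2l// lerDr powR_ge0.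
rewrite addrC; apply: (le_trans (H _ _ b0 a0 (ltW ba))).
by rewrite ler_wpM2l// lerDl powR_ge0.
Qed.

(** * From one level to the next *)

Section level_decay.
Context {R : realType} {n : nat}.
Variables (Omega Theta : set 'rV[R]_n.+1) (p q sigma tau : R) (Q : 'rV[R]_n.+1 -> 'M[R]_n.+1)
  (phi u : 'rV[R]_n.+1 -> R) (g : 'rV[R]_n.+1 -> 'rV[R]_n.+1) (C F : R).
Hypotheses (Omega_open : open Omega) (Theta_open : open Theta)
  (ThetaO : Theta `<=` Omega) (Theta_fin : (leb Theta < +oo)%E) (p_gt1 : 1 < p)
  (Q_psd : forall x, Omega x -> psd (Q x)) (Q_loc : Lloc_matrix Omega (p / 2) Q)
  (q_gt1 : 1 < q) (tau01 : 0 < tau < 1) (C_gt0 : 0 < C) (F_gt0 : 0 < F)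
  (phi_measurable : leb_measurable_fun Theta phi)
  (phi_le : (\int[leb]_(x in Theta) (`|phi x| `^ q)%:E <= (F `^ q)%:E)%E)
  (weak : weak_solution Theta p Q tau phi u g).
Hypothesis level_Theta : forall f, Lip0 Theta f -> forall w, 0 < w ->
  (energy Theta p Q f <= w%:E)%E -> forall l, 0 < l ->
  (leb (Theta `&` [set x | (l < `|f x|)%R]) <= (C * (w / l `^ p) `^ sigma)%:E)%E.

Let p0 : 0 < p. Proof. exact: lt_trans p_gt1. Qed.
Let mT : lmeasurable Theta. Proof. exact: open_lmeasurable. Qed.
Let mu : leb_measurable_fun Theta u. Proof. by have [[[]]] := weak. Qed.

Lemma H1_approx (e : R) : 0 < e -> exists2 f, Lip0 Theta f &
  (\int[leb]_(x in Theta) (`|u x - f x| `^ p)%:E <= e%:E)%E /\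
  (\int[leb]_(x in Theta) (Q_abs Q (fun x => (g x - grad f x)%R) x `^ p)%:E <= e%:E)%E.
Proof.
move=> e0; have [[_ _ app] _] := weak.
have ep0 : 0 < e `^ p^-1 by exact: powR_gt0.
have [f f0 fe] := app _ ep0; exists f => //.
have pp x : (0 <= x -> (x `^ p^-1) `^ p = x)%E.
  by move=> x0; rewrite -poweRrM mulVf ?gt_eqF// poweRe1.
move: fe; rewrite /H1_norm !Lnorm_onE//.
set A := (\int[leb]_(x in Theta) (`|u x - f x| `^ p)%:E)%E.
have -> : (\int[leb]_(x in Theta) (`|Q_abs Q (fun x => (g x - grad f x)%R) x| `^ p)%:E =
  \int[leb]_(x in Theta) (Q_abs Q (fun x => (g x - grad f x)%R) x `^ p)%:E)%E.
  by apply: eq_integral => x _; rewrite ger0_norm ?enorm_ge0.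
set B := (\int[leb]_(x in Theta) (Q_abs Q _ x `^ p)%:E)%E.
have A0 : (0 <= A)%E by apply: integral_ge0 => x _; rewrite lee_fin powR_ge0.
have B0 : (0 <= B)%E by apply: integral_ge0 => x _; rewrite lee_fin powR_ge0.
rewrite (pp _ A0) (pp _ B0) => H.
have : (A + B <= e%:E)%E.
  have e1 : (0 <= e%:E)%E by rewrite lee_fin ltW.
  have AB0 := adde_ge0 A0 B0.
  have : (((A + B) `^ p^-1) `^ p <= ((e `^ p^-1)%:E) `^ p)%E.
    apply: gt0_ler_poweR; rewrite ?(ltW p0)// ?in_itv/= ?leey ?andbT ?poweR_ge0//.
    - by rewrite lee_fin powR_ge0.
    - exact: ltW.
  by rewrite -poweR_EFin !pp.
move=> AB; split; apply: le_trans AB; [exact: (leeDl _ B0)|exact: (leeDr _ A0)].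
Qed.

Definition level_measure k : R := fine (leb (Theta `&` [set x | (k < `|u x|)%R])).

Let level_fin (A : set 'rV[R]_n.+1) : (leb (Theta `&` A) <= leb Theta)%E.
Proof. by apply: le_lebesgue_outer => x []. Qed.

Lemma level_measureE k : leb (Theta `&` [set x | (k < `|u x|)%R]) = (level_measure k)%:E.
Proof.
rewrite /level_measure fineK// ge0_fin_numE; last exact: measure_ge0.
exact: le_lt_trans (level_fin _) Theta_fin.
Qed.

Lemma level_measure_ge0 k : 0 <= level_measure k.
Proof. by rewrite fine_ge0//; exact: measure_ge0. Qed.

Lemma le_level_measure k h : k <= h -> level_measure h <= level_measure k.
Proof.
move=> kh; rewrite -lee_fin -!level_measureE; apply: le_lebesgue_outer => x [Tx /= hx].
by split => //=; exact: le_lt_trans hx.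
Qed.

Let Q_abs_triangle f x : Q_abs Q (grad f) x <=
  Q_abs Q g x + Q_abs Q (fun x => g x - grad f x) x.
Proof.
rewrite /Q_abs; set S := psd_sqrt (Q x).
have -> : mulv S (grad f x) = mulv S (g x) + (-1) *: mulv S (g x - grad f x).
  by rewrite -mulvZr -mulvDr scaleN1r opprB addrC subrK.
by apply: (le_trans (ler_enormD _ _)); rewrite enormZ normrN1 mul1r.
Qed.

Let theta : R := 1 - q^-1.

(** The passage between level sets of [u] and of [f], in both directions; by Chebyshev it costs
    [e / l^p]. *)
Let level_fM f l e : Lip0 Theta f -> 0 < l ->
  (\int[leb]_(x in Theta) (`|u x - f x| `^ p)%:E <= e%:E)%E -> forall D E,
  D `<=` E `|` [set x | (l < `|u x - f x|)%R] -> forall a : R,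
  (leb (Theta `&` E) <= a%:E)%E -> (leb (Theta `&` D) <= (a + e / l `^ p)%:E)%E.
Proof.
move=> f0 l0 ufe D E DE a Ea.
have muf : leb_measurable_fun Theta (fun x => u x - f x).
  apply: leb_measurableB => //; apply: continuous_leb_measurable.
  by apply: lipschitz_cont; exact: f0.1.
rewrite EFinD; apply: le_trans (leeD Ea (lebesgue_le_powR mT muf p0 l0 ufe)).
apply: le_trans (outer_measureU2 _ _ _).
apply: le_lebesgue_outer => x [Tx Dx].
by case: (DE x Dx) => ?; [left|right].
Qed.

Let Lnorm_real h : (Lnorm_on Theta p%:E h < +oo)%E -> exists W : R, 0 <= W /\
  (\int[leb]_(x in Theta) (`|h x| `^ p)%:E <= W%:E)%E.
Proof.
rewrite Lnorm_onE// => hfin; set I := (\int[leb]_(x in Theta) _)%E in hfin *.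
have I0 : (0 <= I)%E by apply: integral_ge0 => x _; rewrite lee_fin powR_ge0.
have Ifin : I \is a fin_num.
  rewrite ge0_fin_numE// ltNge leye_eq; apply/negP => /eqP IE.
  by move: hfin; rewrite IE poweRyr ?ltxx// gt_eqF ?invr_gt0.
exists (fine I); split; first exact: fine_ge0.
by rewrite fineK.
Qed.

(** [X] bounds the source term: [|T(f)| <= w / 4], and [T(f)] vanishes off a set of measure at most
    [2 * A]. Approximation errors raise the energy bound to [2^p * (2 * X)], for which [Z] is the
    weak-type bound at level [w / 8]. The second [Z] and the 2 in [2 * A] pay for exchanging [u] and
    [f]. *)
Lemma level_step k w (A := level_measure k) (X := w / 4 * (2 * (F * (2 * A) `^ theta)))
  (Z := C * (2 `^ p * (2 * X) / (w / 8) `^ p) `^ sigma) :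
  0 <= k -> 0 < w -> 0 < A -> level_measure (k + w) <= Z + Z.
Proof.
move=> k0 w0 A0; have [w1 F1] := (ltW w0, ltW F_gt0).
have A2 : 0 < 2 * A by exact: mulr_gt0.
have X0 : 0 < X by rewrite !mulr_gt0// ?divr_gt0// powR_gt0.
have w8 : 0 < w / 8 by rewrite divr_gt0.
have w4 : 0 < w / 4 by rewrite divr_gt0.
have Z0 : 0 < Z by rewrite mulr_gt0// powR_gt0// divr_gt0// ?powR_gt0// !mulr_gt0// powR_gt0.
have [[[_ ufin] [mg gfin] _] _] := weak.
have [Wg [Wg0 gW]] : exists W : R, 0 <= W /\
    (\int[leb]_(x in Theta) (Q_abs Q g x `^ p)%:E <= W%:E)%E.
  have [W [W0 gW]] := Lnorm_real (h := Q_abs Q g) gfin; exists W; split; first exact: W0.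
  apply: le_trans gW; apply: le_integral_nonneg => x _; first by rewrite lee_fin powR_ge0.
  by rewrite [ `|_|]ger0_norm ?enorm_ge0.
have [U [U0 uU]] : exists W : R, 0 <= W /\
    (\int[leb]_(x in Theta) (`|u x| `^ p)%:E <= W%:E)%E.
  exact: Lnorm_real ufin.
(* [d] and [e] depend on the solution through [Wg] and [U], but do not occur in the conclusion. The
   9 is the Lipschitz constant of the ramp; the 1 keeps the denominator positive. *)
pose d := X / (4 * (Wg + 9 * U + 1)).
have d0 : 0 < d by rewrite divr_gt0//; lra.
have P1 : 0 < (w / 4) `^ p by exact: powR_gt0.
have D1 : 0 < d `^ (1 - p) by exact: powR_gt0.
have dX : d * (Wg + 9 * U) <= X / 4.
  rewrite /d -[X / 4]mulr1 invfM mulrA -mulrA ler_pM2l ?divr_gt0//.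
  by rewrite mulrC ler_pdivrMr; lra.
have [e [e0 eA eZ eX eD]] : exists e : R, [/\ 0 < e, e / (w / 4) `^ p <= A,
    e / (w / 4) `^ p <= Z, e <= X / 2 & d `^ (1 - p) * ((1 + 9) * e) <= X / 4].
  pose e := Num.min (Num.min (A * (w / 4) `^ p) (Z * (w / 4) `^ p))
    (Num.min (X / 2) (X / (40 * d `^ (1 - p)))).
  exists e; split.
  - have i1 : 0 < X / (40 * d `^ (1 - p)) by rewrite divr_gt0// mulr_gt0.
    by rewrite /e !lt_min i1 (mulr_gt0 A0 P1) (mulr_gt0 Z0 P1) divr_gt0.
  - by rewrite ler_pdivrMr// !ge_min lexx.
  - by rewrite ler_pdivrMr// !ge_min lexx !orbT.
  - by rewrite !ge_min lexx !orbT.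
  - have : e <= X / (40 * d `^ (1 - p)) by rewrite !ge_min lexx !orbT.
    by rewrite ler_pdivlMr ?mulr_gt0//; lra.
have [f f0 [ufe Dfe]] := H1_approx e0.
have lf := f0.1.
(* The outer quarters of [k, k + w] are spent on [|u - f| <= w / 4]; the ramp rises in the middle
   half and reaches the height [w / 4]. *)
pose m := k + w / 4.
have m0 : 0 <= m by rewrite addr_ge0// ltW.
have w2 : 0 < w / 2 by rewrite divr_gt0.
pose T := ramp m (w / 2); pose T' := ramp' m (w / 2).
have T0 : T 0 = 0 by exact: ramp0.
have Tb t : `|T t| <= w / 4.
  by apply: (le_trans (ramp_bound m0 w2 t)); lra.
have T'b : forall t, 0 <= T' t <= 1 by exact: ramp'_bound.
have T_taylor : forall s t, `|T t - T s - T' s * (t - s)| <= 8 / (w / 2) * (t - s) ^+ 2.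
  by exact: ramp_taylor.
have T_lip : forall s t, `|T s - T t| <= 9 * `|s - t| by exact: ramp_lip.
have T'_lip : forall s t, `|T' s - T' t| <= 16 / (w / 2) * `|s - t| by exact: ramp'_lip.
have mf : leb_measurable_fun Theta f.
  by apply: continuous_leb_measurable; exact: lipschitz_cont.
have mT' : leb_measurable_fun Theta (T' \o f).
  apply: continuous_leb_measurable; apply: lipschitz_cont.
  exact: (lipschitz_comp_real lf T'_lip).
have aT : (leb (Theta `&` [set x | (m < `|f x|)%R]) <= (2 * A)%:E)%E.
  apply: (@le_trans _ _ (A + e / (w / 4) `^ p)%:E); last by rewrite lee_fin; lra.
  apply: (level_fM f0 w4 ufe (E := [set x | (k < `|u x|)%R])); last by rewrite level_measureE.
  move=> x /= mfx; have [le_uf|] := leP `|u x - f x| (w / 4); [left|by right].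
  have := ler_distD (u x) (f x) 0; rewrite !subr0 distrC => ?.
  rewrite /m in mfx; lra.
have phiT : (\int[leb]_(x in Theta) (`|phi x| * `|T (f x)|)%:E <= X%:E)%E.
  pose S := Theta `&` [set x | (m < `|f x|)%R].
  have mS : lmeasurable S by apply: leb_measurable_level => //; exact: leb_measurable_norm.
  have F0 : 0 < F `^ q by exact: powR_gt0.
  have q0 : 0 < q by exact: lt_trans q_gt1.
  have H := integral_powR_le (mu := leb) (h := fun x => `|phi x|) mT mS
    (@subIsetl _ _ _) (leb_measurable_norm phi_measurable) (fun x _ => normr_ge0 _) ltr01
    (ltW q_gt1) F0 A2 phi_le aT.
  rewrite div1r -powRrM mulfV ?gt_eqF// powRr1// in H.
  apply: (@le_trans _ _ (\int[leb]_(x in S) ((w / 4) * `|phi x|)%:E)%E).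
    rewrite integral_mkcond [leRHS]integral_mkcond; apply: le_integral_nonneg => x _.
      by rewrite patchE; case: ifP => // _; rewrite lee_fin mulr_ge0.
    rewrite !patchE; case: ifPn => Tx; last first.
      by rewrite memNset// => -[Tx' _]; move: Tx; rewrite mem_set.
    have [mfx|fxm] := ltP m `|f x|.
      rewrite mem_set; last by split => //; exact: set_mem.
      by rewrite lee_fin mulrC ler_wpM2r.
    rewrite memNset; last by move=> [_ /=]; rewrite ltNge fxm.
    by rewrite /T ramp_small// normr0 mulr0.
  under eq_integral do rewrite EFinM.
  have mphi := leb_measurable_EFin (leb_measurable_norm
    (leb_measurableS mT (@subIsetl _ _ [set x | (m < `|f x|)%R]) phi_measurable)).
  have phi0 x : S x -> (0 <= `|phi x|%:E)%E by rewrite lee_fin.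
  rewrite (ge0_integralZl_EFin leb mS phi0 mphi (ltW w4)).
  rewrite /X [leRHS]EFinM; apply: lee_wpmul2l; first by rewrite lee_fin ltW.
  by under eq_integral do rewrite -(@powRr1 _ `|phi _|)//.
have TG : (\int[leb]_(x in Theta) (T' (f x) * Q_abs Q g x `^ p)%:E <= (X + X / 2)%:E)%E.
  have phi_fin := le_lt_trans phi_le (ltry _).
  have T_sign : forall t, 0 <= t * T t by exact: ramp_sign.
  have L0 : 0 <= 9 :> R by [].
  apply: (le_trans (test_estimate Omega_open Theta_open ThetaO Theta_fin p_gt1 Q_psd Q_loc
    q_gt1 tau01 phi_measurable phi_fin weak T0 T_taylor T_lip T_sign Tb T'b T'_lip L0
    gW uU f0 d0 ufe Dfe)).
  by rewrite [leRHS]EFinD; apply: leeD phiT _; rewrite lee_fin; lra.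
pose v := T \o f; have v0 : Lip0 Theta v by exact: (Lip0_comp f0 T0 T_lip).
have en : (energy Theta p Q v <= (2 `^ p * (2 * X))%:E)%E.
  pose D x := Q_abs Q (fun x => g x - grad f x) x.
  have P2 : 0 <= 2 `^ p :> R by exact: powR_ge0.
  apply: (@le_trans _ _ (2 `^ p * (X + X / 2) + 2 `^ p * e)%:E); last first.
    by rewrite lee_fin -mulrDr ler_wpM2l//; lra.
  have mD : leb_measurable_fun Theta (fun x => D x `^ p).
    apply: leb_measurable_powR; apply: (Q_abs_measurable Omega_open Q_psd Q_loc mT ThetaO) => i.
    rewrite (_ : (fun x => _) = (fun x => g x 0 i - grad f x 0 i)).
      by apply: leb_measurableB => //; exact: grad_measurable.
    by apply/funext => x; rewrite !mxE.
  have mG : leb_measurable_fun Theta (fun x => T' (f x) * Q_abs Q g x `^ p).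
    apply: leb_measurableM mT' _; apply: leb_measurable_powR.
    exact: (Q_abs_measurable Omega_open Q_psd Q_loc mT ThetaO mg).
  have G0 x : 0 <= T' (f x) * Q_abs Q g x `^ p.
    by have /andP[? _] := T'b (f x); rewrite mulr_ge0// powR_ge0.
  have D0 x : 0 <= D x `^ p by exact: powR_ge0.
  apply: le_trans (integral_comb_le mT mG mD G0 D0 P2 P2 TG Dfe).
  apply: le_integral_nonneg => x Tx; first by rewrite lee_fin powR_ge0.
  have /andP[t0 t1] := T'b (f x).
  have Qv : Q_abs Q (grad v) x = T' (f x) * Q_abs Q (grad f) x.
    by rewrite /Q_abs (grad_comp _ lf T_taylor) mulvZr enormZ ger0_norm.
  rewrite lee_fin Qv -mulrDr.
  have GD : T' (f x) * Q_abs Q (grad f) x <= T' (f x) * Q_abs Q g x + T' (f x) * D x.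
    by rewrite -mulrDr ler_wpM2l//; exact: Q_abs_triangle.
  have q0 h : 0 <= Q_abs Q h x by exact: enorm_ge0.
  apply: (@le_trans _ _ ((T' (f x) * Q_abs Q g x + T' (f x) * D x) `^ p)).
    by apply: ge0_ler_powR => //; rewrite ?nnegrE ?addr_ge0 ?(ltW p0)//;
      apply: mulr_ge0 => //; exact: q0.
  apply: (le_trans (powR_sum_le (ltW p0) (mulr_ge0 t0 (q0 _)) (mulr_ge0 t0 (q0 _)))).
  rewrite ler_wpM2l// (powRM p t0 (q0 g)) (powRM p t0 (q0 _)).
  (* The gradient of [T \o f] brings the weight [T'^p], while [TG] has the weight [T']. *)
  have tp : T' (f x) `^ p <= T' (f x).
    move: t0 t1; rewrite le_eqVlt => /predU1P[<- _|t0 t1].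
      by rewrite powR0// gt_eqF.
    by rewrite ge1r_powR ?t0// ltW.
  apply: lerD; first by apply: ler_wpM2r tp; exact: powR_ge0.
  by rewrite -[leRHS]mul1r; apply: ler_wpM2r (le_trans tp t1); exact: powR_ge0.
have W0 : 0 < 2 `^ p * (2 * X) by rewrite !mulr_gt0// powR_gt0.
have lv := level_Theta v0 W0 en w8.
rewrite -lee_fin -level_measureE.
apply: (@le_trans _ _ (Z + e / (w / 4) `^ p)%:E); last by rewrite lee_fin; lra.
apply: (level_fM f0 w4 ufe _ lv) => x /= hx.
have [le_uf|] := leP `|u x - f x| (w / 4); [left|by right].
have := ler_distD (f x) (u x) 0; rewrite !subr0 => ?.
rewrite /v /= (ramp_large m0 w2); first lra.
by rewrite /m; lra.
Qed.

(** [level_step] with [w = h - k]: [X] is proportional to [w], so that [w^(p - 1)] remains in the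
    denominator before the power [sigma] is taken. *)
Lemma level_decay k h : 0 <= k -> k < h -> level_measure h <=
  (2 * C * (16 `^ p * 2 `^ theta) `^ sigma * F `^ sigma) / (h - k) `^ ((p - 1) * sigma) *
  level_measure k `^ (theta * sigma).
Proof.
move=> k0 kh; pose w := h - k; have w0 : 0 < w by rewrite subr_gt0.
have [w1 F1] := (ltW w0, ltW F_gt0).
have [A0|A0] := eqVneq (level_measure k) 0.
  apply: (@le_trans _ _ 0); first by rewrite -A0; apply: le_level_measure; exact: ltW.
  apply: mulr_ge0; last exact: powR_ge0.
  apply: divr_ge0; last exact: powR_ge0.
  by do 2! [apply: mulr_ge0; last exact: powR_ge0]; rewrite mulr_ge0// ltW.
have Ap : 0 < level_measure k by rewrite lt_def A0 level_measure_ge0.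
have := level_step k0 w0 Ap; rewrite {1}/w addrC subrK => aZ.
apply: (le_trans aZ); rewrite le_eqVlt; apply/orP; left; apply/eqP.
rewrite -/w; set A := level_measure k in Ap *.
have -> : 2 `^ p * (2 * (w / 4 * (2 * (F * (2 * A) `^ theta)))) / (w / 8) `^ p =
    16 `^ p * 2 `^ theta * F * A `^ theta / w `^ (p - 1).
  rewrite (powR_div _ w1)// (powRM _ _ (ltW Ap))//.
  have -> : 16 = 2 * 8 :> R by ring.
  rewrite (powRM p (x := 2) (y := 8))// -(mulr_powRB1 w1 p0); field.
  by rewrite !gt_eqF ?powR_gt0.
have [P1 P2 P3] : [/\ 0 <= 16 `^ p :> R, 0 <= 2 `^ theta :> R & 0 <= A `^ theta].
  by split; exact: powR_ge0.
have P4 : 0 <= 16 `^ p * 2 `^ theta * F by rewrite !mulr_ge0.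
rewrite (powR_div _ (mulr_ge0 P4 P3) (powR_ge0 _ _)) (powRM _ P4 P3).
rewrite (powRM _ (mulr_ge0 P1 P2) F1) -!powRrM.
ring.
Qed.

(** The 1 in [V] keeps it positive when [Theta] is empty. In Stampacchia's constant [F] occurs as
    [F^sigma] under the power [1 / ((p - 1) * sigma)], which gives the homogeneity [1 / (p - 1)]. *)
Lemma esssup_le_level (V := fine (leb Theta) + 1) (de := theta * sigma)
  (c := (2 * C * (16 `^ p * 2 `^ theta) `^ sigma * V `^ (de - 1)) `^ ((p - 1) * sigma)^-1 *
    2 `^ (de / (de - 1))) : 0 < sigma -> 1 < de ->
  (esssup_on Theta (fun x => `|u x|%R) <= (c * F `^ (p - 1)^-1)%:E)%E.
Proof.
move=> sigma0 de1; have V0 : 0 < V.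
  by apply: ltr_wpDl => //; exact: fine_ge0 (measure_ge0 leb Theta).
have p1 : 0 < p - 1 by rewrite subr_gt0.
have P16 : 0 < (16 `^ p * 2 `^ theta) `^ sigma :> R by rewrite powR_gt0// mulr_gt0 ?powR_gt0.
have K0 : 0 < 2 * C * (16 `^ p * 2 `^ theta) `^ sigma by rewrite !mulr_gt0.
have Fs : 0 < F `^ sigma by exact: powR_gt0.
have aV k : 0 <= k -> 0 <= level_measure k <= V.
  move=> _; rewrite level_measure_ge0/= -lee_fin -level_measureE.
  apply: (le_trans (level_fin _)); rewrite -[leLHS]fineK ?lee_fin ?lerDl//.
  by rewrite ge0_fin_numE//; exact: measure_ge0.
have := stampacchia (mulr_gt0 K0 Fs) (mulr_gt0 p1 sigma0) de1 V0 aV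
  (fun k h _ => @le_level_measure k h) (fun k h => @level_decay k h).
set l := (X in level_measure X) => l0.
have -> : c * F `^ (p - 1)^-1 = l.
  have Fe : (F `^ sigma) `^ ((p - 1) * sigma)^-1 = F `^ (p - 1)^-1.
    by rewrite -powRrM; congr (_ `^ _); field; rewrite !gt_eqF.
  have VP : 0 < V `^ (de - 1) by exact: powR_gt0.
  rewrite /l /c -Fe [_ * F `^ sigma * V `^ _]mulrAC.
  by rewrite (powRM _ (ltW (mulr_gt0 K0 VP)) (ltW Fs)); ring.
have lg : 0 <= l by apply: mulr_ge0; exact: powR_ge0.
apply/ess_supP; exists (Theta `&` [set x | (l < `|u x|)%R]); split.
- by apply: leb_measurable_level => //; exact: leb_measurable_norm.
- by have := level_measureE l; rewrite l0.
- move=> x /= /negP; rewrite patchE; case: ifPn => Tx; rewrite -ltNge lte_fin.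
    by split => //; exact: set_mem.
  by rewrite ltNge lg.
Qed.

End level_decay.

Theorem proposition5p1 (R : realType) (n : nat)
    (Omega : set 'rV[R]_n.+1) (rho : 'rV[R]_n.+1 -> 'rV[R]_n.+1 -> R)
    (Omega_open : open Omega) (Omega_connected : connected Omega)
    (rho_qmetric : quasi_metric Omega rho)
    (rho_measurable : forall x r, Omega x -> 0 < r ->
      (@lebesgue_outer R n).-cara.-measurable (qball Omega rho x r))
    (rho_compatible : euclidean_compatible Omega rho)
    (p : R) (t : \bar R) (p_gt1 : 1 < p) (t_gt1 : (1 < t)%E)
    (Q : 'rV[R]_n.+1 -> 'M[R]_n.+1)
    (Q_psd : forall x, Omega x -> psd (Q x))
    (Q_loc : Lloc_matrix Omega (p / 2) Q)
    (sigma : R) (s : \bar R) (r1 : 'rV[R]_n.+1 -> R)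
    (sigma_ge1 : 1 <= sigma)
    (s_pt : s = (p%:E * t)%E)
    (s_gt : (p%:E * hoelder_conjugate sigma%:E < s)%E)
    (r1_gt0 : forall x, Omega x -> 0 < r1 x)
    (r1_continuous : {within Omega, continuous r1})
    (cutoff : cutoff_condition Omega rho Q r1 s)
    (poincare : local_poincare Omega rho Q r1 p (hoelder_conjugate t))
    (sobolev : local_sobolev Omega rho Q r1 p sigma)
    (Theta : set 'rV[R]_n.+1)
    (Theta_open : open Theta) (Theta_inside : compactly_inside Theta Omega)
    (q : R) (q_ge : (hoelder_conjugate p%:E <= q%:E)%E)
    (q_gt : (p%:E * hoelder_conjugate sigma%:E < q%:E)%E) :
  exists2 C : R, 0 < C &
  forall (phi : 'rV[R]_n.+1 -> R) (tau : R)
    (u : 'rV[R]_n.+1 -> R) (g : 'rV[R]_n.+1 -> 'rV[R]_n.+1),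
    Lp Theta q%:E phi -> 0 < tau < 1 ->
    weak_solution Theta p Q tau phi u g ->
    (esssup_on Theta (fun x => `|u x|%R)
       <= C%:E * Lnorm_on Theta q%:E phi `^ (p - 1)^-1)%E.
Proof.
have ThetaO : Theta `<=` Omega.
  by apply: subset_trans Theta_inside.2; exact: subset_closure.
have Theta_fin : (leb Theta < +oo)%E by exact: bounded_lebesgue_fin Theta_inside.1.
have p0 : 0 < p by exact: lt_trans p_gt1.
(* For [sigma = 1] the conjugate exponent would be infinite, and no finite [q] lies above it. *)
have sigma_gt1 : (1 < sigma%:E)%E.
  rewrite lte_fin lt_neqAle sigma_ge1 andbT; apply/eqP => s1.
  by move: q_gt; rewrite -s1 hoelder_conjugate1 mulry gtr0_sg// mul1e.
have sigma0 : 0 < sigma by exact: lt_le_trans sigma_ge1.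
have [a [aE a1 [[//]|[_ _ [[<-] ia]]]]] := hoelder_conjugate_gt1 sigma_gt1.
move: q_gt; rewrite aE -EFinM lte_fin => paq.
have a0 : 0 < a by exact: lt_le_trans a1.
have aq : a < q by apply: lt_trans paq; rewrite ltr_pMl.
have q_gt1 : 1 < q by exact: le_lt_trans aq.
have q0 : 0 < q by exact: lt_trans q_gt1.
(* Here [a] is the conjugate of [sigma], and the claim is [a < q] rewritten. *)
have de1 : 1 < (1 - q^-1) * sigma.
  rewrite -ltr_pdivrMr// div1r ltrBrDl -ltrBrDr -ia ltf_pV2//.
rewrite s_pt in cutoff.
have [C C0 lev] := weak_sobolev Omega_open Omega_connected rho_measurable rho_compatible
  p_gt1 t_gt1 Q_psd Q_loc sigma0 r1_gt0 cutoff poincare sobolev Theta_open Theta_inside.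
pose de := (1 - q^-1) * sigma; pose V := fine (leb Theta) + 1.
pose c := (2 * C * (16 `^ p * 2 `^ (1 - q^-1)) `^ sigma * V `^ (de - 1)) `^
  ((p - 1) * sigma)^-1 * 2 `^ (de / (de - 1)).
have V0 : 0 < V.
  by apply: ltr_wpDl => //; exact: fine_ge0 (measure_ge0 leb Theta).
have c0 : 0 < c.
  by rewrite mulr_gt0 ?powR_gt0// !mulr_gt0 ?powR_gt0// mulr_gt0 ?powR_gt0.
exists c => // phi tau u g [mphi phi_fin] tau01 weak.
have bound F : 0 < F -> (\int[leb]_(x in Theta) (`|phi x| `^ q)%:E <= (F `^ q)%:E)%E ->
    (esssup_on Theta (fun x => `|u x|%R) <= (c * F `^ (p - 1)^-1)%:E)%E.
  move=> F0 phiF.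
  exact: (esssup_le_level Omega_open Theta_open ThetaO Theta_fin p_gt1 Q_psd Q_loc q_gt1
    tau01 C0 F0 mphi phiF weak lev sigma0 de1).
set N := Lnorm_on Theta q%:E phi in phi_fin *.
have N_ge0 : (0 <= N)%E by exact: Lnorm_ge0.
have NE : (\int[leb]_(x in Theta) (`|phi x| `^ q)%:E = N `^ q)%E.
  rewrite /N Lnorm_onE// -poweRrM mulVf ?gt_eqF// poweRe1//.
  by apply: integral_ge0 => x _; rewrite lee_fin powR_ge0.
have Nfin : N \is a fin_num by rewrite ge0_fin_numE.
have [r rE] : exists r : R, N = r%:E by exists (fine N); rewrite fineK.
rewrite rE lee_fin in N_ge0; rewrite rE -EFinM.
have [r0|r0] := eqVneq r 0; last first.
  apply: bound; first by rewrite lt_def r0.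
  by rewrite NE rE.
rewrite r0 powR0 ?mulr0; last by rewrite gt_eqF// invr_gt0 subr_gt0.
(* For a vanishing norm there is no positive [F] to take directly; [F = (d / c)^(p - 1)] turns the
   bound into the arbitrary [d > 0]. *)
apply/lee_addgt0Pr => d d0; rewrite add0e.
have F0 : 0 < (d / c) `^ (p - 1) by rewrite powR_gt0// divr_gt0.
apply: (le_trans (bound _ F0 _)).
  by rewrite NE rE r0 poweR_EFin powR0 ?gt_eqF// lee_fin powR_ge0.
have p1 : p - 1 != 0 by rewrite gt_eqF// subr_gt0.
rewrite lee_fin -powRrM (mulfV p1) powRr1 ?divr_ge0 ?(ltW d0) ?(ltW c0)//.
by rewrite mulrC divfK// gt_eqF.
Qed.
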